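(* Let $n\in\mathbb{N}$, $r>0$, $T>0$, and let $D\subset\mathbb{R}^n$ be a convex domain of class $\mathcal{C}^{1,1}_r$. There is a constant $C=C(n,r,T)>0$ such that for all $x,y\in D$ and $0<t<T$, $$p_D(t,x,y)\geq C\, p(t,x,y)\left(1\wedge \frac{\delta_{D}(x)\left(\delta_{D}\left(\frac{x+y}2\right)+\sqrt t\right)}{t}\right)\left(1\wedge \frac{\delta_{D}(y)\left(\delta_{D}\left(\frac{x+y}{2}\right)+\sqrt t\right)}{t}\right).$$ Moreover, the right-hand side is comparable to $$C\, p(t,x,y)\left[\left(1\wedge\frac{\delta_D(x)\delta_D(y)}{t}\right)+\left(1\wedge \frac{\delta_{D}(x)\delta_{D}\left(\frac{x+y}2\right)}{t}\right)\left(1\wedge \frac{\delta_{D}(y)\delta_{D}\left(\frac{x+y}{2}\right)}{t}\right)\right],$$ that is, the ratio of the two expressions is bounded from above and below by positive constants depending at most on $n$.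
   Context: A domain is an open connected subset of $\mathbb{R}^n$ (here with nonempty boundary). $a\wedge b=\min\{a,b\}$. $p(t,x,y)=(4\pi t)^{-n/2}e^{-|x-y|^2/(4t)}$ is the global heat kernel of the Laplacian $\Delta$ on $\mathbb{R}^n$. $p_D(t,x,y)$ is the Dirichlet heat kernel of $D$: the fundamental solution of the heat equation $\partial_t u=\Delta u$ in $D$ with Dirichlet condition on $\partial D$; equivalently, the transition density of Brownian motion (normalized to have transition density $p(t,x,y)$) killed upon leaving $D$. $\delta_D(x)$ is the distance from $x\in D$ to $\partial D$. A $\mathcal{C}^{1,1}$ set is one whose boundary is locally the graph of a $\mathcal{C}^{1,1}$ function; $\mathcal{C}^{1,1}_r(\mathbb{R}^n)$ denotes the class of $\mathcal{C}^{1,1}$ sets such that for every boundary point $z\in\partial D$ there are two balls of radius at least $r$ tangent to $D$ at $z$, one contained in $D$ and the other in $D^c$. *)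

(* Defs.v *)
From mathcomp Require Export all_boot all_order all_algebra.
From mathcomp Require Export all_classical all_reals all_analysis.
Export Order.TTheory GRing.Theory Num.Theory.
Export numFieldNormedType.Exports.

Set Implicit Arguments.
Unset Strict Implicit.
Unset Printing Implicit Defensive.

#[export] Set Implicit Arguments.
#[export] Unset Strict Implicit.
#[export] Unset Printing Implicit Defensive.

Global Open Scope classical_set_scope.
Global Open Scope ring_scope.

(* R^n is 'rV[R]_n.  The library norm on 'rV[R]_n is the sup norm: it is used
   for the topology only, and the Euclidean structure is defined here. *)

Definition dot (R : realType) (n : nat) (x y : 'rV[R]_n) : R :=
  \sum_(i < n) x 0 i * y 0 i.

Definition enorm (R : realType) (n : nat) (x : 'rV[R]_n) : R :=
  Num.sqrt (dot x x).

Definition eball (R : realType) (n : nat) (c : 'rV[R]_n) (rho : R)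
  : set 'rV[R]_n := [set y | enorm (y - c) < rho].

Definition boundary (T : topologicalType) (D : set T) : set T :=
  closure D `\` interior D.

Definition bdist (R : realType) (n : nat) (D : set 'rV[R]_n) (x : 'rV[R]_n)
  : R := inf [set enorm (x - z) | z in boundary D].

Definition midpoint (R : realType) (n : nat) (x y : 'rV[R]_n) : 'rV[R]_n :=
  2^-1 *: (x + y).

Definition domain (R : realType) (n : nat) (D : set 'rV[R]_n) : Prop :=
  [/\ open D, connected D & boundary D !=set0].

Definition basis_vec (R : realType) (n : nat) (i : 'I_n) : 'rV[R]_n :=
  delta_mx 0 i.

Definition C11_function (R : realType) (n : nat) (phi : 'rV[R]_n -> R) : Prop :=
  (forall x, differentiable phi x) /\
  (forall i : 'I_n,
     exists k : R, k.-lipschitz (fun x => 'D_(basis_vec R i) phi x)).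

(* Near z, in orthonormal coordinates centred at z with last axis nu, the
   boundary is the graph of phi over the hyperplane orthogonal to nu.  A
   function on that hyperplane is represented by a function phi on R^n,
   evaluated at orthogonal projections only. *)
Definition C11_set (R : realType) (n : nat) (D : set 'rV[R]_n) : Prop :=
  forall z, boundary D z ->
  exists (nu : 'rV[R]_n) (rho : R) (phi : 'rV[R]_n -> R),
    [/\ enorm nu = 1, 0 < rho, C11_function phi &
        forall x, eball z rho x ->
          (boundary D x <->
           dot (x - z) nu = phi ((x - z) - dot (x - z) nu *: nu))].

Definition C11_class (R : realType) (n : nat) (r : R) (D : set 'rV[R]_n)
  : Prop :=
  C11_set D /\
  forall z, boundary D z ->
    (exists (c : 'rV[R]_n) (rho : R),
       [/\ r <= rho, enorm (z - c) = rho & eball c rho `<=` D]) /\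
    (exists (c : 'rV[R]_n) (rho : R),
       [/\ r <= rho, enorm (z - c) = rho & eball c rho `<=` ~` D]).

Definition gauss_kernel (R : realType) (n : nat) (t : R) (x y : 'rV[R]_n) : R :=
  (4 * pi * t) `^ (- (n%:R / 2)) * expR (- (enorm (x - y) ^+ 2 / (4 * t))).

(* Integral over R^n as n successive one-dimensional Lebesgue integrals; it is
   used below for continuous compactly supported integrands only. *)
Fixpoint integral_rV (R : realType) (n : nat) : ('rV[R]_n -> R) -> R :=
  match n with
  | 0 => fun g => g 0
  | m.+1 => fun g =>
      \int[@lebesgue_measure R]_(s in setT)
        integral_rV (fun v : 'rV[R]_m => g (row_mx (s%:M : 'rV[R]_1) v))
  end.

(* Regularity C^1 in time and C^2 in space on (0, +oo) x D. *)
Definition C12_on (R : realType) (n : nat) (D : set 'rV[R]_n)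
    (u : R -> 'rV[R]_n -> R) : Prop :=
  forall t x, 0 < t -> D x ->
  [/\ derivable (u^~ x) t 1,
      forall i, derivable (u t) x (basis_vec R i) &
      forall i j,
        derivable (fun y => 'D_(basis_vec R j) (u t) y) x (basis_vec R i)] /\
  [/\ {for (t, x), continuous (fun q : R * 'rV[R]_n => u q.1 q.2)},
      {for (t, x), continuous (fun q : R * 'rV[R]_n => derive1 (u^~ q.2) q.1)},
      forall i, {for (t, x), continuous (fun q : R * 'rV[R]_n =>
        'D_(basis_vec R i) (u q.1) q.2)} &
      forall i j, {for (t, x), continuous (fun q : R * 'rV[R]_n =>
        'D_(basis_vec R i) (fun y => 'D_(basis_vec R j) (u q.1) y) q.2)}].

Definition laplacian (R : realType) (n : nat) (g : 'rV[R]_n -> R)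
    (x : 'rV[R]_n) : R :=
  \sum_(i < n) 'D_(basis_vec R i) (fun y => 'D_(basis_vec R i) g y) x.

Definition heat_solution (R : realType) (n : nat) (D : set 'rV[R]_n)
    (u : R -> 'rV[R]_n -> R) : Prop :=
  C12_on D u /\
  forall t x, 0 < t -> D x -> derive1 (u^~ x) t = laplacian (u t) x.

(* (s, x) tends to (t, z) inside (0, +oo) x D. *)
Definition parabolic_nbhs (R : realType) (n : nat) (D : set 'rV[R]_n)
    (t : R) (z : 'rV[R]_n) : set_system (R * 'rV[R]_n) :=
  within [set q : R * 'rV[R]_n | 0 < q.1 /\ D q.2] (nbhs (t, z)).

Definition dirichlet_condition (R : realType) (n : nat) (D : set 'rV[R]_n)
    (u : R -> 'rV[R]_n -> R) : Prop :=
  forall t z, 0 < t -> boundary D z ->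
    u q.1 q.2 @[q --> parabolic_nbhs D t z] --> (0 : R).

Definition initial_condition (R : realType) (n : nat) (D : set 'rV[R]_n)
    (u : R -> 'rV[R]_n -> R) (f : 'rV[R]_n -> R) : Prop :=
  forall x0, closure D x0 ->
    u q.1 q.2 @[q --> parabolic_nbhs D 0 x0] --> f x0.

Definition bounded_solution (R : realType) (n : nat) (D : set 'rV[R]_n)
    (u : R -> 'rV[R]_n -> R) : Prop :=
  exists M : R, forall t x, 0 < t -> D x -> `|u t x| <= M.

Definition compactly_supported_in (R : realType) (n : nat) (D : set 'rV[R]_n)
    (f : 'rV[R]_n -> R) : Prop :=
  continuous f /\
  exists K : set 'rV[R]_n,
    [/\ compact K, K `<=` D & forall y, ~ K y -> f y = 0].

(* pD is the fundamental solution of the heat equation in D with Dirichlet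
   condition: for every initial datum f in C_c(D), the function
   u(t, x) = \int_D pD(t, x, y) f(y) dy is the bounded classical solution of the
   Cauchy-Dirichlet problem.  Boundedness is what makes that solution unique
   when D is unbounded; with the continuity of pD it determines pD on
   (0, +oo) x D x D.  The values of pD elsewhere are irrelevant. *)
Definition dirichlet_heat_kernel (R : realType) (n : nat) (D : set 'rV[R]_n)
    (pD : R -> 'rV[R]_n -> 'rV[R]_n -> R) : Prop :=
  [/\ forall t x y, 0 < t -> D x -> D y ->
        {for (t, x, y), continuous (fun q : R * 'rV[R]_n * 'rV[R]_n =>
           pD q.1.1 q.1.2 q.2)},
      forall y, D y ->
        heat_solution D (fun t x => pD t x y) /\
        dirichlet_condition D (fun t x => pD t x y) &
      forall f, compactly_supported_in D f ->
        let u t x := integral_rV (patch (cst 0) D (fun y => pD t x y * f y)) in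
        [/\ heat_solution D u, dirichlet_condition D u,
            initial_condition D u f & bounded_solution D u]].

Definition lower_profile (R : realType) (n : nat) (D : set 'rV[R]_n)
    (t : R) (x y : 'rV[R]_n) : R :=
  Num.min 1 (bdist D x * (bdist D (midpoint x y) + Num.sqrt t) / t) *
  Num.min 1 (bdist D y * (bdist D (midpoint x y) + Num.sqrt t) / t).

Definition sum_profile (R : realType) (n : nat) (D : set 'rV[R]_n)
    (t : R) (x y : 'rV[R]_n) : R :=
  Num.min 1 (bdist D x * bdist D y / t) +
  Num.min 1 (bdist D x * bdist D (midpoint x y) / t) *
  Num.min 1 (bdist D y * bdist D (midpoint x y) / t).

(* Main.v *)
Require Import Defs.
From mathcomp Require Import ring lra measurable_realfun.

(** Write a lower barrier as [p(s, x, y) g(s, x)], with the pole [y] of the exact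
    Gaussian kept throughout.  It is a subsolution of the heat equation iff
    [g_s + ((x - y) / s) . grad g <= Laplacian g], and this condition is invariant
    under the change of variable [x -> x - s v].  So [g] may be supported in a ball
    whose centre moves on a straight line, and no Gaussian factor is ever compared
    with another one.

    Let [delta] be the distance to the boundary, [d] the sum of [sqrt t] and of
    [delta] at the midpoint, and [rad = t / (Lam d)] with [Lam] large.  Put balls of
    radius [rad] in [D], tangent to the boundary, near [y] and near [x] (centres [c]
    and [c']), and move a ball from [c] at time [0] to [c'] at time [t].  Up to time
    [rad ^ 2] its radius is [rad] and the barrier starts from the pole [y]; then its
    radius grows to the order of [d] and shrinks back to [rad], which convexity of
    [D] permits.  Both barriers vanish linearly at the boundary of the ball, and this
    produces the factors [min 1 (delta y / rad)] and [min 1 (delta x / rad)], while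
    the long middle part costs only a constant because the integral of
    [radius ^ -2] over time is of order [t / (rad d)], that is [Lam]. *)

(** * Euclidean norm *)

Section euclid.
Variables (R : realType) (n : nat).
Implicit Types x y z u v : 'rV[R]_n.

(** The size of [rad] is forced from both sides. In the frame of the moving ball the drift
    [(x - y) / s] becomes [(B + e) / s], with [B] the position relative to the moving centre and
    [e = c - y] the offset of the pole. The part along [B] points outward, which favours a barrier
    that decreases outward and leaves room for the radius to grow, as long as radius over time
    decreases. The part along [e] has no sign and is harmless only if [rad] times the radius is at
    most of order [s], that is, [rad * d <= t] up to a constant. Conversely the cost of the long
    stage, of order [t / (rad d)], is bounded only if [t] is at most of order [rad * d]. Hence [rad]
    is of order [t / d], and [delta / rad] is the quantity [delta d / t] of the statement. The
    remaining constraint [rad <= r] makes [Lam] depend on [r] and [T].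

    A single bump with linear vanishing cannot start at the pole: for times below [rad ^ 2] the
    boundary correction depends on [rho rhoy / s] and disappears in the interior as [s] tends to 0.
    This is why there are two barriers, glued at time [rad ^ 2], where the correction has become a
    product. *)

Lemma dotC x y : dot x y = dot y x.
Proof. by apply: eq_bigr => i _; rewrite mulrC. Qed.

Lemma dotDl x y z : dot (x + y) z = dot x z + dot y z.
Proof. by rewrite -big_split; apply: eq_bigr => i _; rewrite mxE mulrDl. Qed.

Lemma dotZl a x y : dot (a *: x) y = a * dot x y.
Proof. by rewrite mulr_sumr; apply: eq_bigr => i _; rewrite mxE mulrA. Qed.

Lemma dotDr x y z : dot z (x + y) = dot z x + dot z y.
Proof. by rewrite !(dotC z) dotDl. Qed.

Lemma dotZr a x y : dot x (a *: y) = a * dot x y.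
Proof. by rewrite !(dotC x) dotZl. Qed.

Lemma dotNl x y : dot (- x) y = - dot x y.
Proof. by rewrite -scaleN1r dotZl mulN1r. Qed.

Lemma dotNr x y : dot x (- y) = - dot x y.
Proof. by rewrite -scaleN1r dotZr mulN1r. Qed.

Lemma dot0l x : dot 0 x = 0.
Proof. by rewrite -(scale0r 0) dotZl mul0r. Qed.

Definition dotE := (dotDl, dotDr, dotNl, dotNr, dotZl, dotZr).

Lemma dot_ge0 x : 0 <= dot x x.
Proof. by apply: sumr_ge0 => i _; rewrite -expr2 sqr_ge0. Qed.

Lemma dot_eq0 x : dot x x = 0 -> x = 0.
Proof.
move=> x0; apply/rowP => i; rewrite mxE.
have : forall i, true -> 0 <= x 0 i * x 0 i by move=> j _; rewrite -expr2 sqr_ge0.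
move=> /psumr_eq0P /(_ x0) /(_ i isT) /eqP.
by rewrite mulf_eq0 orbb => /eqP ->.
Qed.

Lemma enorm_ge0 x : 0 <= enorm x.
Proof. exact: sqrtr_ge0. Qed.

Lemma sqr_enorm x : enorm x ^+ 2 = dot x x.
Proof. by rewrite sqr_sqrtr// dot_ge0. Qed.

Lemma enorm0 : enorm (0 : 'rV[R]_n) = 0.
Proof. by rewrite /enorm -[X in dot X](scale0r 0) dotZl mul0r sqrtr0. Qed.

Lemma enorm_eq0 x : enorm x = 0 -> x = 0.
Proof. by move=> x0; apply: dot_eq0; rewrite -sqr_enorm x0 expr0n. Qed.

Lemma enormZ a x : enorm (a *: x) = `|a| * enorm x.
Proof.
by rewrite /enorm dotZl dotZr mulrA -expr2 sqrtrM ?sqr_ge0// sqrtr_sqr.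
Qed.

Lemma enormN x : enorm (- x) = enorm x.
Proof. by rewrite /enorm dotNl dotNr opprK. Qed.

Lemma enormB x y : enorm (x - y) = enorm (y - x).
Proof. by rewrite -enormN opprB. Qed.

Lemma dot_le x y : dot x y <= enorm x * enorm y.
Proof.
have [y0|y0] := eqVneq (enorm y) 0.
  by rewrite (enorm_eq0 y0) -[X in dot _ X](scale0r 0) dotZr mul0r enorm0 mulr0.
have yp : 0 < enorm y by rewrite lt_def y0 enorm_ge0.
have [x0|x0] := eqVneq (enorm x) 0.
  by rewrite (enorm_eq0 x0) -[X in dot X](scale0r 0) dotZl mul0r enorm0 mul0r.
have xp : 0 < enorm x by rewrite lt_def x0 enorm_ge0.
have := dot_ge0 (enorm y *: x - enorm x *: y).
rewrite !dotE (dotC y x) -!sqr_enorm => h.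
rewrite -(ler_pM2l (mulr_gt0 xp yp)); nra.
Qed.

Lemma dot_sqr_le x y : dot x y ^+ 2 <= dot x x * dot y y.
Proof.
have h1 := dot_le x y; have h2 := dot_le (- x) y.
move: h2; rewrite dotNl enormN => h2.
have := enorm_ge0 x; have := enorm_ge0 y.
rewrite -!sqr_enorm => y0 x0; rewrite -exprMn.
have e0 : 0 <= enorm x * enorm y by rewrite mulr_ge0.
by nra.
Qed.

(** The left side is the square of [dot (B + e) (e - B)]; Cauchy-Schwarz and [|e - B| <= 2 r]
    conclude. In the pole barrier it bounds the difference of the two depths [rho], [rhoy] by the
    distance between the point and the pole. *)
Lemma sqdiff_dot_le (B e : 'rV[R]_n) (r : R) : 0 < r ->
  dot B B <= r ^+ 2 -> dot e e <= r ^+ 2 ->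
  (dot e e - dot B B) ^+ 2 <= 4 * r ^+ 2 * (dot B B + 2 * dot e B + dot e e).
Proof.
move=> r0 hB he.
have := dot_sqr_le (B + e) (e - B).
have -> : dot (B + e) (e - B) = dot e e - dot B B.
  by rewrite !dotE (dotC B e); ring.
have -> : dot (B + e) (B + e) = dot B B + 2 * dot e B + dot e e.
  by rewrite !dotE (dotC B e); ring.
have E1 : dot (e - B) (e - B) = dot e e - 2 * dot e B + dot B B.
  by rewrite !dotE (dotC B e); ring.
rewrite E1 => h; apply: le_trans h _.
have p0 : 0 <= dot B B + 2 * dot e B + dot e e.
  have := dot_ge0 (B + e); rewrite !dotE (dotC B e); lra.
rewrite [leRHS]mulrC ler_wpM2l//; lra.
Qed.

Lemma ler_enormD x y : enorm (x + y) <= enorm x + enorm y.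
Proof.
rewrite -(@ler_pXn2r _ 2) ?nnegrE ?addr_ge0 ?enorm_ge0//.
rewrite sqr_enorm !dotE (dotC y x) -!sqr_enorm.
by have := dot_le x y; nra.
Qed.

Lemma ler_enormB z x y : enorm (x - y) <= enorm (x - z) + enorm (z - y).
Proof. by have := ler_enormD (x - z) (z - y); rewrite addrA subrK. Qed.

Lemma coord_le_enorm x i : `|x 0 i| <= enorm x.
Proof.
rewrite -sqrtr_sqr ler_sqrt ?dot_ge0// /dot (bigD1 i)//= expr2 lerDl.
by apply: sumr_ge0 => j _; rewrite -expr2 sqr_ge0.
Qed.

Lemma mx_norm_le_enorm x : `|x| <= enorm x.
Proof.
rewrite [leLHS]/Num.norm /= mx_normrE; apply/bigmax_leP; split => /=.
  exact: enorm_ge0.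
by move=> [i j] _; rewrite (ord1 i) coord_le_enorm.
Qed.

Lemma continuous_dot (T : topologicalType) (f g : T -> 'rV[R]_n) (q : T) :
  {for q, continuous f} -> {for q, continuous g} ->
  {for q, continuous (fun p => dot (f p) (g p))}.
Proof.
move=> cf cg.
change (\sum_(i < n) f p 0 i * g p 0 i @[p --> q] -->
        \sum_(i < n) f q 0 i * g q 0 i).
elim: (index_enum _) => [|i r IH].
  by under eq_fun do rewrite big_nil; rewrite big_nil; exact: cvg_cst.
under eq_fun do rewrite big_cons; rewrite big_cons.
apply: cvgD IH; apply: cvgM.
  exact: (continuous_cvg _ (@coord_continuous R 1 n 0 i (f q)) cf).
exact: (continuous_cvg _ (@coord_continuous R 1 n 0 i (g q)) cg).
Qed.

Lemma continuous_enorm (T : topologicalType) (f : T -> 'rV[R]_n) (q : T) :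
  {for q, continuous f} -> {for q, continuous (fun p => enorm (f p))}.
Proof.
move=> cf; apply: (@continuous_comp _ _ _ (fun p => dot (f p) (f p)) Num.sqrt).
  exact: continuous_dot.
exact: sqrt_continuous.
Qed.

Lemma continuous_subr x y : {for y, continuous (fun z => z - x)}.
Proof.
exact: (@cvgB _ _ _ (nbhs y) _ _ _ _ _ (fun _ h => h) (cvg_cst x)).
Qed.

Lemma nbhs_eball x (A : set 'rV[R]_n) :
  nbhs x A -> exists2 rho, 0 < rho & eball x rho `<=` A.
Proof.
move=> /nbhs_ballP[e /= e0 xA]; exists e => // y xy; apply: xA.
rewrite mx_norm_ball /ball_ /=; apply: le_lt_trans xy.
by rewrite enormB mx_norm_le_enorm.
Qed.

Lemma bounded_enorm (A : set 'rV[R]_n) (M : R) :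
  (forall x, A x -> enorm x <= M) -> bounded_set A.
Proof.
move=> AM; exists M; split; first exact: num_real.
by move=> a Ma x /AM xM; apply: le_trans (mx_norm_le_enorm x) (le_trans xM (ltW Ma)).
Qed.

Lemma closed_eball_compact x rho : compact [set y | enorm (y - x) <= rho].
Proof.
apply: bounded_closed_compact.
  apply: (@bounded_enorm _ (rho + enorm x)) => y /= xy.
  by rewrite -(subrK x y); apply: le_trans (ler_enormD _ _) _; rewrite lerD2r.
have h : continuous (fun y => enorm (y - x)).
  by move=> y; exact: (continuous_enorm (@continuous_subr x y)).
apply: (@preimage_closed _ _ _ [set a | a <= rho]); last exact: closed_le.
by move=> y _; exact: h.
Qed.

End euclid.

(** * Derivative tests and jets *)

Section calculus.
Variable R : realType.
Implicit Types f g : R -> R.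

Lemma exists_lt2 (a b : R) : 0 < a -> 0 < b ->
  exists k, [/\ 0 < k, k < a & k < b].
Proof.
move=> a0 b0; have m0 : 0 < Num.min a b by rewrite lt_min a0.
have mh : Num.min a b / 2 < Num.min a b by rewrite ltr_pdivrMr// ltr_pMr// ltr1n.
exists (Num.min a b / 2); split; first by rewrite divr_gt0.
  by rewrite (lt_le_trans mh)// ge_min lexx.
by rewrite (lt_le_trans mh)// ge_min lexx orbT.
Qed.

Lemma is_derive_quot f (x d : R) : is_derive x 1 f d ->
  forall e, 0 < e -> exists2 del, 0 < del &
    forall k, k != 0 -> `|k| < del -> `|(f (x + k) - f x) / k - d| < e.
Proof.
move=> [fx <-] e e0.
have := fx; rewrite /derivable => /cvgrPdist_lt /(_ e e0).
rewrite near_withinE => /nbhs_ballP[del /= del0 h]; exists del => // k k0 kd.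
have := h k; rewrite /ball /= sub0r normrN => /(_ kd k0).
by rewrite distrC [_%:A]mulr1 (addrC k) [_ *: _]mulrC.
Qed.

(** Only earlier times are compared, since a minimum may occur at the final time of the region. *)
Lemma left_min_derive_le0 f (x d : R) : is_derive x 1 f d ->
  (exists2 del, 0 < del & forall k, 0 < k < del -> f x <= f (x - k)) -> d <= 0.
Proof.
move=> fd [del del0 fmin]; rewrite leNgt; apply/negP => d0.
have [del' del'0 h] := is_derive_quot fd d0.
have [k [k0 kd kd']] := exists_lt2 del0 del'0.
have := h (- k); rewrite oppr_eq0 gt_eqF// normrN gtr0_norm// => /(_ isT kd').
have q0 : (f (x + - k) - f x) / - k <= 0.
  rewrite invrN mulrN oppr_le0; apply: divr_ge0; last exact: ltW.
  by rewrite subr_ge0 fmin// k0.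
by move/ltr_normlP => [h1 _]; move: h1 q0; lra.
Qed.

(** At the minimum [f1 0 = 0]; if [d < 0] then [f1] is negative just to the right of 0, and the mean
    value theorem makes [f] drop below [f 0]. *)
Lemma min_derive2_ge0 f f1 (d : R) :
  (\forall h \near (0 : R), is_derive (h : R) (1 : R) f (f1 h)) -> is_derive (0 : R) (1 : R) f1 d ->
  (\forall h \near (0 : R), f 0 <= f h) -> 0 <= d.
Proof.
move=> ff1 f1d fmin; rewrite leNgt; apply/negP => d0.
have [del /= del0 h] : exists2 del, 0 < del & forall h, `|h| < del ->
    is_derive (h : R) (1 : R) f (f1 h) /\ f 0 <= f h.
  have /nbhs_ballP[del del0 h] : \forall h \near (0 : R),
      is_derive (h : R) (1 : R) f (f1 h) /\ f 0 <= f h by exact: filterI.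
  by exists del => // k kd; apply: h; rewrite /ball /= sub0r normrN.
have f10 : f1 0 = 0.
  have fd0 := (h 0 ltac:(by rewrite normr0)).1.
  suff h0 : is_derive (0 : R) (1 : R) f 0.
    by case: fd0 => _ <-; case: h0.
  apply: (@derive1_at_min _ f (- del) del).
  - by rewrite ge0_cp// ltW.
  - move=> t; rewrite in_itv /= => td.
    have /h[[]//] : `|t| < del by rewrite ltr_norml.
  - by rewrite in_itv /= oppr_lt0 del0.
  - by move=> t; rewrite in_itv /= => td; apply: (h t _).2; rewrite ltr_norml.
have nd0 : 0 < - d by rewrite oppr_gt0.
have [del' del'0 h'] := is_derive_quot f1d nd0.
have [k [k0 kd kd']] := exists_lt2 del0 del'0.
have fdr t : 0 <= t <= k -> is_derive (t : R) (1 : R) f (f1 t).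
  by move=> /andP[t0 tk]; apply: (h t _).1; rewrite ger0_norm// (le_lt_trans tk).
have [] := @MVT _ f f1 0 k k0.
- by move=> t; rewrite in_itv /= => /andP[/ltW ? /ltW ?]; apply: fdr; apply/andP.
- apply: derivable_within_continuous => t; rewrite in_itv /= => /fdr.
  by case.
move=> c; rewrite in_itv /= subr0 => /andP[c0 ck] E.
have := h' c; rewrite gt_eqF// gtr0_norm// (lt_trans ck kd') => /(_ isT isT).
rewrite add0r f10 subr0 => /ltr_normlP[_ hc].
have fk : f 0 <= f k by apply: (h k _).2; rewrite gtr0_norm.
have : f1 c < 0.
  have : f1 c / c < 0 by move: hc; lra.
  by rewrite pmulr_llt0// invr_gt0.
have : 0 <= f1 c * k by rewrite -E subr_ge0.
by rewrite pmulr_lge0// => ? ?; lra.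
Qed.

End calculus.

Section jets.
Variables (R : realType) (n : nat).
Implicit Types (P Q u : R -> 'rV[R]_n -> R) (s : R) (x c v : 'rV[R]_n).
Implicit Types (g l : 'I_n -> R).

(* Second-order data along coordinate lines only: this is all that the derivative
   tests at a minimum require, and it is stable under sums, products and [expR]. *)
Definition jet P s x (ps : R) g l : Prop :=
  is_derive s (1 : R) (P ^~ x) ps /\
  forall i, exists P1 : R -> R,
    [/\ \forall h \near (0 : R),
          is_derive (h : R) (1 : R) (fun k => P s (x + k *: basis_vec R i)) (P1 h),
        P1 0 = g i & is_derive (0 : R) (1 : R) P1 (l i)].

Lemma is_derive_line (f : 'rV[R]_n -> R) x (e : 'rV[R]_n) (h d : R) :
  is_derive (x + h *: e) e f d ->
  is_derive (h : R) (1 : R) (fun k => f (x + k *: e)) d.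
Proof.
move=> [fx <-].
have E : (fun k : R => k^-1 *: (((fun k => f (x + k *: e)) \o shift h) (k *: (1 : R)) - f (x + h *: e))) =
   (fun k : R => k^-1 *: ((f \o shift (x + h *: e)) (k *: e) - f (x + h *: e))).
  apply/funext => k /=; congr (_ *: (f _ - _)).
  by rewrite [_%:A]mulr1 scalerDl addrCA.
split; first by rewrite /derivable E.
by rewrite /derive E.
Qed.

Lemma is_derive_ext (f g : R -> R) (a d d' : R) : f =1 g -> d = d' ->
  is_derive a (1 : R) f d -> is_derive a (1 : R) g d'.
Proof. by move=> /funext -> ->. Qed.

Lemma jet_ext P Q s x ps qs g g' l l' : (forall t y, P t y = Q t y) ->
  ps = qs -> g =1 g' -> l =1 l' -> jet P s x ps g l -> jet Q s x qs g' l'.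
Proof.
move=> PQ <- gg' ll' [Ps Px].
have -> : Q = P by apply/funext => t; apply/funext => y.
by split=> // i; have [P1] := Px i; rewrite gg' ll' => ?; exists P1.
Qed.

Lemma jet_time (a : R -> R) s x (d : R) : is_derive s (1 : R) a d ->
  jet (fun t _ => a t) s x d (fun=> 0) (fun=> 0).
Proof.
move=> ad; split=> // i; exists (fun=> 0); split => //.
- by near=> h; exact: is_derive_cst.
- exact: is_derive_cst.
Unshelve. all: by end_near. Qed.

Lemma jetD P Q s x ps qs g g' l l' : jet P s x ps g l -> jet Q s x qs g' l' ->
  jet (fun t y => P t y + Q t y) s x (ps + qs) (fun i => g i + g' i)
    (fun i => l i + l' i).
Proof.
move=> [Ps Px] [Qs Qx]; split; first exact: is_deriveD.
move=> i; have [P1 [P1n <- P1d]] := Px i; have [Q1 [Q1n <- Q1d]] := Qx i.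
exists (fun h => P1 h + Q1 h); split=> //; last exact: is_deriveD.
by near=> h; apply: is_deriveD; [near: h; exact: P1n|near: h; exact: Q1n].
Unshelve. all: by end_near. Qed.

Lemma is_derive_mul (f g : R -> R) (a d e : R) : is_derive a (1 : R) f d ->
  is_derive a (1 : R) g e ->
  is_derive a (1 : R) (fun t => f t * g t) (d * g a + f a * e).
Proof.
move=> fd ge; apply: (is_derive_ext (f := f * g) _ _ (is_deriveM fd ge)) => //.
by rewrite addrC [_ *: e]/(_ * e) [_ *: d]/(_ * d) (mulrC d).
Qed.

Lemma jetM P Q s x ps qs g g' l l' : jet P s x ps g l -> jet Q s x qs g' l' ->
  jet (fun t y => P t y * Q t y) s x (ps * Q s x + P s x * qs)
    (fun i => g i * Q s x + P s x * g' i)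
    (fun i => l i * Q s x + 2 * (g i * g' i) + P s x * l' i).
Proof.
move=> [Ps Px] [Qs Qx]; split; first exact: is_derive_mul.
move=> i; have [P1 [P1n <- P1d]] := Px i; have [Q1 [Q1n <- Q1d]] := Qx i.
exists (fun h => P1 h * Q s (x + h *: basis_vec R i) +
  P s (x + h *: basis_vec R i) * Q1 h); split.
- by near=> h; apply: is_derive_mul; [near: h; exact: P1n|near: h; exact: Q1n].
- by rewrite scale0r addr0.
- have P0 := nbhs_singleton P1n; have Q0 := nbhs_singleton Q1n.
  apply: (is_derive_ext _ _ (is_deriveD (is_derive_mul P1d Q0) (is_derive_mul P0 Q1d))) => //.
  by rewrite scale0r addr0; ring.
Unshelve. all: by end_near. Qed.

Lemma jetN P s x ps g l : jet P s x ps g l ->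
  jet (fun t y => - P t y) s x (- ps) (fun i => - g i) (fun i => - l i).
Proof.
move=> Pj; have := jetM (jet_time x (is_derive_cst (-1 : R) s 1)) Pj.
by apply: jet_ext => [t y||i|i] /=; ring.
Qed.

Lemma is_derive_exp (f : R -> R) (a d : R) : is_derive a (1 : R) f d ->
  is_derive a (1 : R) (fun t => expR (f t)) (d * expR (f a)).
Proof.
move=> fd; apply: (is_derive_ext (f := expR \o f) _ _ (is_derive1_comp (is_derive_expR (f a)) fd)) => //.
exact: mulrC.
Qed.

Lemma jet_exp P s x ps g l : jet P s x ps g l ->
  jet (fun t y => expR (P t y)) s x (ps * expR (P s x))
    (fun i => g i * expR (P s x)) (fun i => (l i + g i ^+ 2) * expR (P s x)).
Proof.
move=> [Ps Px]; split; first exact: is_derive_exp.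
move=> i; have [P1 [P1n <- P1d]] := Px i.
exists (fun h => P1 h * expR (P s (x + h *: basis_vec R i))); split.
- by near=> h; apply: is_derive_exp; near: h; exact: P1n.
- by rewrite scale0r addr0.
- have P0 := nbhs_singleton P1n.
  apply: (is_derive_ext _ _ (is_derive_mul P1d (is_derive_exp P0))) => //.
  by rewrite scale0r addr0; ring.
Unshelve. all: by end_near. Qed.

Lemma is_derive_continuous (f : R -> R) (s d : R) :
  is_derive s (1 : R) f d -> {for s, continuous f}.
Proof.
by move=> [fd _]; apply/differentiable_continuous/derivable1_diffP.
Qed.

Lemma is_derive_scale (f : R -> R) (b s d : R) :
  is_derive s (1 : R) f d -> is_derive s (1 : R) (fun t => b * f t) (b * d).
Proof.
move=> fd; have := is_derive_mul (is_derive_cst (b : R) s 1) fd.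
by apply: is_derive_ext => //; rewrite /cst; ring.
Qed.

Lemma is_derive_invr (f : R -> R) (s d : R) : f s != 0 ->
  is_derive s (1 : R) f d ->
  is_derive s (1 : R) (fun t => (f t)^-1) (- d / f s ^+ 2).
Proof.
move=> f0 fd; have := is_deriveV f0 fd.
apply: is_derive_ext => //; change (- (f s) ^- 2 * d = - d / f s ^+ 2).
by ring.
Qed.

Lemma is_derive_idR (s : R) : is_derive s (1 : R) (fun t => t) 1.
Proof. exact: is_derive_id. Qed.

Lemma is_derive_affine (a b t : R) : is_derive t (1 : R) (fun k => a + k * b) b.
Proof.
have := is_deriveD (is_derive_cst a t 1) (is_derive_mul (is_derive_id t 1) (is_derive_cst b t 1)).
by apply: is_derive_ext => [k|]; rewrite ?fctE /cst /=; ring.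
Qed.

Lemma is_derive_quad (a b c t : R) :
  is_derive t (1 : R) (fun k => a + k * b + k ^+ 2 * c) (b + 2 * t * c).
Proof.
have := is_deriveD (is_derive_affine a b t) (is_derive_mul (is_derive_mul (is_derive_id t 1) (is_derive_id t 1)) (is_derive_cst c t 1)).
by apply: is_derive_ext => [k|]; rewrite ?fctE /cst /=; ring.
Qed.

Lemma dot_basis x i : dot x (basis_vec R i) = x 0 i.
Proof.
rewrite /dot (bigD1 i)//= big1 ?addr0; first by rewrite mxE !eqxx mulr1.
by move=> j ji; rewrite mxE (negbTE ji) andbF mulr0.
Qed.

Lemma jet_sqdist c v s x (w := x - c - s *: v) :
  jet (fun t y => dot (y - c - t *: v) (y - c - t *: v)) s x
    (- 2 * dot v w) (fun i => 2 * w 0 i) (fun=> 2).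
Proof.
split.
  have := is_derive_quad (dot (x - c) (x - c)) (- 2 * dot v (x - c)) (dot v v) s.
  apply: is_derive_ext => [k|].
    by rewrite !dotE (dotC v x) (dotC v c); ring.
  by rewrite /w !dotE; ring.
move=> i; exists (fun h => 2 * w 0 i + h * 2); split.
- near=> h.
  have := is_derive_quad (dot w w) (2 * w 0 i) 1 h.
  apply: is_derive_ext => [k|]; last by ring.
  have -> : x + k *: basis_vec R i - c - s *: v = w + k *: basis_vec R i.
    by apply/rowP => j; rewrite !mxE; ring.
  clearbody w; rewrite !dotE (dotC (basis_vec R i) w) !dot_basis mxE !eqxx /=; ring.
- by rewrite mul0r addr0.
- exact: is_derive_affine.
Unshelve. all: by end_near. Qed.

Lemma heat_solution_jet (D : set 'rV[R]_n) u s x : open D -> heat_solution D u ->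
  0 < s -> D x -> exists us g l,
    jet u s x us g l /\ us = \sum_i l i.
Proof.
move=> oD [C12 heq] s0 Dx; have [[us ui uij] _] := C12 s x s0 Dx.
exists (derive1 (u ^~ x) s), (fun i => 'D_(basis_vec R i) (u s) x),
  (fun i => 'D_(basis_vec R i) (fun y => 'D_(basis_vec R i) (u s) y) x).
split; last exact: heq.
split; first by rewrite derive1E; exact: (DeriveDef us erefl).
move=> i; exists (fun h => 'D_(basis_vec R i) (u s) (x + h *: basis_vec R i)).
split.
- have : \forall h \near (0 : R), D (x + h *: basis_vec R i).
    have cl : (x + h *: basis_vec R i) @[h --> (0 : R)] --> x.
      have : (x + h *: basis_vec R i) @[h --> (0 : R)] --> x + 0 *: basis_vec R i.
        apply: (@cvgD _ _ _ (nbhs (0:R))); first exact: cvg_cst.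
        exact: scalel_continuous.
      by rewrite scale0r addr0.
    by apply: cl; exact: open_nbhs_nbhs.
  apply: filterS => h Dh; apply: is_derive_line.
  have [[_ ux _] _] := C12 s _ s0 Dh; exact: (DeriveDef (ux i) erefl).
- by rewrite scale0r addr0.
- apply: (@is_derive_line (fun y => 'D_(basis_vec R i) (u s) y) x (basis_vec R i)).
  by rewrite scale0r addr0; exact: (DeriveDef (uij i i) erefl).
Qed.

Lemma jet_local_min P s x ps g l : jet P s x ps g l ->
  (exists2 del, 0 < del & forall k, 0 < k < del -> P s x <= P (s - k) x) ->
  (forall i, \forall h \near (0 : R), P s x <= P s (x + h *: basis_vec R i)) ->
  ps - \sum_i l i <= 0.
Proof.
move=> [Ps Px] tm xm.
have := left_min_derive_le0 Ps tm.
have : 0 <= \sum_i l i.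
  apply: sumr_ge0 => i _; have [P1 [P1n _ P1d]] := Px i.
  apply: (min_derive2_ge0 P1n P1d).
  by rewrite scale0r addr0; exact: xm.
by lra.
Qed.

End jets.

(** * Comparison principle *)

Section comparison.
Variables (R : realType) (n : nat).
Implicit Types (u W : R -> 'rV[R]_n -> R) (D : set 'rV[R]_n).

(** The starting time [a] is a parameter because the comparison is applied to solutions delayed in
    time. *)
Definition heat_after D (a : R) u : Prop :=
  forall s x, a < s -> D x ->
    {for (s, x), continuous (fun q : R * 'rV[R]_n => u q.1 q.2)} /\
    exists us g l, jet u s x us g l /\ us = \sum_i l i.

Lemma heat_solution_after D u : open D -> heat_solution D u -> heat_after D 0 u.
Proof.
move=> oD hu s x s0 Dx; split; last exact: heat_solution_jet hu s0 Dx.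
by have [[] + _] := hu.1 s x s0 Dx; case: (hu.1 s x s0 Dx) => _ [].
Qed.

Lemma jet_shift u s x us g l (tau : R) : jet u (s - tau) x us g l ->
  jet (fun t y => u (t - tau) y) s x us g l.
Proof.
move=> [us' ux]; split => //.
have ad : is_derive s (1 : R) (fun t => t - tau) 1.
  have := is_derive_affine (- tau) 1 s.
  by apply: is_derive_ext => // k; rewrite mulr1 addrC.
apply: (is_derive_ext (f := (u ^~ x) \o (fun t => t - tau)) _ _
  (@is_derive1_comp _ (u ^~ x) (fun t => t - tau) s us 1 us' ad)) => //.
exact: mulr1.
Qed.

Lemma heat_after_shift D a u tau : heat_after D a u ->
  heat_after D (a + tau) (fun s x => u (s - tau) x).
Proof.
move=> hu s x s0 Dx; have [|cu [us [g [l [j e]]]]] := hu (s - tau) x _ Dx.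
  by rewrite ltrBrDr.
split; last by exists us, g, l; split => //; exact: jet_shift.
pose f (q : R * 'rV[R]_n) := (q.1 - tau, q.2).
have cf : {for (s, x), continuous f}.
  have c1 : (q.1 - tau) @[q --> (s, x)] --> s - tau.
    exact: (@cvgB _ _ _ (nbhs (s, x)) _ _ _ _ _ cvg_fst (cvg_cst tau)).
  have c2 : q.2 @[q --> (s, x)] --> x by exact: cvg_snd.
  exact: (cvg_pair c1 c2).
exact: (@continuous_comp _ _ _ f (fun q => u q.1 q.2) (s, x) cf cu).
Qed.

(* Closedness of the sublevel sets of [u - W] in [E] (last hypothesis) and their
   boundedness make the infimum of [u - W] attained if it is negative. *)
Lemma comparison D (a : R) u W (E : set (R * 'rV[R]_n)) :
  heat_after D a u ->
  (forall q, E q -> a < q.1 /\ D q.2) ->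
  (forall s x, E (s, x) ->
     exists2 del, 0 < del & forall k, 0 < k < del -> E (s - k, x)) ->
  (forall s x, E (s, x) ->
     forall i, \forall h \near (0 : R), E (s, x + h *: basis_vec R i)) ->
  (forall s x, E (s, x) -> exists ws g l, jet W s x ws g l /\ ws < \sum_i l i) ->
  (forall q, E q -> {for q, continuous (fun p : R * 'rV[R]_n => W p.1 p.2)}) ->
  (exists M, forall q, E q -> u q.1 q.2 < W q.1 q.2 ->
     `|q.1| <= M /\ enorm q.2 <= M) ->
  (forall q, ~ E q -> forall e, 0 < e ->
     \forall p \near q, E p -> W p.1 p.2 - e < u p.1 p.2) ->
  forall q, E q -> W q.1 q.2 <= u q.1 q.2.
Proof.
move=> hu ED Eback Eline Wjet Wc [M EM] Ebd q1 Eq1.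
rewrite leNgt; apply/negP => uW.
pose psi (q : R * 'rV[R]_n) := u q.1 q.2 - W q.1 q.2.
have psic q : E q -> {for q, continuous psi}.
  move=> Eq; have [s0 Dx] := ED q Eq; apply: cvgB; last exact: Wc.
  by case: q Eq s0 Dx => s x Eq s0 Dx; exact: (hu s x s0 Dx).1.
pose S := [set q | E q /\ psi q <= psi q1].
have psi1 : psi q1 < 0 by rewrite /psi subr_lt0.
have Scl : closed S.
  rewrite -openC openE => q nSq; rewrite /interior.
  have [Eq|nEq] := pselect (E q).
    have lt : psi q1 < psi q.
      by rewrite ltNge; apply/negP => h; apply: nSq.
    have := psic q Eq; move=> /(_ [set y | psi q1 < y]) h.
    have : nbhs q (psi @^-1` [set y | psi q1 < y]) by apply: h; exact: lt_nbhsr.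
    apply: filterS => p /= h1 [_ h2]; move: h1 h2; rewrite ltNge => /negP //.
  have := Ebd q nEq (- psi q1); rewrite oppr_gt0 => /(_ psi1).
  by apply: filterS => p h [/h h1 h2]; move: h1 h2; rewrite /psi; lra.
have Scpt : compact S.
  apply: (subclosed_compact Scl (B := [set` `[- M, M]%R] `*` [set y | enorm (y - 0) <= M])).
    by apply: compact_setX; [exact: segment_compact|exact: closed_eball_compact].
  move=> q [Eq qle]; have [|h1 h2] := EM q Eq.
    by move: qle psi1; rewrite /psi; lra.
  by split; rewrite /= ?in_itv /= -?ler_norml ?subr0.
have S0 : S !=set0 by exists q1; split.
have Scont : {within S, continuous psi}.
  apply: continuous_in_subspaceT => q /set_mem [Eq _]; exact: psic.
have [[s x] /set_mem [Eq qle] qmin] := compact_EVT_min S0 Scpt Scont.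
have pmin p : E p -> psi (s, x) <= psi p.
  move=> Ep; have [h|h] := leP (psi p) (psi q1).
    by apply: qmin; apply/mem_set.
  exact: le_trans qle (ltW h).
have [/= s0 Dx] := ED _ Eq.
have [_ [us [g [l [uj ul]]]]] := hu s x s0 Dx.
have [ws [g' [l' [wj wl]]]] := Wjet _ _ Eq.
have := jet_local_min (jetD uj (jetN wj)).
have [del del0 Edel] := Eback _ _ Eq.
have h1 : exists2 del, 0 < del & forall k, 0 < k < del ->
    u s x - W s x <= u (s - k) x - W (s - k) x.
  by exists del => // k kd; exact: (pmin (s - k, x) (Edel _ kd)).
have h2 i : \forall h \near (0 : R), u s x - W s x <=
    u s (x + h *: basis_vec R i) - W s (x + h *: basis_vec R i).
  by apply: filterS (Eline _ _ Eq i) => h Eh; exact: (pmin (s, _) Eh).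
(* The heat operator of [u - W] is nonpositive at the minimum, but positive because [W] is a strict
   subsolution. *)
move=> /(_ h1 h2); rewrite big_split /= sumrN ul.
by move: wl; lra.
Qed.

End comparison.

(** * Comparison in a ball moving along a straight line *)

Section moving_ball.
Variables (R : realType) (n : nat).
Implicit Types (u W : R -> 'rV[R]_n -> R) (D : set 'rV[R]_n).

Definition sqd (c v : 'rV[R]_n) (s : R) (x : 'rV[R]_n) : R :=
  dot (x - c - s *: v) (x - c - s *: v).

Lemma continuous_sqd c v (q : R * 'rV[R]_n) :
  {for q, continuous (fun p : R * 'rV[R]_n => sqd c v p.1 p.2)}.
Proof.
have cf : {for q, continuous (fun p : R * 'rV[R]_n => p.2 - c - p.1 *: v)}.
  have c1 : p.2 - c @[p --> q] --> q.2 - c.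
    exact: (@cvgB _ _ _ (nbhs q) _ _ _ _ _ cvg_snd (cvg_cst c)).
  have c2 : p.1 *: v @[p --> q] --> q.1 *: v.
    exact: (@cvgZr_tmp _ _ _ (nbhs q) _ _ _ _ cvg_fst).
  exact: (@cvgB _ _ _ (nbhs q) _ _ _ _ _ c1 c2).
exact: continuous_dot.
Qed.

(* [u] is not assumed continuous up to the lateral boundary of the moving ball, which
   may touch the boundary of [D]: there only [0 <= u] and [W <= 0] are used. *)
Lemma moving_ball_comparison D u W (c v : 'rV[R]_n) (a b M : R) (r2 : R -> R) :
  heat_after D a u -> (forall s x, a < s -> D x -> 0 <= u s x) ->
  (forall s, {for s, continuous r2}) -> (forall s, a <= s <= b -> r2 s <= M) ->
  (forall s x, a < s <= b -> sqd c v s x < r2 s -> D x) ->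
  (forall s x, a <= s <= b ->
     {for (s, x), continuous (fun p : R * 'rV[R]_n => W p.1 p.2)}) ->
  (forall s x, a <= s <= b -> sqd c v s x = r2 s -> W s x <= 0) ->
  (forall s x, a < s <= b -> sqd c v s x < r2 s ->
     exists ws g l, jet W s x ws g l /\ ws <= \sum_i l i) ->
  (forall x, sqd c v a x < r2 a -> forall e, 0 < e ->
     \forall p \near (a, x), a < p.1 -> D p.2 -> W a x - e < u p.1 p.2) ->
  forall s x, a < s <= b -> sqd c v s x < r2 s -> W s x <= u s x.
Proof.
move=> hu u0 r2c r2M bD Wc Wbd Wj ini s1 x1 s1ab sx1.
pose F (q : R * 'rV[R]_n) := r2 q.1 - sqd c v q.1 q.2.
have Fc q : {for q, continuous F}.
  apply: cvgB; last exact: continuous_sqd.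
  exact: (continuous_cvg _ (r2c q.1) cvg_fst).
pose E := [set q : R * 'rV[R]_n | a < q.1 <= b /\ 0 < F q].
(* The term linear in time makes the subsolution strict; [eta] is arbitrary. *)
have key eta : 0 < eta -> W s1 x1 - eta * (1 + (s1 - a)) <= u s1 x1.
  move=> eta0.
  pose We s x := W s x - eta * (1 + (s - a)).
  have Wec s x : a <= s <= b ->
      {for (s, x), continuous (fun p : R * 'rV[R]_n => We p.1 p.2)}.
    move=> sab; apply: cvgB; first exact: Wc.
    apply: cvgM; first exact: cvg_cst.
    apply: cvgD; first exact: cvg_cst.
    exact: (@cvgB _ _ _ (nbhs (s, x)) _ _ _ _ _ cvg_fst (cvg_cst a)).
  have Fpos q : 0 < F q -> \forall p \near q, 0 < F p.
    by move=> Fq; apply: (Fc q [set y | 0 < y]); exact: lt_nbhsr.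
  apply: (@comparison _ _ D a u We E hu _ _ _ _ _ _ _ (s1, x1)).
  - move=> [s x] [/= sab Fp]; split; first by case/andP: sab.
    by apply: (bD s x sab); move: Fp; rewrite /F /=; lra.
  - move=> s x [/= /andP[sa sb] Fp].
    have : \forall k \near (0 : R), 0 < F (s - k, x).
      have cl : (s - k, x) @[k --> (0 : R)] --> (s, x).
        have c1 : (s - k) @[k --> (0 : R)] --> s.
          rewrite -[X in _ --> X]subr0.
          exact: (@cvgB _ _ _ (nbhs (0 : R)) _ _ _ _ _ (cvg_cst s) (fun _ h => h)).
        exact: (cvg_pair c1 (cvg_cst x)).
      exact: (cl _ (Fpos _ Fp)).
    move=> /nbhs_ballP[del /= del0 h].
    have [k0 [k00 k0d k0s]] := @exists_lt2 R del (s - a) del0 ltac:(by rewrite subr_gt0).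
    exists k0 => // k /andP[kp kk]; split => /=.
      by apply/andP; split; lra.
    apply: h; rewrite /ball /= sub0r normrN gtr0_norm//; lra.
  - move=> s x [/= sab Fp] i.
    have cl : (s, x + h *: basis_vec R i) @[h --> (0 : R)] --> (s, x).
      have c2 : x + h *: basis_vec R i @[h --> (0 : R)] --> x.
        rewrite -[X in _ --> X](addr0 x) -[X in x + X](scale0r (basis_vec R i)).
        apply: (@cvgD _ _ _ (nbhs (0 : R))); first exact: cvg_cst.
        exact: scalel_continuous.
      exact: (cvg_pair (cvg_cst s) c2).
    have : \forall h \near (0 : R), 0 < F (s, x + h *: basis_vec R i).
      exact: (cl _ (Fpos _ Fp)).
    by apply: filterS => h Fh; split.
  - move=> s x [/= sab Fp].
    have [|ws [g [l [wj wl]]]] := Wj s x sab; first by move: Fp; rewrite /F /=; lra.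
    have dt : is_derive s (1 : R) (fun t => - (eta * (1 + (t - a)))) (- eta).
      have := is_derive_affine (- (eta * (1 - a))) (- eta) s.
      by apply: is_derive_ext => // k; ring.
    have := jetD wj (jet_time x dt).
    exists (ws - eta), (fun i => g i + 0), (fun i => l i + 0); split => //.
    under eq_bigr do rewrite addr0.
    by move: wl eta0; lra.
  - by move=> [s x] [/= /andP[sa sb] _]; apply: Wec; rewrite (ltW sa) sb.
  - exists (`|a| + `|b| + Num.sqrt M + enorm c + (`|a| + `|b|) * enorm v).
    move=> [s x] [/= /andP[sa sb] Fp] _.
    have sab : `|s| <= `|a| + `|b|.
      have := ler_norm b; have := ler_norm (- a); rewrite normrN => h1 h2.
      have := normr_ge0 a; have := normr_ge0 b => h3 h4.
      by rewrite ler_norml; apply/andP; split; lra.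
    have e1 := enorm_ge0 c; have e2 := enorm_ge0 v; have e3 := sqrtr_ge0 M.
    have e4 : 0 <= (`|a| + `|b|) * enorm v by rewrite mulr_ge0// addr_ge0.
    split; first by lra.
    have : enorm (x - c - s *: v) <= Num.sqrt M.
      rewrite /enorm ler_wsqrtr//; apply: le_trans (r2M s _); last by rewrite (ltW sa).
      by move: Fp; rewrite /F /sqd /=; lra.
    have : enorm (s *: v) <= (`|a| + `|b|) * enorm v.
      by rewrite enormZ ler_wpM2r.
    have := ler_enormD (x - c - s *: v) (s *: v + c).
    have := ler_enormD (s *: v) c.
    rewrite (_ : x - c - s *: v + _ = x); last by apply/rowP => j; rewrite !mxE; ring.
    have := normr_ge0 a; have := normr_ge0 b; lra.
  - move=> [s x] nE e e0.
    have near1 : \forall p \near (s, x), W p.1 p.2 < W s x + e / 2 \/ ~ (a <= s <= b).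
      have [sab|] := boolP (a <= s <= b); last by move=> ?; near=> p; right.
      have : \forall p \near (s, x), W p.1 p.2 < W s x + e / 2.
        apply: (Wc s x sab [set y | y < W s x + e / 2]).
        by apply: lt_nbhsl; rewrite /=; lra.
      by apply: filterS; left.
    have [sa|sa] := ltP s a.
      have : \forall p \near (s, x), p.1 < a.
        exact: (@cvg_fst _ _ (nbhs s) (nbhs x) _ [set y | y < a] (lt_nbhsl sa)).
      by apply: filterS => p pa [/andP[ap _] _]; move: pa ap; lra.
    have [sb|sb] := ltP b s.
      have : \forall p \near (s, x), b < p.1.
        exact: (@cvg_fst _ _ (nbhs s) (nbhs x) _ [set y | b < y] (lt_nbhsr sb)).
      by apply: filterS => p pa [/andP[_ ap] _]; move: pa ap; lra.
    have sab : a <= s <= b by rewrite sa.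
    have Ds p : E p -> a < p.1 /\ D p.2.
      move=> [/= pab Fp]; split; first by case/andP: pab.
      by apply: (bD p.1 p.2 pab); move: Fp; rewrite /F /=; lra.
    have Wel p : E p -> We p.1 p.2 <= W p.1 p.2.
      move=> [/andP[pa _] _]; rewrite /We lerBlDr lerDl mulr_ge0//; lra.
    have [F0|F0] := ltP (F (s, x)) 0.
      have : \forall p \near (s, x), F p < 0.
        by apply: (Fc (s, x) [set y | y < 0]); exact: lt_nbhsl.
      by apply: filterS => p pa [_]; move: pa; lra.
    have [Fz|Fnz] := eqVneq (F (s, x)) 0.
      have W0 : W s x <= 0 by apply: Wbd => //; move: Fz; rewrite /F /=; lra.
      apply: filterS near1 => p [h|//] Ep; have [pa Dp] := Ds p Ep.
      have := u0 _ _ pa Dp; have := Wel p Ep; lra.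
    have Fp : 0 < F (s, x) by rewrite lt_def Fnz.
    (* A point strictly inside the moving ball and outside [E] can only be at the initial time. *)
    have as_ : s = a.
      apply/eqP; rewrite eq_le sa andbT leNgt; apply/negP => h.
      by apply: nE; split => //=; rewrite h.
    have e20 : 0 < e / 2 by lra.
    have := ini x; rewrite -as_ => /(_ _ _ e20) h.
    have {}h := h ltac:(by move: Fp; rewrite /F /=; lra).
    near=> p => Ep; have [pa Dp] := Ds p Ep; have := Wel p Ep.
    have : W p.1 p.2 < W s x + e / 2.
      have [//|/(_ sab)] : W p.1 p.2 < W s x + e / 2 \/ ~ (a <= s <= b) by near: p.
      by [].
    have : W s x - e / 2 < u p.1 p.2.
      have : s < p.1 -> D p.2 -> W s x - e / 2 < u p.1 p.2 by near: p.
      by apply => //; rewrite as_.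
    lra.
  - by split => //=; rewrite /F /= subr_gt0.
rewrite leNgt; apply/negP => lt.
have [s1a _] := andP s1ab.
have p0 : 0 < 1 + (s1 - a) by lra.
have := key ((W s1 x1 - u s1 x1) / 2 / (1 + (s1 - a))).
rewrite divfK ?gt_eqF// => /(_ _); rewrite divr_gt0//; last by lra.
by move=> /(_ isT); lra.
Unshelve. all: by end_near. Qed.

End moving_ball.

(** * Positivity of bounded solutions *)

Section positivity.
Variables (R : realType) (n : nat).
Implicit Types (u : R -> 'rV[R]_n -> R) (D : set 'rV[R]_n) (f : 'rV[R]_n -> R).

(** The coefficient [2 n + 1] of time exceeds the Laplacian [2 n] of [|x|^2], so the subsolution is
    strict. *)
Lemma jet_quadratic (eta : R) s (x : 'rV[R]_n) : exists g l,
  jet (fun t y => - eta * (1 + sqd 0 0 t y + (2 * n%:R + 1) * t)) s x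
    (- eta * (2 * n%:R + 1)) g l /\ \sum_i l i = - eta * (2 * n%:R).
Proof.
have j1 := jet_sqdist 0 0 s x.
have dt : is_derive s (1 : R) (fun t => 1 + (2 * n%:R + 1) * t) (2 * n%:R + 1).
  have := is_derive_affine 1 (2 * n%:R + 1) s.
  by apply: is_derive_ext => // k; rewrite mulrC.
have j2 := jetD j1 (jet_time x dt).
have j3 := jetM (jet_time x (is_derive_cst (- eta) s 1)) j2.
exists (fun i => - eta * (2 * x 0 i)), (fun=> - eta * 2); split.
  apply: jet_ext j3 => [t y||i|i] /=; rewrite ?fctE /cst.
  - by rewrite /sqd; ring.
  - by rewrite dot0l; ring.
  - by rewrite scaler0 !subr0; ring.
  - by ring.
by rewrite sumr_const card_ord -[_ *+ _]mulr_natr; ring.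
Qed.

(** Minimum principle on a possibly unbounded [D]: as [u] is bounded, the quadratic term of the
    comparison function confines the set where [u] lies below it to a bounded region, and then [eta]
    tends to 0. *)
Lemma bounded_solution_ge0 D u f : open D -> heat_solution D u ->
  dirichlet_condition D u -> initial_condition D u f -> bounded_solution D u ->
  (forall x, 0 <= f x) -> forall s x, 0 < s -> D x -> 0 <= u s x.
Proof.
move=> oD hu du iu [M uM] f0 b x1 b0 Dx1.
pose E := [set q : R * 'rV[R]_n | 0 < q.1 <= b /\ D q.2].
have oDx (x : 'rV[R]_n) : D x -> nbhs x D by move=> ?; exact: open_nbhs_nbhs.
pose W eta (s : R) (x : 'rV[R]_n) := - eta * (1 + sqd 0 0 s x + (2 * n%:R + 1) * s).
have key eta : 0 < eta -> W eta b x1 <= u b x1.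
  move=> eta0.
  have Wle s x : 0 <= s -> W eta s x <= - eta * (1 + sqd 0 0 s x).
    by move=> s0; rewrite /W !mulNr lerN2 ler_pM2l// lerDl mulr_ge0.
  have sq0 s x : 0 <= sqd (0 : 'rV[R]_n) 0 s x by exact: dot_ge0.
  have Wle0 s x : 0 <= s -> W eta s x <= 0.
    move=> /Wle h; apply: le_trans (h x) _.
    by rewrite mulNr oppr_le0 mulr_ge0 ?ltW//; have := sq0 s x; lra.
  apply: (@comparison _ _ D 0 u (W eta) E (heat_solution_after oD hu) _ _ _ _ _ _ _ (b, x1)).
  - by move=> [s x] [/= /andP[]].
  - move=> s x [/= /andP[sa sb] Dx]; exists s => // k /andP[k0 ks].
    by split => //=; apply/andP; split; lra.
  - move=> s x [/= sab Dx] i.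
    have c2 : x + h *: basis_vec R i @[h --> (0 : R)] --> x.
      rewrite -[X in _ --> X](addr0 x) -[X in x + X](scale0r (basis_vec R i)).
      apply: (@cvgD _ _ _ (nbhs (0 : R))); first exact: cvg_cst.
      exact: scalel_continuous.
    have : \forall h \near (0 : R), D (x + h *: basis_vec R i).
      exact: (c2 _ (oDx x Dx)).
    by apply: filterS => h Dh; split.
  - move=> s x _; have [g [l [jl sl]]] := jet_quadratic eta s x.
    by exists (- eta * (2 * n%:R + 1)), g, l; split => //; rewrite sl; lra.
  - move=> q _.
    have c1 : 1 + sqd 0 0 p.1 p.2 @[p --> q] --> 1 + sqd 0 0 q.1 q.2.
      exact: (@cvgD _ _ _ (nbhs q) _ _ _ _ _ (cvg_cst (1 : R)) (@continuous_sqd R n 0 0 q)).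
    have c2 : (2 * n%:R + 1) * p.1 @[p --> q] --> (2 * n%:R + 1) * q.1.
      exact: (@cvgM _ _ (nbhs q) _ _ _ _ _ (cvg_cst (2 * n%:R + 1 : R)) cvg_fst).
    exact: (@cvgM _ _ (nbhs q) _ _ _ _ _ (cvg_cst (- eta)) (@cvgD _ _ _ (nbhs q) _ _ _ _ _ c1 c2)).
  - exists (b + Num.sqrt (`|M| / eta)) => -[s x] [/= /andP[sa sb] Dx] uW.
    have q0 := sqrtr_ge0 (`|M| / eta).
    split; first by rewrite gtr0_norm//; lra.
    have : sqd 0 0 s x <= `|M| / eta.
      rewrite ler_pdivlMr//.
      have := Wle s x (ltW sa); have := uM s x sa Dx.
      rewrite ler_norml => /andP[h1 _] h2; have := ler_norm M.
      by move: h1 h2 uW eta0; nra.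
    rewrite /sqd !subr0 scaler0 subr0 -sqr_enorm => h.
    have : enorm x <= Num.sqrt (`|M| / eta).
      by rewrite -(ger0_norm (enorm_ge0 x)) -sqrtr_sqr ler_wsqrtr.
    by lra.
  - move=> [s x] nE e e0.
    have [sa|sa] := ltP s 0.
      have : \forall p \near (s, x), p.1 < 0.
        exact: (@cvg_fst _ _ (nbhs s) (nbhs x) _ [set y | y < 0] (lt_nbhsl sa)).
      by apply: filterS => p pa [/andP[ap _] _]; move: pa ap; lra.
    have [sb|sb] := ltP b s.
      have : \forall p \near (s, x), b < p.1.
        exact: (@cvg_fst _ _ (nbhs s) (nbhs x) _ [set y | b < y] (lt_nbhsr sb)).
      by apply: filterS => p pa [/andP[_ ap] _]; move: pa ap; lra.
    have [cDx|ncDx] := pselect (closure D x); last first.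
      have : \forall p \near x, ~ D p.
        have : open (~` closure D) by rewrite openC; exact: closed_closure.
        move=> oc; have : nbhs x (~` closure D) by exact: open_nbhs_nbhs.
        by apply: filterS => p np /subset_closure.
      move=> h; have : \forall p \near (s, x), ~ D p.2.
        exact: (@cvg_snd _ _ (nbhs s) (nbhs x) _ _ h).
      by apply: filterS => p np [_ /np].
    suff : \forall p \near (s, x), 0 < p.1 /\ D p.2 -> - e < u p.1 p.2.
      apply: filterS => p h [/= /andP[p0 pb] Dp].
      have := h (conj p0 Dp); have := Wle0 p.1 p.2 (ltW p0); lra.
    have [s0|s0] := eqVneq s 0.
      rewrite s0; have := iu x cDx.
      move=> /(_ [set y | - e < y]); apply; apply: lt_nbhsr.
      by have := f0 x; lra.
    have sp : 0 < s by rewrite lt_def s0.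
    have bx : boundary D x.
      split=> // ix; apply: nE; split; rewrite /= ?sp//.
      exact: interior_subset ix.
    have := du s x sp bx.
    by move=> /(_ [set y | - e < y]); apply; apply: lt_nbhsr; lra.
  - by split => //=; rewrite b0 lexx.
rewrite leNgt; apply/negP => un.
pose k := 1 + sqd 0 0 b x1 + (2 * n%:R + 1) * b.
have k0 : 0 < k.
  have := dot_ge0 (x1 - 0 - b *: 0); rewrite -/(sqd _ _ _ _) => h.
  have : 0 <= (2 * n%:R + 1) * b by rewrite mulr_ge0 ?ltW// addr_gt0// ?mulr_ge0 //.
  by rewrite /k; lra.
have := key (- u b x1 / 2 / k); rewrite /W -/k mulNr divfK ?gt_eqF//.
by rewrite !divr_gt0// ?oppr_gt0// => /(_ isT); lra.
Qed.

End positivity.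

(** * Barriers *)

Section gaussian_exponents.
Variables (R : realType) (n : nat).
Implicit Types (x y c v : 'rV[R]_n).

(** The squared gradient of the exponent, in terms of inner products of [B], [e] and [v]. With these
    as opaque scalars, the cancellation of [v] in [jet_hexp] is left to [field]. *)
Lemma dot_comb (b k q s : R) (B e v : 'rV[R]_n) :
  dot (b *: (B + e + s *: v) + k *: (B + e) + q *: B)
      (b *: (B + e + s *: v) + k *: (B + e) + q *: B) =
  b ^+ 2 * (dot B B + dot e e + s ^+ 2 * dot v v
            + 2 * (dot e B + s * dot v B + s * dot v e))
  + k ^+ 2 * (dot B B + dot e e + 2 * dot e B) + q ^+ 2 * dot B B
  + 2 * b * k * (dot B B + 2 * dot e B + dot e e + s * dot v B + s * dot v e)
  + 2 * b * q * (dot B B + dot e B + s * dot v B)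
  + 2 * k * q * (dot B B + dot e B).
Proof.
rewrite !dotE.
rewrite (dotC e v) (dotC B v) (dotC B e).
move: (dot B B) (dot e e) (dot v v) (dot e B) (dot v B) (dot v e) => *.
ring.
Qed.

Lemma sum_sqr (a b : R) (B w : 'rV[R]_n) :
  \sum_(i < n) (a + b * B 0 i ^+ 2 + w 0 i ^+ 2) =
  n%:R * a + b * dot B B + dot w w.
Proof.
rewrite !big_split /= sumr_const card_ord -mulr_sumr.
have sq (u : 'rV[R]_n) : \sum_(i < n) u 0 i ^+ 2 = dot u u.
  by apply: eq_bigr => i _; rewrite expr2.
by rewrite !sq mulr_natl.
Qed.

(* Logarithm of [s^(-n/2) exp (- |x - y|^2 / 4 s)], plus radial terms in the frame
   moving with velocity [v]. *)
Definition hexp (a k p1 p2 : R -> R) y c v (s : R) x : R :=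
  - (n%:R / 2) * ln s - sqd y 0 s x / (4 * s) + a s + k s * sqd y v s x
  + p1 s * sqd c v s x + p2 s * sqd c v s x ^+ 2.

(* The velocity [v] drops out of the result: this is the invariance under
   [x -> x - s v]. *)
Lemma jet_hexp (a k p1 p2 : R -> R) (a' k' p1' p2' : R) y c v s x
    (B := x - c - s *: v) (e := c - y) (z := dot B B) (q := 2 * p1 s + 4 * p2 s * z)
    (AB := z + dot e B) :
  0 < s ->
  is_derive s (1 : R) a a' -> is_derive s (1 : R) k k' ->
  is_derive s (1 : R) p1 p1' -> is_derive s (1 : R) p2 p2' ->
  exists ws g l, jet (fun t w => expR (hexp a k p1 p2 y c v t w)) s x ws g l /\
    ws - \sum_i l i = expR (hexp a k p1 p2 y c v s x) *
     (a' + (k' + 2 * k s / s - 4 * k s ^+ 2) * (AB + dot e B + dot e e)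
      - 2 * n%:R * k s + p1' * z + p2' * z ^+ 2 - n%:R * q - 8 * p2 s * z
      - q ^+ 2 * z + q * AB / s - 4 * k s * q * AB).
Proof.
move=> s0 da dk dp1 dp2.
have sn0 : s != 0 by rewrite gt_eqF.
have dln : is_derive s (1 : R) (fun t => - (n%:R / 2) * ln t) (- (n%:R / 2) / s).
  have := is_derive_mul (is_derive_cst (- (n%:R / 2) : R) s 1) (is_derive1_ln s0).
  by apply: is_derive_ext => // ; rewrite /cst; ring.
have dinv : is_derive s (1 : R) (fun t => - (4 * t)^-1) (1 / (4 * s ^+ 2)).
  have d4 : is_derive s (1 : R) (fun t : R => 4 * t) 4.
    have := is_derive_affine 0 4 s.
    by apply: is_derive_ext => // t; ring.
  have n4 : 4 * s != 0 by rewrite mulf_neq0.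
  have := is_deriveN (is_deriveV n4 d4).
  apply: is_derive_ext => //.
  by change (- (- (4 * s) ^- 2 * 4) = 1 / (4 * s ^+ 2)); field.
have jA := jet_sqdist y 0 s x.
have jA' := jet_sqdist y v s x.
have jB := jet_sqdist c v s x.
have j1 := jetM (jet_time x dinv) jA.
have j2 := jetM (jet_time x dk) jA'.
have j3 := jetM (jet_time x dp1) jB.
have j4 := jetM (jet_time x dp2) (jetM jB jB).
have J := jet_exp (jetD (jetD (jetD (jetD (jetD (jet_time x dln) j1)
   (jet_time x da)) j2) j3) j4).
eexists; eexists; eexists; split.
  apply: jet_ext J => [t w||i|i].
  - by congr expR; rewrite /hexp /sqd; ring.
  - reflexivity.
  - reflexivity.
  - reflexivity.
set E1 := expR _; set E := expR (hexp _ _ _ _ _ _ _ _ _).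
have -> : E1 = E by congr expR; rewrite /hexp /sqd; ring.
move=> {E1}; rewrite -/B -/z /=.
(* The spatial gradient of the exponent. *)
pose w := (- (4 * s)^-1 * 2) *: (x - y - s *: 0) + (k s * 2) *: (x - y - s *: v) + q *: B.
set L := \sum_(i < n) _.
have -> : L = E * (n%:R * (2 * (- (4 * s)^-1 + k s) + q) + 8 * p2 s * z + dot w w).
  rewrite /z -sum_sqr mulr_sumr; apply: eq_bigr => i _.
  rewrite mulrC; congr (_ * _).
  have -> : w 0 i = - (4 * s)^-1 * 2 * (x - y - s *: 0) 0 i
     + k s * 2 * (x - y - s *: v) 0 i + q * B 0 i.
    by rewrite /w ![in LHS]mxE; rewrite !mxE; ring.
  by rewrite /q; ring.
clear L; rewrite mulrC -mulrBr; congr (_ * _).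
have eA' : x - y - s *: v = B + e by rewrite /B /e; apply/rowP => j; rewrite !mxE; ring.
have eA : x - y - s *: 0 = B + e + s *: v.
  by rewrite /B /e; apply/rowP => j; rewrite !mxE; ring.
have dw : dot w w = (- (4 * s)^-1 * 2) ^+ 2 *
    (z + dot e e + s ^+ 2 * dot v v + 2 * (dot e B + s * dot v B + s * dot v e))
  + (k s * 2) ^+ 2 * (z + dot e e + 2 * dot e B) + q ^+ 2 * z
  + 2 * (- (4 * s)^-1 * 2) * (k s * 2) *
     (z + 2 * dot e B + dot e e + s * dot v B + s * dot v e)
  + 2 * (- (4 * s)^-1 * 2) * q * (z + dot e B + s * dot v B)
  + 2 * (k s * 2) * q * (z + dot e B).
  by rewrite /w eA eA'; exact: dot_comb.
have dA : dot (x - y - s *: 0) (x - y - s *: 0) =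
    z + dot e e + s ^+ 2 * dot v v + 2 * (dot e B + s * dot v B + s * dot v e).
  by rewrite eA; have := dot_comb 1 0 0 s B e v; rewrite !scale0r !addr0 scale1r => ->; rewrite -/z; ring.
have dA' : dot (x - y - s *: v) (x - y - s *: v) = z + dot e e + 2 * dot e B.
  by rewrite eA'; have := dot_comb 0 1 0 s B e v; rewrite !scale0r !add0r !addr0 scale1r => ->; rewrite -/z; ring.
have dv' : dot v (x - y - s *: v) = dot v B + dot v e by rewrite eA' dotDr.
rewrite dw dA dA' dv' dot0l /AB /q.
move: (dot e e) (dot v v) (dot e B) (dot v B) (dot v e) => ee vv eB vB ve.
clearbody z.
move: (k s) (p1 s) (p2 s) => K P1 P2.
field; exact: sn0.
Qed.

End gaussian_exponents.

(** * Scalar inequalities behind the two barriers *)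

Section barrier_inequalities.
Variable R : realType.

Lemma expR_ge_quad (x : R) : 0 <= x -> 1 + x + x ^+ 2 / 4 <= expR x.
Proof.
move=> x0; have h : 1 + x / 2 <= expR (x / 2) by exact: expR_ge1Dx.
have -> : expR x = expR (x / 2) ^+ 2 by rewrite -expRM_natl; congr expR; lra.
have : (1 + x / 2) ^+ 2 <= expR (x / 2) ^+ 2.
  by rewrite ler_pXn2r// nnegrE; [lra|exact: expR_ge0].
by apply: le_trans; lra.
Qed.

(** [pole_beta] is the coefficient of [rho rhoy] in the loss of [T] below. Half of [pole_lambda] is
    the constant [4 beta + C1] needed in the final inequality, plus [2 N beta], which cancels the
    Laplacian of the quadratic damping term. *)
Definition pole_beta (N : R) := 2 * N * (1 + N).
Definition pole_lambda (N : R) :=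
  2 * (4 * pole_beta N + 4 * pole_beta N * (1 + N) + 2 * N ^+ 2 + 4 * N) + 4 * N * pole_beta N.

(* Normalised to a ball of radius 1, with [r] the square root of time, [rho] and
   [rhoy] the values of [(1 - |.|^2) / 2] at the point and at the pole, and [a2] the
   squared distance to the pole.  [K1] is the contribution of the damping factor; it
   pays for the error terms in [T]. *)
Lemma pole_barrier_ineq (N r rho rhoy a2 : R)
    (phi := rho + N * rho ^+ 2) (dphi := 1 + 2 * N * rho)
    (K1 := - pole_lambda N / (2 * r) - 3 / 2 * pole_beta N * a2 / r ^+ 3
           - 4 * pole_beta N ^+ 2 * a2 / r ^+ 2 + 2 * N * pole_beta N / r)
    (T := phi - (1 + 4 * pole_beta N * r) * dphi * (rho - rhoy - a2 / 2)
          + r ^+ 2 * (- N * dphi + 2 * N * (1 - 2 * rho))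
          - rhoy * dphi ^+ 2 * (1 - 2 * rho)) :
  1 <= N -> 0 < r <= 1 -> 0 <= rho <= 2^-1 -> 0 < rhoy ->
  (rho - rhoy) ^+ 2 <= a2 ->
  (expR (rhoy * phi / r ^+ 2) - 1) * K1 <= rhoy / r ^+ 4 * T.
Proof.
move=> N1 /andP[r0 r1] /andP[rho0 rho1] ry0 ha.
have rn0 : r != 0 by rewrite gt_eqF.
have b0 : 0 < pole_beta N by rewrite /pole_beta; nra.
pose C1 := 4 * pole_beta N * (1 + N) + 2 * N ^+ 2 + 4 * N.
have C10 : 0 < C1 by rewrite /C1; nra.
(* Parabolic scaling: lengths in units of the square root of time. The exponent is [X Y] plus a
   nonnegative term. *)
pose X := rho / r; pose Y := rhoy / r; pose Z := a2 / r ^+ 2.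
have eX : rho = r * X by rewrite /X mulrC divfK.
have eY : rhoy = r * Y by rewrite /Y mulrC divfK.
have eZ : a2 = r ^+ 2 * Z by rewrite /Z mulrC divfK// expf_neq0.
have X0 : 0 <= X by rewrite divr_ge0// ltW.
have Y0 : 0 < Y by rewrite divr_gt0.
have a20 : 0 <= a2 by exact: le_trans (sqr_ge0 _) ha.
have Z0 : 0 <= Z by rewrite divr_ge0// exprn_ge0// ltW.
have hZ : (X - Y) ^+ 2 <= Z.
  rewrite -(ler_pM2l (exprn_gt0 2 r0)) -eZ; move: ha; rewrite eX eY.
  by apply: le_trans; rewrite -mulrBr exprMn.
(* At [rho = 0] the quantity [T] is nonnegative, the term of order [r ^ 2] being [N] because
   [N rho ^ 2] makes [phi] subharmonic there. So the loss carries a factor [rho], as does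
   [expR xi - 1] on the other side. *)
have T_ge : - (rho * (N * rho + 2 * N * (1 + N) * rhoy + C1 * r)) <= T.
  have d1 : dphi <= 1 + N by rewrite /dphi; nra.
  have d0 : 0 <= dphi by rewrite /dphi; nra.
  have t1 : - (2 * N * (1 + N) * rho * rhoy) <=
      dphi * rhoy - rhoy * dphi ^+ 2 * (1 - 2 * rho).
    have -> : dphi * rhoy - rhoy * dphi ^+ 2 * (1 - 2 * rho) =
       rhoy * dphi * (2 * rho - 2 * N * rho + 4 * N * rho ^+ 2).
      by rewrite /dphi; ring.
    have u1 : - (2 * N * rho) <= 2 * rho - 2 * N * rho + 4 * N * rho ^+ 2 by nra.
    have u2 : rhoy * dphi * - (2 * N * rho) <=
       rhoy * dphi * (2 * rho - 2 * N * rho + 4 * N * rho ^+ 2).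
      by rewrite ler_wpM2l// mulr_ge0// ltW.
    apply: le_trans u2; rewrite mulrN lerN2.
    have : rhoy * dphi <= rhoy * (1 + N) by rewrite ler_wpM2l// ltW.
    have : 0 <= 2 * N * rho by nra.
    by nra.
  have t2 : - (4 * pole_beta N * (1 + N) * r * rho) <=
      - (4 * pole_beta N * r * dphi * (rho - rhoy - a2 / 2)).
    rewrite lerN2.
    have : dphi * (rho - rhoy - a2 / 2) <= (1 + N) * rho.
      have : dphi * (rho - rhoy - a2 / 2) <= dphi * rho by rewrite ler_wpM2l//; lra.
      by move=> h; apply: le_trans h _; rewrite ler_wpM2r.
    have : 0 <= 4 * pole_beta N * r by have := mulr_gt0 b0 r0; lra.
    by nra.
  have t3 : - ((2 * N ^+ 2 + 4 * N) * r * rho) <=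
      r ^+ 2 * (- N * dphi + 2 * N * (1 - 2 * rho)).
    have -> : - N * dphi + 2 * N * (1 - 2 * rho) = N - (2 * N ^+ 2 + 4 * N) * rho.
      by rewrite /dphi; ring.
    have : r ^+ 2 * ((2 * N ^+ 2 + 4 * N) * rho) <= r * ((2 * N ^+ 2 + 4 * N) * rho).
      rewrite ler_wpM2r//; last by nra.
      by rewrite mulr_ge0//; nra.
    have : 0 <= r ^+ 2 * N by rewrite mulr_ge0 ?sqr_ge0//; lra.
    by rewrite mulrBr; lra.
  have t4 : 0 <= dphi * (a2 / 2) by rewrite mulr_ge0// divr_ge0.
  have -> : T = - N * rho ^+ 2 + (dphi * rhoy - rhoy * dphi ^+ 2 * (1 - 2 * rho))
     + dphi * (a2 / 2) - 4 * pole_beta N * r * dphi * (rho - rhoy - a2 / 2)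
     + r ^+ 2 * (- N * dphi + 2 * N * (1 - 2 * rho)).
    by rewrite /T /phi /dphi; ring.
  have -> : - (rho * (N * rho + 2 * N * (1 + N) * rhoy + C1 * r)) =
     - N * rho ^+ 2 - 2 * N * (1 + N) * rho * rhoy - 4 * pole_beta N * (1 + N) * r * rho
     - (2 * N ^+ 2 + 4 * N) * r * rho by rewrite /C1; ring.
  by lra.
have K1_le : K1 <= - ((4 * pole_beta N + C1 + 3 / 2 * pole_beta N * Z) / r).
  have -> : K1 = - ((4 * pole_beta N + C1 + 3 / 2 * pole_beta N * Z) / r) - 4 * pole_beta N ^+ 2 * Z.
    by rewrite /K1 eZ /pole_lambda /C1; field.
  by have := mulr_ge0 (sqr_ge0 (pole_beta N)) Z0; lra.
pose Q := 4 * pole_beta N + C1 + 3 / 2 * pole_beta N * Z.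
have Q0 : 0 < Q by have := mulr_ge0 (ltW b0) Z0; rewrite /Q; lra.
have ex : X * Y * (1 + X * Y / 4) <= expR (rhoy * phi / r ^+ 2) - 1.
  have xi : X * Y <= rhoy * phi / r ^+ 2.
    have -> : rhoy * phi / r ^+ 2 = X * Y + N * X ^+ 2 * Y * r.
      by rewrite /phi eX eY; field.
    rewrite lerDl; apply: mulr_ge0; last exact: ltW.
    apply: mulr_ge0; last exact: ltW.
    by apply: mulr_ge0; [lra|exact: sqr_ge0].
  have XY0 : 0 <= X * Y by rewrite mulr_ge0// ltW.
  have := expR_ge_quad XY0.
  have : expR (X * Y) <= expR (rhoy * phi / r ^+ 2) by rewrite ler_expR.
  by nra.
have main : N * X + 2 * N * (1 + N) * Y + C1 <= (1 + X * Y / 4) * Q.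
  have XY0 : 0 <= X * Y by rewrite mulr_ge0// ltW.
  have h1 : N * X + 2 * N * (1 + N) * Y <= pole_beta N * (X + Y).
    have N0 : 0 <= N by lra.
    have a1 := mulr_ge0 N0 X0; have a2' := mulr_ge0 N0 a1.
    by rewrite /pole_beta; lra.
  (* From [(X + Y - 2)^2 >= 0] and [(X + Y)^2 = (X - Y)^2 + 4 X Y]. The damping pays for [Z], the
     quadratic term of the exponential for [X Y]. *)
  have h2 : X + Y <= 1 + Z / 4 + X * Y.
    by have := sqr_ge0 (X + Y - 2); lra.
  have h3 : pole_beta N * (X + Y) <= pole_beta N * (1 + Z / 4 + X * Y) by rewrite ler_wpM2l// ltW.
  have h4 : pole_beta N * (1 + Z / 4 + X * Y) <= (1 + X * Y / 4) * (4 * pole_beta N + 3 / 2 * pole_beta N * Z).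
    have := mulr_ge0 (ltW b0) (mulr_ge0 XY0 Z0).
    by have := mulr_ge0 (ltW b0) Z0; lra.
  have h5 : C1 <= (1 + X * Y / 4) * C1.
    by have := mulr_ge0 XY0 (ltW C10); lra.
  rewrite (_ : (1 + X * Y / 4) * Q = (1 + X * Y / 4) * (4 * pole_beta N + 3 / 2 * pole_beta N * Z) + (1 + X * Y / 4) * C1); last by rewrite /Q; ring.
  by lra.
have e1 : (expR (rhoy * phi / r ^+ 2) - 1) * K1 <= X * Y * (1 + X * Y / 4) * - (Q / r).
  have XY0 : 0 <= X * Y * (1 + X * Y / 4).
    have XYp : 0 <= X * Y by rewrite mulr_ge0// ltW.
    by apply: mulr_ge0 => //; lra.
  have q0 : 0 < Q / r by rewrite divr_gt0.
  have : (expR (rhoy * phi / r ^+ 2) - 1) * K1 <= (expR (rhoy * phi / r ^+ 2) - 1) * - (Q / r).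
    by rewrite ler_wpM2l//; lra.
  by nra.
apply: (le_trans e1).
have e2 : rhoy / r ^+ 4 * - (rho * (N * rho + 2 * N * (1 + N) * rhoy + C1 * r))
    <= rhoy / r ^+ 4 * T.
  by rewrite ler_wpM2l// divr_ge0 ?exprn_ge0// ltW.
apply: le_trans e2.
have -> : rhoy / r ^+ 4 * - (rho * (N * rho + 2 * N * (1 + N) * rhoy + C1 * r)) =
   - (X * Y * (N * X + 2 * N * (1 + N) * Y + C1) / r).
  by rewrite eX eY; field.
have -> : X * Y * (1 + X * Y / 4) * - (Q / r) = - (X * Y * ((1 + X * Y / 4) * Q) / r).
  by ring.
rewrite lerN2 ler_pM2r ?invr_gt0//; apply: ler_wpM2l => //.
by apply: mulr_ge0 => //; exact: ltW.
Qed.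

(** For [X >= 1/4] the bump is steep enough to give [br <= 0]. In the core [X < 1/4], [expR (- al)]
    is at most half of [expR (- al * X)], and the decay [2 al^2 dF] dominates [br <= al^2 dF]. *)
Lemma ball_barrier_ineq (al X I dF br : R) :
  6 <= al -> 0 <= X < 1 -> 0 < I <= dF ->
  br <= al * I * (al - 4 * al * X) ->
  (- (2 * al ^+ 2) * dF + br) * expR (- al * X) <=
  - (2 * al ^+ 2) * dF * expR (- al).
Proof.
move=> al6 /andP[X0 X1] /andP[I0 IF] hbr.
have e0 := expR_gt0 (- al * X).
have e1 : expR (- al) <= expR (- al * X) by rewrite ler_expR; nra.
have [X4|X4] := leP 4^-1 X.
  have : br <= 0 by apply: le_trans hbr _; rewrite pmulr_rle0 ?mulr_gt0//; nra.
  have : 0 <= 2 * al ^+ 2 * dF by rewrite !mulr_ge0 ?sqr_ge0//; lra.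
  by nra.
have half : expR (- al) <= 2^-1 * expR (- al * X).
  have h2 : 2 <= expR (al * (1 - X)).
    apply: le_trans (expR_ge1Dx _); nra.
  have -> : expR (- al * X) = expR (al * (1 - X)) * expR (- al).
    by rewrite -expRD; congr expR; ring.
  by have := expR_gt0 (- al); nra.
have hb : br <= al ^+ 2 * dF.
  apply: le_trans hbr _.
  have : al * I * (al - 4 * al * X) <= al * I * al.
    by rewrite ler_wpM2l ?mulr_ge0//; [lra|lra|nra].
  by move/le_trans; apply; nra.
have : 0 <= al ^+ 2 * dF by rewrite mulr_ge0 ?sqr_ge0//; lra.
set A := al ^+ 2 * dF in hb *; move=> A0.
have -> : - (2 * al ^+ 2) * dF = - 2 * A by rewrite /A; ring.
have h1 : (- 2 * A + br) * expR (- al * X) <= - A * expR (- al * X).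
  by rewrite ler_pM2r//; lra.
have h2 : A * expR (- al) <= A * (2^-1 * expR (- al * X)) by rewrite ler_wpM2l.
by lra.
Qed.

End barrier_inequalities.

(** * The barrier issued from the pole *)

Section pole_barrier.
Variables (R : realType) (n : nat).
Implicit Types (x y c v : 'rV[R]_n).

Lemma continuous_hexp (a k p1 p2 : R -> R) y c v s x : 0 < s ->
  {for s, continuous a} -> {for s, continuous k} ->
  {for s, continuous p1} -> {for s, continuous p2} ->
  {for (s, x), continuous (fun q : R * 'rV[R]_n =>
     expR (hexp a k p1 p2 y c v q.1 q.2))}.
Proof.
move=> s0 ca ck cp1 cp2.
have c1 (f : R -> R) : {for s, continuous f} ->
    f q.1 @[q --> (s, x)] --> f s.
  by move=> cf; exact: (continuous_cvg _ cf cvg_fst).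
have cD (f g : R * 'rV[R]_n -> R) (l1 l2 : R) : f q @[q --> (s, x)] --> l1 ->
   g q @[q --> (s, x)] --> l2 -> f q + g q @[q --> (s, x)] --> l1 + l2.
  by move=> ? ?; exact: (@cvgD _ _ _ (nbhs (s, x))).
have cM (f g : R * 'rV[R]_n -> R) (l1 l2 : R) : f q @[q --> (s, x)] --> l1 ->
   g q @[q --> (s, x)] --> l2 -> f q * g q @[q --> (s, x)] --> l1 * l2.
  by move=> ? ?; exact: (@cvgM _ _ (nbhs (s, x))).
have cs (c' v' : 'rV[R]_n) : sqd c' v' q.1 q.2 @[q --> (s, x)] --> sqd c' v' s x.
  exact: (@continuous_sqd R n c' v' (s, x)).
apply: (@continuous_comp _ _ _ (fun q : R * 'rV[R]_n => hexp a k p1 p2 y c v q.1 q.2) expR); last first.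
  exact: continuous_expR.
rewrite /hexp.
apply: (cD); last first.
  apply: (cM); first exact: (c1).
  have := cM _ _ _ _ (cs c v) (cs c v).
  by under eq_fun do rewrite -expr2.
apply: (cD); last by apply: (cM) => //; exact: (c1).
apply: (cD); last by apply: (cM) => //; exact: (c1).
apply: (cD); last by exact: (c1).
apply: (cD).
  apply: (cM); first exact: cvg_cst.
  by apply: (c1); exact: continuous_ln.
under eq_fun do rewrite -mulrN; rewrite -mulrN.
apply: (cM) => //.
apply: (c1 (fun t => - (4 * t)^-1)).
have n4 : 4 * s != 0 by rewrite mulf_neq0// gt_eqF.
have h : 4 * t @[t --> s] --> 4 * s.
  by apply: (@cvgM _ _ (nbhs s)); [exact: cvg_cst|exact: (fun _ h => h)].
apply: cvgN; exact: cvgV.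
Qed.

Variables (y c v : 'rV[R]_n) (rad : R).
Let N : R := n%:R.
Let e := c - y.
Let ry := (1 - dot e e / rad ^+ 2) / 2.

Definition pole_a1 (s : R) := - pole_lambda N / rad * Num.sqrt s.
Definition pole_k (s : R) := - pole_beta N / rad * (Num.sqrt s)^-1.
(** The term added to [pole_a1], [pole_p1] and [pole_p2] are the coefficients of [- pole_xi] as a
    polynomial of degree 2 in the squared distance to the moving centre. Thus [1 - exp (- xi)] times
    the damped Gaussian is a difference of two exponentials covered by [jet_hexp]. *)
Definition pole_a2 (s : R) :=
  pole_a1 s + - (ry * (2^-1 + N / 4) * rad ^+ 2) * s^-1.
Definition pole_p1 (s : R) := ry * (1 + N) / 2 * s^-1.
Definition pole_p2 (s : R) := - (ry * N / (4 * rad ^+ 2)) * s^-1.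

(* In a half-space the ratio of the Dirichlet kernel to [p] is [1 - exp (- x1 y1 / s)].
   In a ball, [x1 y1] becomes [ry * phi] with [phi = rho + N rho ^ 2], subharmonic
   near the sphere; the remaining errors are absorbed by the factor
   [exp (- pole_beta |x - y|^2 / (rad sqrt s) - pole_lambda sqrt s / rad)]. *)
Definition pole_barrier (s : R) x : R :=
  expR (hexp pole_a1 pole_k (fun=> 0) (fun=> 0) y c v s x) -
  expR (hexp pole_a2 pole_k pole_p1 pole_p2 y c v s x).

Definition pole_xi (s z : R) : R :=
  let rho := (1 - z / rad ^+ 2) / 2 in
  ry * (rho + N * rho ^+ 2) * rad ^+ 2 / s.

Lemma pole_exponentE (s : R) x : 0 < rad -> 0 < s ->
  hexp pole_a2 pole_k pole_p1 pole_p2 y c v s x =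
  hexp pole_a1 pole_k (fun=> 0) (fun=> 0) y c v s x - pole_xi s (sqd c v s x).
Proof.
move=> r0 s0; rewrite /hexp /pole_a2 /pole_p1 /pole_p2 /pole_xi.
have rn0 : rad != 0 by rewrite gt_eqF.
have sn0 : s != 0 by rewrite gt_eqF.
by field; rewrite ?rn0 ?sn0.
Qed.

Lemma pole_coef_derive (s : R) : 0 < rad -> 0 < s ->
  [/\ is_derive s (1 : R) pole_a1 (- pole_lambda N / rad / (2 * Num.sqrt s)),
      is_derive s (1 : R) pole_k (pole_beta N / rad / (2 * Num.sqrt s ^+ 3)),
      is_derive s (1 : R) pole_a2 (- pole_lambda N / rad / (2 * Num.sqrt s)
         + ry * (2^-1 + N / 4) * rad ^+ 2 / s ^+ 2),
      is_derive s (1 : R) pole_p1 (- (ry * (1 + N) / 2) / s ^+ 2) &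
      is_derive s (1 : R) pole_p2 (ry * N / (4 * rad ^+ 2) / s ^+ 2)].
Proof.
move=> r0 s0.
have rn0 : rad != 0 by rewrite gt_eqF.
have sn0 : s != 0 by rewrite gt_eqF.
have q0 : Num.sqrt s != 0 by rewrite gt_eqF// sqrtr_gt0.
have ds := is_derive1_sqrt s0.
have di := is_derive_invr sn0 (is_derive_idR s).
have d1 : is_derive s (1 : R) pole_a1 (- pole_lambda N / rad / (2 * Num.sqrt s)).
  exact: (is_derive_scale (- pole_lambda N / rad) ds).
split => //.
- have := is_derive_scale (- pole_beta N / rad) (is_derive_invr q0 ds).
  by apply: is_derive_ext => //; field; rewrite q0.
- have := is_deriveD d1 (is_derive_scale (- (ry * (2^-1 + N / 4) * rad ^+ 2)) di).
  by apply: is_derive_ext => //; field; rewrite ?sn0 ?q0 ?rn0.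
- have := is_derive_scale (ry * (1 + N) / 2) di.
  by apply: is_derive_ext => //; field.
- have := is_derive_scale (- (ry * N / (4 * rad ^+ 2))) di.
  by apply: is_derive_ext => //; field; rewrite ?sn0 ?q0 ?rn0.
Qed.

Lemma pole_barrier_continuous (s : R) x : 0 < rad -> 0 < s ->
  {for (s, x), continuous (fun q : R * 'rV[R]_n => pole_barrier q.1 q.2)}.
Proof.
move=> r0 s0; have [d1 d2 d3 d4 d5] := pole_coef_derive r0 s0.
have c0 : {for s, continuous (fun _ : R => 0 : R)} by exact: cst_continuous.
have [c1 c2] := (is_derive_continuous d1, is_derive_continuous d2).
have c3 := is_derive_continuous d3.
have [c4 c5] := (is_derive_continuous d4, is_derive_continuous d5).
apply: cvgB; apply: continuous_hexp.
1,6: exact: s0.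
- exact: (c1).
- exact: (c2).
- exact: (c0).
- exact: (c0).
- exact: (c3).
- exact: (c2).
- exact: (c4).
- exact: (c5).
Qed.

Lemma pole_barrier_sphere (s : R) x : 0 < rad -> 0 < s -> sqd c v s x = rad ^+ 2 ->
  pole_barrier s x = 0.
Proof.
move=> r0 s0 hz; rewrite /pole_barrier pole_exponentE// /pole_xi hz divff; last first.
  by rewrite expf_neq0// gt_eqF.
by rewrite subrr !mul0r expr0n mulr0 addr0 mulr0 !mul0r subr0 subrr.
Qed.

Lemma pole_barrier_jet (s : R) x : (0 < n)%N -> 0 < rad -> 0 < s <= rad ^+ 2 ->
  dot e e < rad ^+ 2 -> sqd c v s x < rad ^+ 2 ->
  exists ws g l, jet pole_barrier s x ws g l /\ ws <= \sum_i l i.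
Proof.
move=> n0 r0 /andP[s0 s1] he hz.
have [d1 d2 d3 d4 d5] := pole_coef_derive r0 s0.
have [ws1 [g1 [l1 [j1 E1]]]] := jet_hexp y c v x s0 d1 d2
  (is_derive_cst (0 : R) s 1) (is_derive_cst (0 : R) s 1).
have [ws2 [g2 [l2 [j2 E2]]]] := jet_hexp y c v x s0 d3 d2 d4 d5.
exists (ws1 - ws2), (fun i => g1 i - g2 i), (fun i => l1 i - l2 i); split.
  exact: (jetD j1 (jetN j2)).
rewrite sumrB -subr_le0.
have -> : ws1 - ws2 - (\sum_i l1 i - \sum_i l2 i) =
  (ws1 - \sum_i l1 i) - (ws2 - \sum_i l2 i) by ring.
rewrite {}E1 {}E2 pole_exponentE// -/e.
have zE : dot (x - c - s *: v) (x - c - s *: v) = sqd c v s x by [].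
have Bz := dot_ge0 (x - c - s *: v).
have := sqdiff_dot_le r0 (ltW hz) (ltW he).
rewrite zE in Bz *.
move: (dot e (x - c - s *: v)) => eB hcs.
set E := hexp _ _ _ _ _ _ _ _ _.
set z := sqd c v s x in hcs hz Bz *.
rewrite expRD expRN.
set xi := pole_xi s z.
pose r := Num.sqrt s / rad.
have rn0 : rad != 0 by rewrite gt_eqF.
have q0 : 0 < Num.sqrt s by rewrite sqrtr_gt0.
have rr0 : 0 < r by rewrite divr_gt0.
have r1 : r <= 1.
  by rewrite ler_pdivrMr// mul1r -(ger0_norm (ltW r0)) -sqrtr_sqr ler_wsqrtr.
have sq : Num.sqrt s = r * rad by rewrite /r divfK.
have sE : s = (r * rad) ^+ 2 by rewrite -sq sqr_sqrtr// ltW.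
have N1 : 1 <= N by rewrite ler1n.
have r20 : 0 < rad ^+ 2 by rewrite exprn_gt0.
pose rho := (1 - z / rad ^+ 2) / 2.
pose a2 := (z + eB + eB + dot e e) / rad ^+ 2.
have rho01 : 0 <= rho <= 2^-1.
  have : 0 <= z / rad ^+ 2 by rewrite divr_ge0// ltW.
  have : z / rad ^+ 2 <= 1 by rewrite ler_pdivrMr// mul1r ltW.
  by rewrite /rho; lra.
have ry0 : 0 < ry.
  have : dot e e / rad ^+ 2 < 1 by rewrite ltr_pdivrMr// mul1r.
  by rewrite /ry; lra.
have ha2 : (rho - ry) ^+ 2 <= a2.
  have -> : (rho - ry) ^+ 2 = (dot e e - z) ^+ 2 / (4 * rad ^+ 2) / rad ^+ 2.
    by rewrite /rho /ry; field.
  rewrite ler_pM2r ?invr_gt0// ler_pdivrMr; last by rewrite mulr_gt0.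
  by move: hcs; rewrite mulrC; lra.
have rr : 0 < r <= 1 by rewrite rr0.
have := pole_barrier_ineq N1 rr rho01 ry0 ha2.
rewrite (_ : ry * (rho + N * rho ^+ 2) / r ^+ 2 = xi); last first.
  rewrite /xi /pole_xi -/rho sE; field.
  by rewrite rn0 gt_eqF.
have xE := expR_gt0 xi; have EE := expR_gt0 E.
set K1n := (X in _ * X <= _); set Tn := (X in _ <= X) => main.
have rnz : r != 0 by rewrite gt_eqF.
rewrite /pole_k /pole_p1 /pole_p2 sq.
set K1 := (X in expR E * X - _ <= _); set K2 := (X in _ - _ * X <= _).
have k1 : K1 = K1n / rad ^+ 2.
  rewrite /K1 /K1n sE /cst -/N /a2.
  by field; rewrite rn0.
have k2 : K2 = K1 + Tn / rad ^+ 2.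
  rewrite /K2 /K1 /Tn sE /cst -/N /a2 /rho.
  by rewrite /ry; field; rewrite rn0.
(* The second exponential is the first one divided by [expR xi]; once it is factored out, only the
   scalar inequality remains. *)
have -> : expR E * K1 - expR E / expR xi * K2 =
   expR E / expR xi * ((expR xi - 1) * K1 - Tn / rad ^+ 2).
  by rewrite k2; clearbody K1 K2 Tn; field; rewrite ?rn0 ?gt_eqF.
rewrite pmulr_rle0; last by rewrite divr_gt0.
have -> : (expR xi - 1) * K1 - Tn / rad ^+ 2 = ((expR xi - 1) * K1n - Tn) / rad ^+ 2.
  by rewrite k1; field.
by rewrite pmulr_lle0 ?invr_gt0// subr_le0.
Qed.

End pole_barrier.

(** * The barrier in a ball of variable radius *)

Section ball_barrier.
Variables (R : realType) (n : nat).
Implicit Types (x : 'rV[R]_n).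
Variables (y c v : 'rV[R]_n) (rad kap t a0 : R).
Let N : R := n%:R.
Let e := c - y.

(* The radius is [rad] at the times [rad ^ 2] and [t]; the clock is an explicit
   primitive of a function that dominates [radius ^ -2]. *)
Definition tube_radius (s : R) := rad + kap * (s - rad ^+ 2) * (t - s) / t.

Definition tube_clock (s : R) :=
  s * (rad / 2 * (rad / 2 + kap / 2 * s))^-1 -
  (t - s) * (rad / 2 * (rad / 2 + kap / 2 * (t - s)))^-1.

(** Here [2 N] is the Laplacian of the squared distance and 4 bounds the drift due to [e]; their sum
    has to be at most the rate in [ball_barrier_ineq]. *)
Definition tube_rate : R := 2 * N + 4.
Definition tube_a1 (s : R) := a0 + - (2 * tube_rate ^+ 2) * tube_clock s.
Definition tube_a2 (s : R) := tube_a1 s - tube_rate.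
Definition tube_p (s : R) := - tube_rate * (tube_radius s ^+ 2)^-1.

(** The exponential barrier of Hopf's lemma, times the exact Gaussian and a factor decreasing with
    the clock. *)
Definition tube_barrier (s : R) x : R :=
  expR (hexp tube_a1 (fun=> 0) tube_p (fun=> 0) y c v s x) -
  expR (hexp tube_a2 (fun=> 0) (fun=> 0) (fun=> 0) y c v s x).

Lemma tube_barrierE (s : R) x : tube_barrier s x =
  expR (- (n%:R / 2) * ln s - sqd y 0 s x / (4 * s)) * expR (tube_a1 s) *
  (expR (- tube_rate * (sqd c v s x / tube_radius s ^+ 2)) - expR (- tube_rate)).
Proof.
rewrite /tube_barrier -expRD mulrBr -!expRD /hexp /tube_a2 /tube_p.
by congr (expR _ - expR _); ring.
Qed.

(** The bound on [kap * rad ^ 2] makes [tube_radius s / s] nonincreasing and keeps the radius above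
    the denominators of the clock. The bound on [rad * kap] gives [rad * tube_radius s <= s], which
    controls the drift due to the pole offset. *)
Definition tube_ok : Prop :=
  [/\ 0 < rad, 0 <= kap, rad ^+ 2 < t, kap * rad ^+ 2 <= rad / 2 & rad * kap <= 1].

Let t_gt0 : tube_ok -> 0 < t.
Proof. by case=> _ _ rt _ _; apply: le_lt_trans rt; exact: sqr_ge0. Qed.

Lemma tube_radius_ge (s : R) : tube_ok ->
  rad ^+ 2 <= s <= t -> rad <= tube_radius s.
Proof.
move=> ok; have [rad0 kap0 rt kr kr1] := ok; have t0 := t_gt0 ok.
move=> /andP[s0 s1]; rewrite lerDl divr_ge0 ?(ltW t0)//.
by rewrite !mulr_ge0// subr_ge0.
Qed.

Lemma tube_radius_le (s : R) : tube_ok ->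
  rad ^+ 2 <= s <= t ->
  tube_radius s <= rad + kap * (s - rad ^+ 2).
Proof.
move=> ok; have [rad0 kap0 rt kr kr1] := ok; have t0 := t_gt0 ok.
move=> /andP[s0 s1]; rewrite lerD2l ler_pdivrMr// ler_wpM2l//.
  by rewrite mulr_ge0// subr_ge0.
by have := sqr_ge0 rad; lra.
Qed.

Lemma is_derive_tube_radius (s : R) : tube_ok ->
  is_derive s (1 : R) tube_radius
  (kap * (t + rad ^+ 2 - 2 * s) / t).
Proof.
move=> ok; have [rad0 kap0 rt kr kr1] := ok; have t0 := t_gt0 ok.
have := is_derive_quad (rad - kap * rad ^+ 2) (kap * (t + rad ^+ 2) / t) (- kap / t) s.
have tn0 : t != 0 by rewrite gt_eqF.
by apply: is_derive_ext => [k|]; rewrite /tube_radius; field.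
Qed.

Let clock_den (s : R) := rad / 2 + kap / 2 * s.

Let is_derive_clock_half (s : R) : tube_ok ->
  0 <= s ->
  is_derive s (1 : R) (fun u => u * (rad / 2 * clock_den u)^-1)
    ((clock_den s ^+ 2)^-1).
Proof.
move=> ok; have [rad0 kap0 rt kr kr1] := ok; have t0 := t_gt0 ok.
move=> s0; have d0 : 0 < clock_den s.
  by rewrite /clock_den; have := mulr_ge0 kap0 s0; lra.
have n0 : rad / 2 * clock_den s != 0 by rewrite gt_eqF// mulr_gt0// divr_gt0.
have d1 : is_derive s (1 : R) (fun u => rad / 2 * clock_den u) (rad / 2 * (kap / 2)).
  apply: is_derive_scale; have := is_derive_affine (rad / 2) (kap / 2) s.
  by apply: is_derive_ext => // k; rewrite /clock_den (mulrC k).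
have := is_derive_mul (is_derive_idR s) (@is_derive_invr _ (fun u => rad / 2 * clock_den u) s _ n0 d1).
apply: is_derive_ext => //.
have dn0 : clock_den s != 0 by rewrite gt_eqF.
have rn0 : rad != 0 by rewrite gt_eqF.
have e1 : kap / 2 * s = clock_den s - rad / 2 by rewrite /clock_den; ring.
have -> : 1 / (rad / 2 * clock_den s) + s * (- (rad / 2 * (kap / 2)) / (rad / 2 * clock_den s) ^+ 2)
  = 1 / (rad / 2 * clock_den s) - (kap / 2 * s) * (rad / 2) / (rad / 2 * clock_den s) ^+ 2.
  by ring.
rewrite e1; move: dn0; move: (clock_den s) => d dn0.
by field; rewrite rn0 dn0.
Qed.

Lemma is_derive_tube_clock (s : R) : tube_ok ->
  0 <= s <= t ->
  is_derive s (1 : R) tube_clock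
    ((clock_den s ^+ 2)^-1 + (clock_den (t - s) ^+ 2)^-1).
Proof.
move=> ok; have [rad0 kap0 rt kr kr1] := ok; have t0 := t_gt0 ok.
move=> /andP[s0 s1].
have ts0 : 0 <= t - s by rewrite subr_ge0.
have d1 : is_derive s (1 : R) (fun u => t - u) (- 1).
  have := is_derive_affine t (-1) s.
  by apply: is_derive_ext => // k; rewrite mulrN1.
have d2 := @is_derive1_comp _ (fun u => u * (rad / 2 * clock_den u)^-1) (fun u => t - u)
  s _ _ (is_derive_clock_half ok ts0) d1.
have := is_deriveD (is_derive_clock_half ok s0) (is_deriveN d2).
by apply: is_derive_ext => //; rewrite mulrN1 opprK.
Qed.

Let rate6 : (0 < n)%N -> 6 <= tube_rate.
Proof. by move=> n0; have : 1 <= N by [rewrite ler1n]; rewrite /tube_rate; lra. Qed.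

(** On the first half of [[0, t]], [(t - s) / t >= 1/2] and [kap * rad ^ 2 <= rad / 2] put
    [clock_den s] below the radius; on the second half the same holds for [clock_den (t - s)]. The
    clock adds both contributions, so one of them always suffices. *)
Lemma tube_clock_rate_ge (s : R) : tube_ok ->
  rad ^+ 2 <= s <= t ->
  (tube_radius s ^+ 2)^-1 <= (clock_den s ^+ 2)^-1 + (clock_den (t - s) ^+ 2)^-1.
Proof.
move=> ok; have [rad0 kap0 rt kr kr1] := ok; have t0 := t_gt0 ok.
move=> sab; have /andP[s0 s1] := sab.
have s00 : 0 <= s by apply: le_trans s0; exact: sqr_ge0.
have ts0 : 0 <= t - s by rewrite subr_ge0.
have den0 u : 0 <= u -> 0 < clock_den u.
  by move=> u0; rewrite /clock_den; have := mulr_ge0 kap0 u0; lra.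
have inv0 u : 0 <= u -> 0 <= (clock_den u ^+ 2)^-1.
  by move=> u0; rewrite invr_ge0 sqr_ge0.
have rE : tube_radius s = rad + kap * (s * ((t - s) / t)) - kap * rad ^+ 2 * ((t - s) / t).
  by rewrite /tube_radius; field; rewrite gt_eqF.
have q1 : (t - s) / t <= 1 by rewrite ler_pdivrMr// mul1r; lra.
have q0 : 0 <= (t - s) / t by rewrite divr_ge0// ltW.
have kr2 : kap * rad ^+ 2 * ((t - s) / t) <= rad / 2.
  have : 0 <= kap * rad ^+ 2 by rewrite mulr_ge0// sqr_ge0.
  by move: kr q0 q1; nra.
have cmp u : 0 <= u -> clock_den u <= tube_radius s ->
    (tube_radius s ^+ 2)^-1 <= (clock_den u ^+ 2)^-1.
  move=> u0 h; rewrite lef_pV2 ?posrE ?exprn_gt0 ?den0//; last first.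
    exact: lt_le_trans (den0 _ u0) h.
  by rewrite ler_pXn2r// nnegrE ltW// ?den0//; exact: lt_le_trans (den0 _ u0) h.
have [h|h] := leP s (t / 2).
  have : clock_den s <= tube_radius s.
    have : kap * (s * 2^-1) <= kap * (s * ((t - s) / t)).
      rewrite ler_wpM2l// ler_wpM2l//.
      by rewrite ler_pdivlMr//; lra.
    by rewrite rE /clock_den; lra.
  by move=> /(cmp _ s00); have := inv0 _ ts0; lra.
have : clock_den (t - s) <= tube_radius s.
  have : kap * ((t - s) * 2^-1) <= kap * (s * ((t - s) / t)).
    rewrite ler_wpM2l// [leRHS]mulrCA ler_wpM2l//.
    by rewrite ler_pdivlMr//; lra.
  by rewrite rE /clock_den; lra.
by move=> /(cmp _ ts0); have := inv0 _ s00; lra.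
Qed.

Lemma tube_barrier_continuous (s : R) x : tube_ok ->
  rad ^+ 2 <= s <= t ->
  {for (s, x), continuous (fun q : R * 'rV[R]_n => tube_barrier q.1 q.2)}.
Proof.
move=> ok; have [rad0 kap0 rt kr kr1] := ok; have t0 := t_gt0 ok.
move=> sab; have /andP[s0 s1] := sab.
have sp : 0 < s by apply: lt_le_trans s0; rewrite exprn_gt0.
have cc : {for s, continuous tube_clock}.
  by apply: (is_derive_continuous (is_derive_tube_clock ok _)); rewrite (ltW sp).
have ca1 : {for s, continuous tube_a1}.
  by apply: cvgD; [exact: cvg_cst|apply: cvgM => //; exact: cvg_cst].
have ca2 : {for s, continuous tube_a2} by apply: cvgB => //; exact: cvg_cst.
have rp : 0 < tube_radius s by exact: lt_le_trans rad0 (tube_radius_ge ok sab).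
have cr := is_derive_continuous (is_derive_tube_radius s ok).
have cp : {for s, continuous tube_p}.
  apply: cvgM; first exact: cvg_cst.
  apply: cvgV; first by rewrite expf_neq0// gt_eqF.
  have : tube_radius u * tube_radius u @[u --> s] --> tube_radius s * tube_radius s.
    exact: (@cvgM _ _ (nbhs s) _ _ _ _ _ cr cr).
  by under eq_fun do rewrite -expr2.
have c0 : {for s, continuous (fun _ : R => 0 : R)} by exact: cst_continuous.
apply: cvgB; apply: continuous_hexp.
1,6: exact: sp.
- exact: (ca1).
- exact: (c0).
- exact: (cp).
- exact: (c0).
- exact: (ca2).
- exact: (c0).
- exact: (c0).
- exact: (c0).
Qed.

Lemma tube_barrier_sphere (s : R) x : tube_ok ->
  rad ^+ 2 <= s <= t ->
  sqd c v s x = tube_radius s ^+ 2 -> tube_barrier s x = 0.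
Proof.
move=> ok; have [rad0 kap0 rt kr kr1] := ok; have t0 := t_gt0 ok.
move=> sab hz; rewrite tube_barrierE hz divff ?mulr1 ?subrr ?mulr0//.
by rewrite expf_neq0// gt_eqF// (lt_le_trans rad0 (tube_radius_ge ok sab)).
Qed.

Lemma tube_barrier_jet (s : R) x : tube_ok ->
  (0 < n)%N -> rad ^+ 2 <= s <= t ->
  dot e e <= rad ^+ 2 -> sqd c v s x < tube_radius s ^+ 2 ->
  exists ws g l, jet tube_barrier s x ws g l /\ ws <= \sum_i l i.
Proof.
move=> ok; have [rad0 kap0 rt kr kr1] := ok; have t0 := t_gt0 ok.
move=> n0 sab he hz; have /andP[sr s1] := sab.
have s0 : 0 < s by apply: lt_le_trans sr; rewrite exprn_gt0.
have rho0 : 0 < tube_radius s by exact: lt_le_trans rad0 (tube_radius_ge ok sab).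
have sn0 : s != 0 by rewrite gt_eqF.
have rn0 : tube_radius s != 0 by rewrite gt_eqF.
have dc := is_derive_tube_clock (s := s) ok ltac:(by rewrite (ltW s0)).
set dF := (_ + _) in dc.
have da1 : is_derive s (1 : R) tube_a1 (- (2 * tube_rate ^+ 2) * dF).
  have := is_deriveD (is_derive_cst (a0 : R) s 1) (is_derive_scale (- (2 * tube_rate ^+ 2)) dc).
  by apply: is_derive_ext => //; rewrite add0r.
have da2 : is_derive s (1 : R) tube_a2 (- (2 * tube_rate ^+ 2) * dF).
  have := is_deriveB da1 (is_derive_cst (tube_rate : R) s 1).
  by apply: is_derive_ext => //; rewrite subr0.
have dr := is_derive_tube_radius s ok.
set r' := (_ / t) in dr.
have dp : is_derive s (1 : R) tube_p (2 * tube_rate * r' / tube_radius s ^+ 3).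
  have r2n0 : tube_radius s ^+ 2 != 0 by rewrite expf_neq0.
  have dr2 : is_derive s (1 : R) (fun u => tube_radius u ^+ 2) (2 * tube_radius s * r').
    have := is_derive_mul dr dr; apply: is_derive_ext => [k|]; first by rewrite expr2.
    by ring.
  have := is_derive_scale (- tube_rate) (@is_derive_invr _ (fun u => tube_radius u ^+ 2) s _ r2n0 dr2).
  by apply: is_derive_ext => //; field.
have d0 := is_derive_cst (0 : R) s 1.
have [ws1 [g1 [l1 [j1 E1]]]] := jet_hexp y c v x s0 da1 d0 dp d0.
have [ws2 [g2 [l2 [j2 E2]]]] := jet_hexp y c v x s0 da2 d0 d0 d0.
exists (ws1 - ws2), (fun i => g1 i - g2 i), (fun i => l1 i - l2 i); split.
  exact: (jetD j1 (jetN j2)).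
rewrite sumrB -subr_le0.
have -> : ws1 - ws2 - (\sum_i l1 i - \sum_i l2 i) =
  (ws1 - \sum_i l1 i) - (ws2 - \sum_i l2 i) by ring.
rewrite {}E1 {}E2 -/e /cst.
have zE : dot (x - c - s *: v) (x - c - s *: v) = sqd c v s x by [].
have hcs := dot_sqr_le e (x - c - s *: v).
have Bz := dot_ge0 (x - c - s *: v).
rewrite zE in Bz hcs *.
move: (dot e (x - c - s *: v)) hcs => eB hcs.
pose X := sqd c v s x / tube_radius s ^+ 2.
have zX : sqd c v s x = X * tube_radius s ^+ 2.
  by rewrite /X divfK// expf_neq0.
have r20 : 0 < tube_radius s ^+ 2 by rewrite exprn_gt0.
have X01 : 0 <= X < 1.
  apply/andP; split; first by apply: divr_ge0 => //; exact: ltW.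
  by rewrite ltr_pdivrMr// mul1r.
have al6 := rate6 n0.
pose I := (tube_radius s ^+ 2)^-1.
have I0 : 0 < I by rewrite invr_gt0.
have IdF : 0 < I <= dF by rewrite I0; exact: tube_clock_rate_ge.
pose br := 2 * tube_rate * r' / tube_radius s ^+ 3 * sqd c v s x
  - N * (2 * tube_p s) - (2 * tube_p s) ^+ 2 * sqd c v s x
  + 2 * tube_p s * (sqd c v s x + eB) / s.
have hbr : br <= tube_rate * I * (tube_rate - 4 * tube_rate * X).
  have -> : br = tube_rate * I * (2 * X * (tube_radius s * r' - tube_radius s ^+ 2 / s)
      + 2 * N - 4 * tube_rate * X - 2 * eB / s).
    by rewrite /br zX /tube_p /I; field; rewrite ?rn0 ?sn0.
  rewrite ler_wpM2l//; first by rewrite mulr_ge0 ?ltW//; lra.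
  (* The outward drift [B / s] outweighs the growth of the radius. *)
  have h1 : tube_radius s * r' - tube_radius s ^+ 2 / s <= 0.
    have -> : tube_radius s * r' - tube_radius s ^+ 2 / s =
       tube_radius s / s * (s * r' - tube_radius s) by field.
    rewrite pmulr_rle0 ?divr_gt0//.
    have -> : s * r' - tube_radius s = - rad + (kap * rad ^+ 2 - kap * s ^+ 2 / t).
      by rewrite /r' /tube_radius; field; rewrite gt_eqF.
    have : 0 <= kap * s ^+ 2 / t by rewrite divr_ge0 ?(ltW t0)// mulr_ge0// sqr_ge0.
    by move: kr rad0; lra.
  have h2 : - eB / s <= 2.
    rewrite ler_pdivrMr//.
    have e1 : eB ^+ 2 <= (rad * tube_radius s) ^+ 2.
      apply: le_trans hcs _; rewrite exprMn; apply: ler_pM => //; last exact: ltW.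
      exact: dot_ge0.
    have e2 : - eB <= rad * tube_radius s.
      have p0 : 0 <= rad * tube_radius s by rewrite mulr_ge0// ltW.
      have : `|eB| <= `|rad * tube_radius s| by rewrite -!sqrtr_sqr ler_wsqrtr.
      rewrite (ger0_norm p0) => h; apply: le_trans h.
      by rewrite -normrN; exact: ler_norm.
    apply: le_trans e2 _.
    have := tube_radius_le ok sab => h3.
    have h4 : rad * tube_radius s <= rad * (rad + kap * (s - rad ^+ 2)).
      by rewrite ler_wpM2l// ltW.
    apply: le_trans h4 _.
    have -> : rad * (rad + kap * (s - rad ^+ 2)) = rad ^+ 2 + rad * kap * (s - rad ^+ 2).
      by ring.
    have : rad * kap * (s - rad ^+ 2) <= s - rad ^+ 2.
      by rewrite ler_piMl// subr_ge0.
    by have := sqr_ge0 rad; lra.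
  have h3 : X * (tube_radius s * r' - tube_radius s ^+ 2 / s) <= 0.
    by rewrite mulr_ge0_le0//; case/andP: X01.
  have -> : 2 * eB / s = - 2 * (- eB / s) by ring.
  by rewrite /tube_rate; lra.
have main := ball_barrier_ineq al6 X01 IdF hbr.
set G := - (n%:R / 2) * ln s - sqd y 0 s x / (4 * s) + tube_a1 s.
have -> : hexp tube_a1 (fun=> 0) tube_p (fun=> 0) y c v s x = G + - tube_rate * X.
  by rewrite /hexp /G /X /tube_p; ring.
have -> : hexp tube_a2 (fun=> 0) (fun=> 0) (fun=> 0) y c v s x = G + - tube_rate.
  by rewrite /hexp /G /tube_a2; ring.
clearbody G; rewrite !(expRD G).
set K1 := (Y in _ * Y - _ <= _); set K2 := (Y in _ - _ * Y <= _).
have -> : K2 = - (2 * tube_rate ^+ 2) * dF by rewrite /K2; ring.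
have -> : K1 = - (2 * tube_rate ^+ 2) * dF + br.
  by rewrite /K1 /br -/N; ring.
have G0 := expR_gt0 G.
have -> : expR G * expR (- tube_rate * X) * (- (2 * tube_rate ^+ 2) * dF + br) -
    expR G * expR (- tube_rate) * (- (2 * tube_rate ^+ 2) * dF) =
    expR G * ((- (2 * tube_rate ^+ 2) * dF + br) * expR (- tube_rate * X) -
    - (2 * tube_rate ^+ 2) * dF * expR (- tube_rate)) by ring.
by rewrite pmulr_rle0// subr_le0.
Qed.

End ball_barrier.

(** * Gluing of the two barriers *)

Section two_stages.
Variables (R : realType) (n : nat).
Implicit Types (D : set 'rV[R]_n) (U : R -> 'rV[R]_n -> R) (x y c v : 'rV[R]_n).

(** The factor [(4 pi)^(-n/2)] of the Gaussian is left out; it comes back as the total mass in the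
    bound on the kernel. *)
Definition log_gauss (s : R) x y : R :=
  - (n%:R / 2) * ln s - sqd y 0 s x / (4 * s).

(* Constant by which the second barrier is multiplied so that it lies below the first
   one at time [rad ^ 2]. *)
Definition handover (y c : 'rV[R]_n) (rad : R) : R :=
  expR (- pole_lambda n%:R - 4 * pole_beta n%:R) *
  ((1 - dot (c - y) (c - y) / rad ^+ 2) / 2) / (4 * tube_rate R n).

(** The clock term makes [expR] of [tube_a1] at time [rad ^ 2] equal to [handover]. *)
Definition handover_const (y c : 'rV[R]_n) (rad kap t : R) : R :=
  ln (handover y c rad) + 2 * tube_rate R n ^+ 2 * tube_clock rad kap t (rad ^+ 2).

Lemma pole_beta_ge0 (N : R) : 0 <= N -> 0 <= pole_beta N.
Proof. by move=> N0; rewrite /pole_beta !mulr_ge0// addr_ge0. Qed.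

Lemma pole_lambda_ge0 (N : R) : 0 <= N -> 0 <= pole_lambda N.
Proof.
move=> N0; have b0 := pole_beta_ge0 N0; have := mulr_ge0 N0 b0; have := mulr_ge0 N0 N0.
by rewrite /pole_lambda; lra.
Qed.

Lemma tube_rate_ge4 : 4 <= tube_rate R n.
Proof. by rewrite /tube_rate lerDr mulr_ge0. Qed.

Lemma pole_barrier_le y c v (rad s : R) x : 0 < rad -> 0 < s ->
  pole_barrier y c v rad s x <= expR (log_gauss s x y).
Proof.
move=> r0 s0; rewrite /pole_barrier.
have h : expR (hexp (pole_a1 n rad) (pole_k n rad) (fun=> 0) (fun=> 0) y c v s x) <=
    expR (log_gauss s x y).
  rewrite ler_expR /hexp /log_gauss !mul0r !addr0 -addrA gerDl.
  have N0 : 0 <= (n%:R : R) by [].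
  have s1 : 0 <= Num.sqrt s / rad by rewrite divr_ge0 ?sqrtr_ge0 ?ltW.
  have s2 : 0 <= (Num.sqrt s)^-1 / rad by rewrite divr_ge0 ?invr_ge0 ?sqrtr_ge0 ?ltW.
  have := mulr_ge0 (pole_lambda_ge0 N0) s1.
  have := mulr_ge0 (mulr_ge0 (pole_beta_ge0 N0) s2) (dot_ge0 (x - y - s *: v)).
  rewrite /pole_a1 /pole_k /sqd.
  have -> : - pole_lambda n%:R / rad * Num.sqrt s = - (pole_lambda n%:R * (Num.sqrt s / rad)) by ring.
  have -> : - pole_beta n%:R / rad * (Num.sqrt s)^-1 * dot (x - y - s *: v) (x - y - s *: v) =
    - (pole_beta n%:R * ((Num.sqrt s)^-1 / rad) * dot (x - y - s *: v) (x - y - s *: v)) by ring.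
  by lra.
by apply: le_trans h; rewrite gerBl expR_ge0.
Qed.

Lemma one_sub_expRN_ge (z : R) : 0 <= z <= 1 -> z / 2 <= 1 - expR (- z).
Proof.
move=> /andP[z0 z1]; rewrite expRN.
have h : 1 + z <= expR z by exact: expR_ge1Dx.
have : (expR z)^-1 <= (1 + z)^-1 by rewrite lef_pV2 ?posrE ?expR_gt0//; lra.
have : (1 + z)^-1 <= 1 - z / 2.
  rewrite -[leLHS]mul1r ler_pdivrMr; last by lra.
  have : z ^+ 2 <= z by rewrite expr2 ler_piMl.
  by lra.
by lra.
Qed.

Lemma expR_diff_le (al X : R) : 0 <= al -> 0 <= X <= 1 ->
  expR (- al * X) - expR (- al) <= al * (1 - X).
Proof.
move=> al0 /andP[X0 X1].
have e1 : expR (- al) = expR (- al * X) * expR (- (al * (1 - X))).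
  by rewrite -expRD; congr expR; ring.
have h : 1 + - (al * (1 - X)) <= expR (- (al * (1 - X))) by exact: expR_ge1Dx.
have p0 : 0 <= al * (1 - X) by rewrite mulr_ge0// subr_ge0.
have e2 : expR (- al * X) <= 1.
  by rewrite -[leRHS](@expR0 R) ler_expR mulNr oppr_le0 mulr_ge0.
have e3 := expR_gt0 (- al * X).
rewrite e1.
have : expR (- al * X) * (1 + - (al * (1 - X))) <= expR (- al * X) * expR (- (al * (1 - X))).
  by rewrite ler_wpM2l// ltW.
have : expR (- al * X) * (al * (1 - X)) <= al * (1 - X) by rewrite ler_piMl.
by lra.
Qed.

Lemma expR_diff_ge (al X : R) : 0 <= al -> X <= 1 ->
  expR (- al) * (al * (1 - X)) <= expR (- al * X) - expR (- al).
Proof.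
move=> al0 X1.
have -> : expR (- al * X) = expR (- al) * expR (al * (1 - X)).
  by rewrite -expRD; congr expR; ring.
have h : 1 + al * (1 - X) <= expR (al * (1 - X)) by exact: expR_ge1Dx.
have : expR (- al) * (1 + al * (1 - X)) <= expR (- al) * expR (al * (1 - X)).
  by rewrite ler_wpM2l// expR_ge0.
by lra.
Qed.

Lemma handover_gt0 y c (rad : R) : 0 < rad -> dot (c - y) (c - y) < rad ^+ 2 ->
  0 < handover y c rad.
Proof.
move=> r0 he; have : dot (c - y) (c - y) / rad ^+ 2 < 1.
  by rewrite ltr_pdivrMr ?exprn_gt0// mul1r.
have := tube_rate_ge4; rewrite /handover => t4 h.
by rewrite divr_gt0 ?mulr_gt0 ?expR_gt0//; lra.
Qed.

(** Both barriers are linear in the depth [rho]: [1 - exp (- xi) >= ry rho / 2] for the first,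
    [exp (- al X) - exp (- al) <= 2 al rho] for the second. The constant in [handover] is the
    quotient, with [exp (- lambda - 4 beta)] for the damping, since [|x - y - s v| <= 2 rad]. *)
Lemma handover_le y c v (rad kap t : R) x : tube_ok rad kap t ->
  dot (c - y) (c - y) < rad ^+ 2 -> sqd c v (rad ^+ 2) x < rad ^+ 2 ->
  tube_barrier y c v rad kap t (handover_const y c rad kap t) (rad ^+ 2) x <=
  pole_barrier y c v rad (rad ^+ 2) x.
Proof.
move=> ok he hz; have [rad0 kap0 _ _ _] := ok.
have r20 : 0 < rad ^+ 2 by rewrite exprn_gt0.
have rn0 : rad != 0 by rewrite gt_eqF.
have r2n0 : rad ^+ 2 != 0 by rewrite gt_eqF.
rewrite tube_barrierE /tube_radius subrr mulr0 mul0r mul0r addr0.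
have -> : expR (tube_a1 n rad kap t (handover_const y c rad kap t) (rad ^+ 2)) =
    handover y c rad.
  rewrite /tube_a1 /handover_const mulNr addrK lnK//.
  by rewrite posrE handover_gt0.
rewrite /pole_barrier pole_exponentE// expRD -[X in _ <= X - _]mulr1 -mulrBr.
set z := sqd c v (rad ^+ 2) x in hz *.
have z0 : 0 <= z by exact: dot_ge0.
pose rho := (1 - z / rad ^+ 2) / 2.
pose ry := (1 - dot (c - y) (c - y) / rad ^+ 2) / 2.
have zr : 0 <= z / rad ^+ 2 < 1.
  by rewrite divr_ge0 ?(ltW r20)//= ltr_pdivrMr// mul1r.
have er : 0 <= dot (c - y) (c - y) / rad ^+ 2 < 1.
  by rewrite divr_ge0 ?(ltW r20) ?dot_ge0//= ltr_pdivrMr// mul1r.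
have /andP[zr0 zr1] := zr; have /andP[er0 er1] := er.
have rho0 : 0 <= rho by rewrite /rho; lra.
have rho1 : rho <= 1 / 2 by rewrite /rho; lra.
have ry0 : 0 <= ry by rewrite /ry; lra.
have ry1 : ry <= 1 / 2 by rewrite /ry; lra.
have al4 := tube_rate_ge4.
have N0 : 0 <= (n%:R : R) by [].
have lhs : handover y c rad * (expR (- tube_rate R n * (z / rad ^+ 2)) - expR (- tube_rate R n))
   <= expR (- pole_lambda n%:R - 4 * pole_beta n%:R) * (ry * rho / 2).
  have h1 : expR (- tube_rate R n * (z / rad ^+ 2)) - expR (- tube_rate R n) <=
      tube_rate R n * (1 - z / rad ^+ 2).
    by apply: expR_diff_le; [lra|rewrite zr0 ltW].
  have h2 : 0 <= handover y c rad by exact: ltW (handover_gt0 rad0 he).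
  have := ler_wpM2l h2 h1; move/le_trans; apply.
  rewrite le_eqVlt; apply/orP; left; apply/eqP.
  rewrite /handover -/ry /rho.
  have an0 : tube_rate R n != 0 by rewrite gt_eqF//; lra.
  move: an0; move: (tube_rate R n) => al an0; move: (expR _) => E.
  move: (z / _) => zz.
  by field.
have rhs : expR (- pole_lambda n%:R - 4 * pole_beta n%:R) * (ry * rho / 2) <=
    expR (pole_a1 n rad (rad ^+ 2) + pole_k n rad (rad ^+ 2) * sqd y v (rad ^+ 2) x) *
    (1 - expR (- pole_xi y c rad (rad ^+ 2) z)).
  apply: ler_pM.
  - exact: expR_ge0.
  - by rewrite divr_ge0// mulr_ge0.
  - have sq : Num.sqrt (rad ^+ 2) = rad by rewrite sqrtr_sqr ger0_norm// ltW.
    rewrite ler_expR /pole_a1 /pole_k sq.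
    have -> : - pole_lambda n%:R / rad * rad = - pole_lambda n%:R by field.
    have hA : sqd y v (rad ^+ 2) x <= 4 * rad ^+ 2.
      rewrite /sqd -sqr_enorm.
      have : enorm (x - y - rad ^+ 2 *: v) <= 2 * rad.
        have -> : x - y - rad ^+ 2 *: v = (x - c - rad ^+ 2 *: v) + (c - y).
          by apply/rowP => i; rewrite !mxE; ring.
        apply: le_trans (ler_enormD _ _) _.
        have e1 : enorm (x - c - rad ^+ 2 *: v) <= rad.
          rewrite -[leRHS]sq /enorm ler_wsqrtr//; exact: ltW hz.
        have e2 : enorm (c - y) <= rad.
          rewrite -[leRHS]sq /enorm ler_wsqrtr//; exact: ltW he.
        by lra.
      have := enorm_ge0 (x - y - rad ^+ 2 *: v).
      move: (enorm _) => E E0 E1.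
      have := ler_pM E0 E0 E1 E1; rewrite !expr2; lra.
    have : pole_beta n%:R * (sqd y v (rad ^+ 2) x / rad ^+ 2) <= pole_beta n%:R * 4.
      by rewrite ler_wpM2l ?pole_beta_ge0// ler_pdivrMr.
    have -> : - pole_beta n%:R / rad / rad * sqd y v (rad ^+ 2) x =
       - (pole_beta n%:R * (sqd y v (rad ^+ 2) x / rad ^+ 2)) by field.
    by lra.
  - have yr0 : 0 <= ry * rho by rewrite mulr_ge0.
    have yr1 : ry * rho <= 1.
      have : ry * rho <= 1 / 2 * (1 / 2) by exact: ler_pM.
      by lra.
    have := @one_sub_expRN_ge (ry * rho) ltac:(by rewrite yr0).
    have : expR (- pole_xi y c rad (rad ^+ 2) z) <= expR (- (ry * rho)).
      rewrite ler_expR lerN2 /pole_xi -/rho -/ry mulfK//.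
      by rewrite ler_wpM2l// lerDl mulr_ge0// sqr_ge0.
    by lra.
have := le_trans lhs rhs.
set p0 := expR (- (n%:R / 2) * _ - _).
have p00 : 0 < p0 by exact: expR_gt0.
have -> : expR (hexp (pole_a1 n rad) (pole_k n rad) (fun=> 0) (fun=> 0) y c v (rad ^+ 2) x)
  = p0 * expR (pole_a1 n rad (rad ^+ 2) + pole_k n rad (rad ^+ 2) * sqd y v (rad ^+ 2) x).
  by rewrite /p0 -expRD /hexp; congr expR; ring.
by move=> h; rewrite -(mulrA p0) -(mulrA p0) ler_pM2l.
Qed.

(** Constants solve the heat equation, so a datum lowered by [eta] costs exactly [eta] at time
    [t]. *)
Lemma two_stages D U y c v (rad kap t w eta : R) :
  (0 < n)%N -> tube_ok rad kap t -> 0 < w -> w ^+ 2 < rad ^+ 2 -> 0 <= eta ->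
  dot (c - y) (c - y) < rad ^+ 2 ->
  heat_after D (w ^+ 2) U -> (forall s x, w ^+ 2 < s -> D x -> 0 <= U s x) ->
  (forall s x, 0 < s <= t -> sqd c v s x < rad ^+ 2 -> D x) ->
  (forall s x, rad ^+ 2 <= s <= t -> sqd c v s x < tube_radius rad kap t s ^+ 2 -> D x) ->
  (forall x e, 0 < e -> D x -> \forall p \near (w ^+ 2, x), w ^+ 2 < p.1 -> D p.2 ->
     expR (log_gauss (w ^+ 2) x y) - eta - e < U p.1 p.2) ->
  forall x, sqd c v t x < rad ^+ 2 ->
    tube_barrier y c v rad kap t (handover_const y c rad kap t) t x - eta <= U t x.
Proof.
move=> n0 ok w0 wr eta0 he hU U0 B1 B2 ini x hx.
have [rad0 kap0 rt kr kr1] := ok.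
have r20 : 0 < rad ^+ 2 by rewrite exprn_gt0.
have w20 : 0 < w ^+ 2 by rewrite exprn_gt0.
have jeta s z (W : R -> 'rV[R]_n -> R) :
    (exists ws g l, jet W s z ws g l /\ ws <= \sum_i l i) ->
    exists ws g l, jet (fun s z => W s z - eta) s z ws g l /\ ws <= \sum_i l i.
  move=> [ws [g [l [j h]]]].
  have := jetD j (jet_time z (is_derive_cst (- eta : R) s 1)).
  exists (ws + 0), (fun i => g i + 0), (fun i => l i + 0); split => //.
  by under eq_bigr do rewrite addr0; rewrite addr0.
have stage1 z : sqd c v (rad ^+ 2) z < rad ^+ 2 ->
    pole_barrier y c v rad (rad ^+ 2) z - eta <= U (rad ^+ 2) z.
  move=> hz.
  apply: (@moving_ball_comparison R n D U (fun s z => pole_barrier y c v rad s z - eta)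
    c v (w ^+ 2) (rad ^+ 2) (rad ^+ 2) (fun=> rad ^+ 2)) => //.
  - by move=> s; exact: cst_continuous.
  - move=> s z1 /andP[s0 s1]; apply: B1; rewrite (lt_trans w20 s0)/=.
    exact: le_trans s1 (ltW rt).
  - move=> s z1 /andP[s0 s1]; apply: cvgB; last exact: cvg_cst.
    by apply: pole_barrier_continuous => //; exact: lt_le_trans s0.
  - move=> s z1 /andP[s0 s1] hs; rewrite pole_barrier_sphere//; last exact: lt_le_trans s0.
    by rewrite sub0r oppr_le0.
  - move=> s z1 /andP[s0 s1] hs; apply: jeta; apply: pole_barrier_jet => //.
    by rewrite s1 andbT; exact: lt_trans s0.
  - move=> z1 hz1 e e0.
    have Dz1 : D z1.
      by apply: (B1 (w ^+ 2)) => //; rewrite w20 (ltW (lt_trans wr rt)).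
    apply: filterS (ini z1 e e0 Dz1) => p h wp Dp.
    apply: le_lt_trans (h wp Dp).
    by rewrite lerD2r lerD2r; apply: pole_barrier_le.
  - by rewrite wr lexx.
have rr : rad ^+ 2 <= t <= t by rewrite lexx andbT ltW.
have tt : tube_radius rad kap t t = rad.
  by rewrite /tube_radius subrr mulr0 mul0r addr0.
have tr : tube_radius rad kap t (rad ^+ 2) = rad.
  by rewrite /tube_radius subrr mulr0 !mul0r addr0.
apply: (@moving_ball_comparison R n D U (fun s z => tube_barrier y c v rad kap t
   (handover_const y c rad kap t) s z - eta)
   c v (rad ^+ 2) t ((rad + kap * t) ^+ 2) (fun s => tube_radius rad kap t s ^+ 2)).
- by move=> s z sr Dz; apply: hU => //; exact: lt_trans sr.
- by move=> s z sr Dz; apply: U0 => //; exact: lt_trans sr.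
- move=> s; have h := is_derive_continuous (is_derive_tube_radius s ok).
  have : tube_radius rad kap t u * tube_radius rad kap t u @[u --> s] -->
     tube_radius rad kap t s * tube_radius rad kap t s.
    exact: (@cvgM _ _ (nbhs s) _ _ _ _ _ h h).
  by under eq_fun do rewrite -expr2.
- move=> s sab; have h1 := tube_radius_ge ok sab; have h2 := tube_radius_le ok sab.
  have /andP[s0 s1] := sab.
  rewrite ler_pXn2r// ?nnegrE; first last.
  + by have := mulr_ge0 kap0 (ltW (lt_trans r20 rt)); lra.
  + by lra.
  apply: le_trans h2 _; rewrite lerD2l ler_wpM2l//.
  by lra.
- by move=> s z /andP[s0 s1]; apply: B2; rewrite (ltW s0).
- move=> s z sab; apply: cvgB; last exact: cvg_cst.
  exact: tube_barrier_continuous.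
- by move=> s z sab hs; rewrite tube_barrier_sphere// sub0r oppr_le0.
- move=> s z /andP[s0 s1] hs; apply: jeta; apply: tube_barrier_jet => //.
    by rewrite (ltW s0).
  exact: ltW.
- rewrite tr => z hz e e0.
  have Dz : D z by apply: (B1 (rad ^+ 2)) => //; rewrite r20 (ltW rt).
  have cU := (hU _ _ wr Dz).1.
  have lt : tube_barrier y c v rad kap t (handover_const y c rad kap t) (rad ^+ 2) z - eta - e
      < U (rad ^+ 2) z.
    have := stage1 z hz; have := handover_le ok he hz; lra.
  have : \forall p \near (rad ^+ 2, z), tube_barrier y c v rad kap t (handover_const y c rad kap t) (rad ^+ 2) z - eta - e < U p.1 p.2.
    exact: (cU [set a | _ < a] (lt_nbhsr lt)).
  by apply: filterS.
- by rewrite rt lexx.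
- by rewrite tt.
Qed.

End two_stages.

(** * Integral bounds *)

Section integral_bound.
Variable R : realType.
Local Notation mu := (@lebesgue_measure R).

(* No measurability of [J] is needed: the integral of its positive part is a
   supremum over simple functions below it. *)
Lemma Rintegral_le_ub (J h : R -> R) (M : R) : (forall s, J s <= h s) ->
  (forall s, 0 <= h s) -> (\int[mu]_s (h s)%:E = M%:E)%E ->
  \int[mu]_(s in setT) J s <= M.
Proof.
move=> Jh h0 hM; rewrite /Rintegral.
have pos s : (0 <= ((EFin \o J)^\+ s))%E by exact: funepos_ge0.
have le1 : (\int[mu]_s ((EFin \o J)^\+ s) <= M%:E)%E.
  rewrite -hM !ge0_integralTE//.
  apply: ereal_sup_le => _ [k hk <-]; exists k => //= s.
  apply: le_trans (hk s) _; rewrite funeposE /= -EFin_max lee_fin.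
  by rewrite ge_max Jh h0.
(* The real-valued integral is 0 by default when the extended one is infinite; [M0] covers the value
   [-oo], which [le2] allows. *)
have M0 : 0 <= M.
  by rewrite -lee_fin -hM; apply: integral_ge0 => s _; rewrite lee_fin.
have neg : (0 <= \int[mu]_s ((EFin \o J)^\- s))%E.
  by apply: integral_ge0 => s _; exact: funeneg_ge0.
have le2 : (\int[mu]_s (J s)%:E <= M%:E)%E.
  rewrite integralE; apply: le_trans le1; rewrite -[leRHS]adde0.
  by apply: leeD2l; rewrite oppe_le0.
move: le2; case: (\int[mu]_s (J s)%:E)%E => [r| |] //=.
Qed.

(** The product majorant is integrated one variable at a time, and [g] enters only through its
    pointwise bound. *)
Lemma integral_rV_le n (g : 'rV[R]_n -> R) (h : 'I_n -> R -> R) (M : R) : 0 <= M ->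
  (forall i s, 0 <= h i s) -> (forall i, \int[mu]_s (h i s)%:E = 1%E)%E ->
  (forall i, measurable_fun setT (h i)) ->
  (forall z, g z <= M * \prod_i h i (z 0 i)) -> integral_rV g <= M.
Proof.
elim: n g h M => [|n IH] g h M M0 h0 h1 mh gM.
  by have := gM 0; rewrite big_ord0 mulr1.
change (integral_rV g) with (\int[mu]_(s in setT)
  integral_rV (fun v : 'rV[R]_n => g (row_mx (s%:M : 'rV[R]_1) v))).
apply: (@Rintegral_le_ub _ (fun s => M * h ord0 s)) => [s|s|].
- apply: (IH _ (fun i => h (lift ord0 i))) => //; first by rewrite mulr_ge0.
  move=> v; apply: le_trans (gM _) _; rewrite big_ord_recl mulrA.
  have E0 : (row_mx (s%:M : 'rV[R]_1) v) 0 (ord0 : 'I_n.+1) = s.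
    have := row_mxEl (s%:M : 'rV[R]_1) v 0 (0 : 'I_1).
    by rewrite lshift0 => ->; rewrite mxE.
  have Er i : (row_mx (s%:M : 'rV[R]_1) v) 0 (lift (ord0 : 'I_n.+1) i) = v 0 i.
    have := row_mxEr (s%:M : 'rV[R]_1) v 0 i.
    by rewrite rshift1.
  rewrite E0 le_eqVlt; apply/orP; left; apply/eqP; congr (_ * _).
  by apply: eq_bigr => i _; rewrite -[in RHS](Er i).
- by rewrite mulr_ge0.
- under eq_integral do rewrite EFinM.
  rewrite ge0_integralZl_EFin//.
  + by rewrite h1 mule1.
  + by move=> s _; rewrite lee_fin.
  + by apply/measurable_EFinP; exact: mh.
Qed.

(** The majorant is [M (4 pi)^(n/2)] times a product of normal densities of variance [2 w^2]. *)
Lemma integral_rV_gauss_le n (g : 'rV[R]_n -> R) (y : 'rV[R]_n) (w M : R) : 0 < w ->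
  0 <= M ->
  (forall z, g z <= M * (w ^+ n)^-1 * expR (- (dot (z - y) (z - y) / (4 * w ^+ 2)))) ->
  integral_rV g <= M * (Num.sqrt (4 * pi)) ^+ n.
Proof.
move=> w0 M0 gM.
pose sg := Num.sqrt 2 * w.
have sg0 : 0 < sg by rewrite mulr_gt0// sqrtr_gt0.
have sgn0 : sg != 0 by rewrite gt_eqF.
have sg2 : sg ^+ 2 = 2 * w ^+ 2 by rewrite exprMn sqr_sqrtr.
apply: (@integral_rV_le n g (fun i s => normal_pdf (y 0 i) sg s)).
- by rewrite mulr_ge0// exprn_ge0.
- by move=> i s; exact: normal_pdf_ge0.
- by move=> i; exact: integral_normal_pdf.
- by move=> i; exact: measurable_normal_pdf.
move=> z; apply: le_trans (gM z) _.
have pk : normal_peak sg = (Num.sqrt (4 * pi) * w)^-1.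
  rewrite /normal_peak sg2 -[in RHS](ger0_norm (ltW w0)) -sqrtr_sqr -sqrtrM; last first.
    by rewrite mulr_ge0 ?pi_ge0.
  by congr (Num.sqrt _)^-1; rewrite -mulr_natr; ring.
have -> : \prod_(i < n) normal_pdf (y 0 i) sg (z 0 i) =
   (normal_peak sg) ^+ n * expR (- (dot (z - y) (z - y) / (4 * w ^+ 2))).
  under eq_bigr do rewrite normal_pdfE// /normal_fun.
  rewrite big_split /= prodr_const card_ord; congr (_ * _).
  rewrite -expR_sum; congr expR; rewrite /dot mulr_suml -sumrN.
  apply: eq_bigr => i _; rewrite !mxE sg2 -mulr_natr -expr2.
  by rewrite mulNr; congr (- (_ / _)); ring.
rewrite pk exprVn exprMn.
have s0 : Num.sqrt (4 * pi) ^+ n != 0 :> R.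
  by rewrite expf_neq0// gt_eqF// sqrtr_gt0 mulr_gt0// pi_gt0.
have wn0 : w ^+ n != 0 by rewrite expf_neq0// gt_eqF.
rewrite le_eqVlt; apply/orP; left; apply/eqP; by field; rewrite s0 wn0.
Qed.

End integral_bound.

(** * From solutions to the kernel *)

Section kernel_bound.
Variables (R : realType) (n : nat).
Implicit Types (D : set 'rV[R]_n) (x y c v : 'rV[R]_n).

Lemma gauss_peak (w : R) : 0 < w ->
  expR (- (n%:R / 2) * ln (w ^+ 2)) = (w ^+ n)^-1.
Proof.
move=> w0; rewrite lnXn// -(mulr_natr (ln w)).
have -> : - (n%:R / 2) * (ln w * 2%:R) = - (ln w * n%:R) by field.
by rewrite expRN (mulr_natr (ln w)) -lnXn// lnK// posrE exprn_gt0.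
Qed.

(** With [q = kappa^2 / (4 n)] the exponential factor is [exp (- q / w^2)^n <= (w^2 / q)^n], so the
    whole is at most [(w / q)^n]. *)
Lemma small_gauss_tail (kappa eps b : R) : (0 < n)%N -> 0 < kappa -> 0 < eps -> 0 < b ->
  exists w, [/\ 0 < w, w < b &
    expR (- (n%:R / 2) * ln (w ^+ 2) - kappa ^+ 2 / (4 * w ^+ 2)) <= eps].
Proof.
move=> n0 k0 e0 b0.
have N1 : 1 <= (n%:R : R) by rewrite ler1n.
have Nn0 : (n%:R : R) != 0 by rewrite gt_eqF//; lra.
pose q := kappa ^+ 2 / (4 * n%:R).
have q0 : 0 < q by rewrite divr_gt0 ?exprn_gt0//; lra.
pose m := Num.min b (q * Num.min 1 eps) / 2.
have m1 : 0 < Num.min 1 eps by rewrite lt_min ltr01.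
have M0 : 0 < Num.min b (q * Num.min 1 eps) by rewrite lt_min b0 mulr_gt0.
have m0 : 0 < m by rewrite divr_gt0.
have mM : m < Num.min b (q * Num.min 1 eps).
  by rewrite /m ltr_pdivrMr// ltr_pMr// ltr1n.
have mb : m < b by rewrite (lt_le_trans mM)// ge_min lexx.
have mq : m <= q * Num.min 1 eps by rewrite (le_trans (ltW mM))// ge_min lexx orbT.
exists m; split => //.
rewrite expRD gauss_peak//.
have ratio : m / q <= Num.min 1 eps by rewrite ler_pdivrMr// mulrC.
have r0 : 0 <= m / q by rewrite divr_ge0// ltW.
apply: (@le_trans _ _ ((m / q) ^+ n)); last first.
  apply: (@le_trans _ _ (m / q)); last first.
    by apply: le_trans ratio _; rewrite ge_min lexx orbT.
  case: (n) n0 => // k _; rewrite exprS ler_piMr// exprn_ile1//.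
  by apply: le_trans ratio _; rewrite ge_min lexx.
have -> : - (kappa ^+ 2 / (4 * m ^+ 2)) = - (n%:R * (q / m ^+ 2)).
  by rewrite /q; field; rewrite gt_eqF.
rewrite expRN expRM_natl.
have h : q / m ^+ 2 <= expR (q / m ^+ 2).
  by apply: le_trans (expR_ge1Dx _); lra.
have qm0 : 0 < q / m ^+ 2 by rewrite divr_gt0// exprn_gt0.
have : (expR (q / m ^+ 2) ^+ n)^-1 <= ((q / m ^+ 2) ^+ n)^-1.
  rewrite lef_pV2 ?posrE ?exprn_gt0 ?expR_gt0//.
  by rewrite ler_pXn2r// nnegrE ltW// expR_gt0.
have mn : 0 < (m ^+ n)^-1 by rewrite invr_gt0 exprn_gt0.
move=> /(ler_wpM2l (ltW mn)) /le_trans; apply.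
rewrite -exprVn -exprVn -exprMn le_eqVlt; apply/orP; left; apply/eqP.
by congr (_ ^+ n); field; rewrite !gt_eqF.
Qed.

(* The initial datum is a Gaussian at time [w ^ 2], lowered by its value [eta] on a
   small sphere and truncated at [0]; its compact support and its mass, bounded
   independently of [w], allow to recover the kernel as [w] tends to [0]. *)
Lemma kernel_ge_tube_barrier D pD (t rad kap : R) x y c v :
  (0 < n)%N -> open D -> dirichlet_heat_kernel D pD -> D x -> D y ->
  tube_ok rad kap t -> dot (c - y) (c - y) < rad ^+ 2 ->
  (forall s x, 0 < s <= t -> sqd c v s x < rad ^+ 2 -> D x) ->
  (forall s x, rad ^+ 2 <= s <= t -> sqd c v s x < tube_radius rad kap t s ^+ 2 -> D x) ->
  sqd c v t x < rad ^+ 2 ->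
  tube_barrier y c v rad kap t (handover_const y c rad kap t) t x <=
  pD t x y * Num.sqrt (4 * pi) ^+ n.
Proof.
move=> n0 oD [cpD _ upD] Dx Dy ok he B1 B2 hx.
have [rad0 kap0 rt _ _] := ok.
have r20 : 0 < rad ^+ 2 by rewrite exprn_gt0.
have t0 : 0 < t by exact: lt_trans rt.
set W := tube_barrier _ _ _ _ _ _ _ _ _.
have S0 : 0 < Num.sqrt (4 * pi) ^+ n :> R.
  by rewrite exprn_gt0// sqrtr_gt0 mulr_gt0// pi_gt0.
set S := Num.sqrt _ ^+ n in S0 *.
have W0 : 0 < W.
  rewrite /W tube_barrierE mulr_gt0 ?mulr_gt0 ?expR_gt0// subr_gt0 ltr_expR.
  have tt : tube_radius rad kap t t = rad.
    by rewrite /tube_radius subrr mulr0 mul0r addr0.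
  have h : sqd c v t x / rad ^+ 2 < 1 by rewrite ltr_pdivrMr// mul1r.
  rewrite tt; have := tube_rate_ge4 R n; nra.
(* The definition of the kernel gives no sign for [pD]; the maximum with 0 keeps the majorant of the
   integrand nonnegative. Below, [eps] is small against [W], which excludes the value 0, and against
   the assumed gap. *)
suff key eps : 0 < eps -> W - eps <= Num.max 0 (pD t x y + eps) * S.
  rewrite leNgt; apply/negP => lt.
  pose eps := Num.min W (W - pD t x y * S) / (2 * (1 + S)).
  have S1 : 0 < 1 + S by lra.
  have m0 : 0 < Num.min W (W - pD t x y * S) by rewrite lt_min W0 subr_gt0.
  have e0 : 0 < eps by rewrite divr_gt0// mulr_gt0.
  have eS : eps * (1 + S) * 2 = Num.min W (W - pD t x y * S).
    by rewrite /eps; field; rewrite gt_eqF.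
  have e1 : eps * (1 + S) * 2 <= W by rewrite eS ge_min lexx.
  have e2 : eps * (1 + S) * 2 <= W - pD t x y * S by rewrite eS ge_min lexx orbT.
  have eS0 : 0 < eps * S by rewrite mulr_gt0.
  have := key eps e0; rewrite maxEle; case: ifP => _ h.
    by move: h e1 e2 e0 eS0; rewrite mulrDl; lra.
  by move: h e1 e0 eS0; rewrite mul0r; lra.
move=> e0.
have [del [kap1 [del0 kap10 pDle]]] : exists del kap1, [/\ 0 < del, 0 < kap1 &
    forall s z, `|t - s| < del -> eball y kap1 z -> pD s x z < pD t x y + eps].
  have lt : pD t x y < pD t x y + eps by rewrite ltrDl.
  have [[A B] [/= nA nB] sub] := cpD t x y t0 Dx Dy [set a | a < pD t x y + eps] (lt_nbhsl lt).
  have [[A1 A2] [/= nA1 nA2] sub2] := nA.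
  have /nbhs_ballP[del del0 hdel] := nA1.
  have [kap1 kap10 hkap] := nbhs_eball nB.
  exists del, kap1; split => // s z ts yz.
  apply: (sub (s, x, z)); split => /=; last exact: hkap.
  by apply: (sub2 (s, x)); split => /=; [exact: hdel|exact: nbhs_singleton nA2].
have [kap2 kap20 yD] := nbhs_eball (open_nbhs_nbhs (conj oD Dy)).
have [kappa [kappa0 k1 k2]] := exists_lt2 kap10 kap20.
(* [w < rad] places the starting time inside the first stage; [w < 1] and [w < del] give
   [w ^ 2 < del]. *)
have b0 : 0 < Num.min rad (Num.min 1 del) by rewrite !lt_min rad0 ltr01 del0.
have [w [w0 wb wtail]] := small_gauss_tail n0 kappa0 e0 b0.
have w1 : w < rad by rewrite (lt_le_trans wb)// ge_min lexx.
have w2 : w < 1 by rewrite (lt_le_trans wb)// !ge_min lexx orbT.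
have w3 : w < del by rewrite (lt_le_trans wb)// !ge_min lexx !orbT.
have w20 : 0 < w ^+ 2 by rewrite exprn_gt0.
have wr : w ^+ 2 < rad ^+ 2 by rewrite ltr_pXn2r// nnegrE ltW.
have wd : w ^+ 2 < del by apply: lt_trans w3; rewrite expr2 gtr_pMr.
set eta := expR _ in wtail.
have eta0 : 0 <= eta by exact: expR_ge0.
pose G z := expR (log_gauss (w ^+ 2) z y).
pose f z := Num.max 0 (G z - eta).
have f0 z : 0 <= f z by rewrite le_max lexx.
have fG z : f z <= G z.
  by rewrite ge_max expR_ge0 lerBlDr lerDl.
have fsupp z : kappa < enorm (z - y) -> f z = 0.
  move=> h; rewrite /f max_l// subr_le0 ler_expR /log_gauss lerD2l lerN2.
  rewrite ler_pM2r ?invr_gt0 ?mulr_gt0// /sqd scaler0 subr0 -sqr_enorm.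
  by rewrite ler_pXn2r// ?nnegrE ?enorm_ge0// ltW.
have cf : compactly_supported_in D f.
  split; last first.
    exists [set z | enorm (z - y) <= kappa]; split.
    - exact: closed_eball_compact.
    - by move=> z /= h; apply: yD; apply: le_lt_trans h k2.
    - by move=> z /= /negP; rewrite -ltNge; exact: fsupp.
  move=> z.
  have c2 := continuous_dot (@continuous_subr R n y z) (@continuous_subr R n y z).
  have c3 : {for z, continuous (fun p : 'rV[R]_n => log_gauss (w ^+ 2) p y)}.
    have -> : (fun p : 'rV[R]_n => log_gauss (w ^+ 2) p y) = (fun p =>
        - (n%:R / 2) * ln (w ^+ 2) - dot (p - y) (p - y) / (4 * w ^+ 2)).
      by apply/funext => p; rewrite /log_gauss /sqd scaler0 subr0.
    have c5 : dot (p - y) (p - y) / (4 * w ^+ 2) @[p --> z] -->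
        dot (z - y) (z - y) / (4 * w ^+ 2).
      exact: (@cvgM _ _ (nbhs z) _ _ _ _ _ c2 (cvg_cst ((4 * w ^+ 2)^-1 : R))).
    have c7 := @cvg_cst _ (- (n%:R / 2) * ln (w ^+ 2) : R) _ (nbhs z) (nbhs_filter z).
    have c8 := @cvgB _ _ _ (nbhs z) (nbhs_filter z) _ _ _ _ c7 c5.
    change (- (n%:R / 2) * ln (w ^+ 2) - dot (p - y) (p - y) / (4 * w ^+ 2) @[p --> z] -->
     - (n%:R / 2) * ln (w ^+ 2) - dot (z - y) (z - y) / (4 * w ^+ 2)).
    exact: c8.
  have c4 : {for z, continuous (fun p : 'rV[R]_n => G p - eta)}.
    have c6 : G p @[p --> z] --> G z.
      exact: (continuous_cvg _ (@continuous_expR R _) c3).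
    have c0 := @cvg_cst _ (eta : R) _ (nbhs z) (nbhs_filter z).
    have c9 := @cvgB _ _ _ (nbhs z) (nbhs_filter z) _ _ _ _ c6 c0.
    change (G p - eta @[p --> z] --> G z - eta).
    exact: c9.
  have cz : {for z, continuous (fun _ : 'rV[R]_n => 0 : R)} by exact: cst_continuous.
  exact: (continuous_max cz c4).
have [/= hu du iu bu] := upD f cf.
set u := (fun t x => _) in hu du iu bu.
have u0 := bounded_solution_ge0 oD hu du iu bu f0.
(* The delay makes the Gaussian datum start at its own time [w ^ 2]. *)
pose U (s : R) z := u (s - w ^+ 2) z.
have hU : heat_after D (w ^+ 2) U.
  have := @heat_after_shift R n D 0 u (w ^+ 2) (heat_solution_after oD hu).
  by rewrite add0r.
have U0 s z : w ^+ 2 < s -> D z -> 0 <= U s z.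
  by move=> ws Dz; apply: u0 => //; rewrite subr_gt0.
have ini z (e : R) : 0 < e -> D z -> \forall p \near (w ^+ 2, z), w ^+ 2 < p.1 ->
    D p.2 -> expR (log_gauss (w ^+ 2) z y) - eta - e < U p.1 p.2.
  move=> ep Dz.
  have lt : expR (log_gauss (w ^+ 2) z y) - eta - e < f z.
    have : G z - eta <= f z by rewrite le_max lexx orbT.
    by rewrite /G; lra.
  have h := iu z (subset_closure Dz) [set a | _ < a] (lt_nbhsr lt).
  have {}h : \forall q \near (0 : R, z), 0 < q.1 /\ D q.2 ->
     expR (log_gauss (w ^+ 2) z y) - eta - e < u q.1 q.2 by exact: h.
  have c1 : (p.1 - w ^+ 2) @[p --> (w ^+ 2, z)] --> (0 : R).
    rewrite -(subrr (w ^+ 2)).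
    exact: (@cvgB _ _ _ (nbhs (w ^+ 2, z)) _ _ _ _ _ cvg_fst (cvg_cst (w ^+ 2))).
  have c2 : p.2 @[p --> (w ^+ 2, z)] --> z by exact: cvg_snd.
  have := cvg_pair c1 c2 h.
  rewrite nbhs_simpl /= => {}h.
  have h' : \forall p \near (w ^+ 2, z), 0 < p.1 - w ^+ 2 /\ D p.2 ->
     expR (log_gauss (w ^+ 2) z y) - eta - e < u (p.1 - w ^+ 2) p.2 by exact: h.
  apply: filterS h' => p hp wp Dp; apply: hp.
  by rewrite subr_gt0.
have := two_stages n0 ok w0 wr eta0 he hU U0 B1 B2 ini hx.
rewrite -/W => WU.
apply: (@le_trans _ _ (U t x)); first by apply: le_trans WU; rewrite lerD2l lerN2.
rewrite /U /u; set gg := patch _ _ _.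
apply: (integral_rV_gauss_le w0 (y := y)); first by rewrite le_max lexx.
move=> z; rewrite -mulrA.
have -> : (w ^+ n)^-1 * expR (- (dot (z - y) (z - y) / (4 * w ^+ 2))) = G z.
  by rewrite /G /log_gauss /sqd scaler0 subr0 expRD gauss_peak.
have mx : 0 <= Num.max 0 (pD t x y + eps) by rewrite le_max lexx.
rewrite /gg /patch; case: ifPn => _; last first.
  by rewrite mulr_ge0// expR_ge0.
have [zk|zk] := ltP kappa (enorm (z - y)).
  by rewrite fsupp// mulr0 mulr_ge0// expR_ge0.
have pz : pD (t - w ^+ 2) x z <= Num.max 0 (pD t x y + eps).
  rewrite le_max; apply/orP; right; apply/ltW/pDle.
    by rewrite subKr gtr0_norm.
  exact: le_lt_trans zk k1.
exact: le_trans (ler_wpM2r (f0 z) pz) (ler_wpM2l mx (fG z)).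
Qed.

End kernel_bound.

(** * Geometry of convex sets with tangent balls *)

Section geometry.
Variables (R : realType) (n : nat).
Implicit Types (D : set 'rV[R]_n) (x y z p q c : 'rV[R]_n).

Lemma convex_comb D x y (l : R) :
  convex_set (D : set (convex_lmodType 'rV[R]_n)) -> D x -> D y ->
  0 <= l <= 1 -> D ((1 - l) *: x + l *: y).
Proof.
move=> cD Dx Dy l01.
have l01' : 0 <= 1 - l <= 1 by move: l01 => /andP[? ?]; apply/andP; split; lra.
have /andP[a b] := l01'.
have := cD x y (Itv01 a b) (mem_set Dx) (mem_set Dy).
rewrite inE; congr (D _); rewrite /conv /= /convex_lmodType /=.
by rewrite /unstable.onem subKr.
Qed.

Lemma eball_sub x y (a b : R) : enorm (y - x) <= b - a -> eball x a `<=` eball y b.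
Proof.
rewrite /eball => h z /= zx; apply: le_lt_trans (ler_enormB x z y) _.
by rewrite (enormB x y); lra.
Qed.

(** A point of the interpolated ball is its centre plus [rho *: d] with [|d| < 1]; the same [d]
    serves in both given balls. *)
Lemma convex_eball D x y (a b l : R) :
  convex_set (D : set (convex_lmodType 'rV[R]_n)) ->
  0 < a -> 0 < b -> eball x a `<=` D -> eball y b `<=` D -> 0 <= l <= 1 ->
  eball ((1 - l) *: x + l *: y) ((1 - l) * a + l * b) `<=` D.
Proof.
move=> cD a0 b0 xD yD l01 w; have /andP[l0 l1] := l01.
set m := _ + _ *: y; set rho := _ + l * b => wm; rewrite /eball /= in wm.
have rho0 : 0 < rho.
  rewrite /rho; have := mulr_ge0 l0 (ltW b0).
  have [->|ln1] := eqVneq l 1; first by lra.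
  have : 0 < (1 - l) * a by rewrite mulr_gt0// subr_gt0 lt_neqAle ln1.
  by lra.
have rn0 : rho != 0 by rewrite gt_eqF.
pose d := rho^-1 *: (w - m).
have dlt k : 0 < k -> enorm (k *: d) < k.
  move=> k0; rewrite enormZ gtr0_norm// -[ltRHS]mulr1 ltr_pM2l//.
  by rewrite /d enormZ gtr0_norm ?invr_gt0// mulrC ltr_pdivrMr// mul1r.
have -> : w = (1 - l) *: (x + a *: d) + l *: (y + b *: d).
  have -> : (1 - l) *: (x + a *: d) + l *: (y + b *: d) = m + rho *: d.
    by rewrite /m /rho; apply/rowP => i; rewrite !mxE; ring.
  by rewrite /d scalerA divff// scale1r addrC subrK.
by apply: convex_comb => //; [apply: xD|apply: yD];
  rewrite /eball /= addrAC subrr add0r; exact: dlt.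
Qed.

Lemma open_boundaryN D z : open D -> boundary D z -> ~ D z.
Proof.
move=> oD [_ nz] Dz; apply: nz.
exact: (open_nbhs_nbhs (conj oD Dz)).
Qed.

Lemma closed_boundary D : closed (boundary D).
Proof.
rewrite /boundary setDE; apply: closedI; first exact: closed_closure.
by rewrite closedC; exact: open_interior.
Qed.

(** The point at the supremum of the parameters with values in [D] is a limit of points of [D], and
    lies outside [D] by openness. *)
Lemma boundary_on_segment D x y : open D -> D x -> ~ D y ->
  exists2 z, boundary D z & enorm (x - z) <= enorm (x - y).
Proof.
move=> oD Dx nDy.
pose g (s : R) := x + s *: (y - x).
have gc (s : R) : g u @[u --> s] --> g s.
  apply: (@cvgD _ _ _ (nbhs s)); first exact: cvg_cst.
  exact: scalel_continuous.
pose S := [set s : R | 0 <= s <= 1 /\ D (g s)].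
have S0 : S 0 by split; [rewrite lexx ler01|rewrite /g scale0r addr0].
have supS : has_sup S.
  by split; [exists 0|exists 1 => s [/andP[]]].
pose s := sup S.
have s01 : 0 <= s <= 1.
  apply/andP; split; first exact: sup_upper_bound.
  by apply: ge_sup; [exists 0|move=> t [/andP[]]].
have /andP[s0 s1] := s01.
have ncl : closure D (g s).
  move=> B gB; have [e e0 he] : exists2 e, 0 < e & forall u, `|s - u| < e -> B (g u).
    have /nbhs_ballP[e e0 he] := gc s B gB.
    by exists e => // u us; exact: he.
  have [u [u01 Du] us] := sup_adherent e0 supS.
  exists (g u); split => //; apply: he.
  have us' : u <= s by apply: sup_upper_bound.
  by rewrite ger0_norm ?subr_ge0//; move: us; rewrite -/s; lra.
have nD : ~ D (g s).
  move=> Dg; have sn1 : s != 1.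
    by apply/eqP => s1'; apply: nDy; move: Dg; rewrite s1' /g scale1r addrC subrK.
  have sl1 : s < 1 by rewrite lt_neqAle sn1.
  have /nbhs_ballP[e /= e0 he] := gc s D (open_nbhs_nbhs (conj oD Dg)).
  pose d := Num.min (e / 2) (1 - s).
  have d0 : 0 < d by rewrite lt_min divr_gt0//= subr_gt0.
  have d1 : d <= e / 2 by rewrite ge_min lexx.
  have d2 : d <= 1 - s by rewrite ge_min lexx orbT.
  have : S (s + d).
    split; first by apply/andP; split; lra.
    apply: he; rewrite /ball /= opprD addNKr normrN gtr0_norm//; lra.
  by move=> /(sup_upper_bound supS); rewrite -/s; lra.
exists (g s); first by split => // /interior_subset.
have -> : x - g s = s *: (x - y).
  by rewrite /g; apply/rowP => i; rewrite !mxE; ring.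
by rewrite enormZ ger0_norm// ler_piMl// enorm_ge0.
Qed.

(** * Distance to the boundary *)

Section dist.
Variable D : set 'rV[R]_n.
Hypotheses (oD : open D) (bD : boundary D !=set0).

Lemma bdist_le x z : boundary D z -> bdist D x <= enorm (x - z).
Proof.
move=> bz; apply: ge_inf; last by exists z.
by exists 0 => _ [w _ <-]; exact: enorm_ge0.
Qed.

Lemma bdist_ge x (rho : R) : eball x rho `<=` D -> rho <= bdist D x.
Proof.
move=> xD; apply: lb_le_inf.
  by have [z bz] := bD; exists (enorm (x - z)), z.
move=> _ [z bz <-]; rewrite leNgt; apply/negP => h.
by apply: (open_boundaryN oD bz); apply: xD; rewrite /eball /= enormB.
Qed.

Lemma bdist_ge0 x : 0 <= bdist D x.
Proof.
apply: lb_le_inf; first by have [z bz] := bD; exists (enorm (x - z)), z.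
by move=> _ [z bz <-]; exact: enorm_ge0.
Qed.

Lemma eball_bdist x : D x -> eball x (bdist D x) `<=` D.
Proof.
rewrite /eball => Dx y /= yx; have [//|nDy] := pselect (D y).
have [z bz] := boundary_on_segment oD Dx nDy.
by have := bdist_le x bz; rewrite (enormB x y); lra.
Qed.

Lemma bdist_gt0 x : D x -> 0 < bdist D x.
Proof.
move=> Dx; have [rho rho0 /bdist_ge] := nbhs_eball (open_nbhs_nbhs (conj oD Dx)).
exact: lt_le_trans.
Qed.

Lemma bdist_attained x : exists2 z, boundary D z & enorm (x - z) = bdist D x.
Proof.
have [z0 bz0] := bD.
pose S := boundary D `&` [set z | enorm (z - x) <= enorm (z0 - x)].
have cS : compact S.
  apply: (subclosed_compact _ (@closed_eball_compact R n x (enorm (z0 - x)))).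
    apply: closedI; first exact: closed_boundary.
    by apply: compact_closed; [exact: norm_hausdorff|exact: closed_eball_compact].
  by move=> z [].
have S0 : S !=set0 by exists z0; split => /=.
have hc : continuous (fun z => enorm (z - x)).
  by move=> z; exact: (continuous_enorm (@continuous_subr _ _ x z)).
have [z /set_mem [bz zx] zmin] := compact_EVT_min S0 cS (continuous_subspaceT hc).
exists z => //; apply/eqP; rewrite eq_le bdist_le// andbT.
apply: lb_le_inf; first by exists (enorm (x - z0)), z0.
move=> _ [w bw <-]; rewrite (enormB x z) (enormB x w).
have [h|h] := leP (enorm (w - x)) (enorm (z0 - x)).
  by apply: zmin; apply/mem_set; split.
exact: le_trans zx (ltW h).
Qed.

End dist.

(** Disjointness forces [|q - p| >= a + b], the equality case of the triangle inequality through
    [z]; then the squared norm of the combination is at most 0. *)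
Lemma tangent_balls_opposite p q z (a b : R) : 0 < a -> 0 < b ->
  enorm (z - p) = a -> enorm (z - q) = b ->
  (forall w, eball p a w -> eball q b w -> False) ->
  b *: (p - z) + a *: (q - z) = 0.
Proof.
move=> a0 b0 zp zq disj.
have ab0 : 0 < a + b by rewrite addr_gt0.
have ge : a + b <= enorm (q - p).
  rewrite leNgt; apply/negP => lt.
  apply: (disj (p + (a / (a + b)) *: (q - p))); rewrite /eball /=.
    rewrite addrAC subrr add0r enormZ gtr0_norm ?divr_gt0//.
    by rewrite mulrAC ltr_pdivrMr// ltr_pM2l.
  have -> : p + (a / (a + b)) *: (q - p) - q = - ((b / (a + b)) *: (q - p)).
    by apply/rowP => i; rewrite !mxE; field; rewrite gt_eqF.
  rewrite enormN enormZ gtr0_norm ?divr_gt0//.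
  by rewrite mulrAC ltr_pdivrMr// ltr_pM2l.
have sq : (a + b) ^+ 2 <= enorm (q - p) ^+ 2.
  by rewrite ler_pXn2r// nnegrE ?enorm_ge0// ltW.
have zp2 : dot (p - z) (p - z) = a ^+ 2 by rewrite -sqr_enorm enormB zp.
have zq2 : dot (q - z) (q - z) = b ^+ 2 by rewrite -sqr_enorm enormB zq.
move: sq; rewrite sqr_enorm.
have -> : q - p = (q - z) - (p - z) by apply/rowP => i; rewrite !mxE; ring.
move: (p - z) (q - z) zp2 zq2 => P Q P2 Q2 sq.
have pq : dot P Q <= - (a * b).
  by move: sq; rewrite !dotE P2 Q2 (dotC Q P); lra.
apply: dot_eq0; apply/eqP; rewrite eq_le dot_ge0 andbT.
rewrite !dotE P2 Q2 (dotC Q P).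
have : a * b * dot P Q <= a * b * - (a * b).
  by rewrite ler_wpM2l// mulr_ge0// ltW.
by lra.
Qed.

(* At a boundary point nearest to [x], the ball around [x], the interior ball and the
   exterior ball have collinear centres. *)
Lemma interior_tangent_ball D (r rad : R) x : domain D -> C11_class r D ->
  0 < rad -> rad <= r -> D x ->
  exists2 c, eball c rad `<=` D & enorm (c - x) <= rad - Num.min (bdist D x) rad.
Proof.
move=> [oD _ bD] [_ hb] rad0 rr Dx.
have [h|h] := leP rad (bdist D x).
  exists x; last by rewrite subrr enorm0 subrr.
  apply: subset_trans (eball_bdist oD Dx); apply: eball_sub.
  by rewrite subrr enorm0 subr_ge0.
have [z bz xz] := bdist_attained bD x.
have [[c [rho [rrho zc cD]]] [c' [rho' [rrho' zc' cD']]]] := hb z bz.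
have hh := bdist_gt0 oD bD Dx.
have rho0 : 0 < rho by lra.
have rho'0 : 0 < rho' by lra.
have e1 := tangent_balls_opposite hh rho'0 (etrans (enormB z x) xz) zc'
  (fun w wx wc' => cD' w wc' (eball_bdist oD Dx wx)).
have e2 := tangent_balls_opposite rho0 rho'0 zc zc'
  (fun w wx wc' => cD' w wc' (cD w wx)).
have rn0 : rho != 0 by rewrite gt_eqF.
have rn0' : rho' != 0 by rewrite gt_eqF.
(* Eliminating the exterior centre [c'] from the two relations puts [x] on the ray from [z] through
   the interior centre. *)
have xE : x = z + (bdist D x / rho) *: (c - z).
  apply/rowP => i.
  have := congr1 (fun u : 'rV[R]_n => u 0 i) e1.
  have := congr1 (fun u : 'rV[R]_n => u 0 i) e2.
  rewrite !mxE; move: (bdist D x) => d f2 f1.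
  have g1 : rho' * (x 0 i - z 0 i) = - (d * (c' 0 i - z 0 i)) by lra.
  have g2 : rho' * (c 0 i - z 0 i) = - (rho * (c' 0 i - z 0 i)) by lra.
  have g3 : c' 0 i - z 0 i = - (rho' * (c 0 i - z 0 i) / rho).
    by rewrite g2; field.
  have : rho' * (x 0 i - z 0 i) = rho' * (d / rho * (c 0 i - z 0 i)).
    by rewrite g1 g3; field.
  by move=> /(mulfI rn0'); lra.
exists (z + (rad / rho) *: (c - z)).
  apply: subset_trans cD; apply: eball_sub.
  have -> : c - (z + (rad / rho) *: (c - z)) = (1 - rad / rho) *: (c - z).
    by apply/rowP => i; rewrite !mxE; ring.
  have : 0 <= 1 - rad / rho by rewrite subr_ge0 ler_pdivrMr// mul1r; lra.
  rewrite enormZ => /ger0_norm ->; rewrite (enormB c z) zc.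
  by rewrite le_eqVlt; apply/orP; left; apply/eqP; field.
have -> : z + (rad / rho) *: (c - z) - x = ((rad - bdist D x) / rho) *: (c - z).
  rewrite {1}xE; apply/rowP => i; rewrite !mxE; ring.
have : 0 <= (rad - bdist D x) / rho by rewrite divr_ge0 ?subr_ge0// ltW.
rewrite enormZ => /ger0_norm ->; rewrite (enormB c z) zc.
by rewrite divfK.
Qed.

(** The average of the two largest balls lies in [D] by convexity. The comparability of the two
    profiles rests on this bound. *)
Lemma bdist_midpoint_ge D x y : open D -> boundary D !=set0 ->
  convex_set (D : set (convex_lmodType 'rV[R]_n)) -> D x -> D y ->
  bdist D x + bdist D y <= 2 * bdist D (midpoint x y).
Proof.
move=> oD bD cD Dx Dy.
have h : 2^-1 * (bdist D x + bdist D y) <= bdist D (midpoint x y).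
  apply: bdist_ge => //.
  have l2 : 0 <= (2^-1 : R) <= 1 by apply/andP; split; lra.
  have := convex_eball cD (bdist_gt0 oD bD Dx) (bdist_gt0 oD bD Dy)
    (eball_bdist oD Dx) (eball_bdist oD Dy) l2.
  by congr (eball _ _ `<=` _); [rewrite /midpoint scalerDr; congr (_ *: _ + _)|]; lra.
by lra.
Qed.

End geometry.

(** * Profiles and the lower bound *)

Section profiles.
Variable R : realType.

(* In units of [s], the case [m <= s] reduces to the first term of the sum and the
   case [s <= m] to the second one. *)
Lemma profile_le_sum (a b m s t : R) : 0 < a -> 0 < b -> 0 < m -> 0 < s -> s ^+ 2 = t ->
  a + b <= 2 * m ->
  Num.min 1 (a * (m + s) / t) * Num.min 1 (b * (m + s) / t) <=
    4 * (Num.min 1 (a * b / t) + Num.min 1 (a * m / t) * Num.min 1 (b * m / t)) /\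
  Num.min 1 (a * b / t) + Num.min 1 (a * m / t) * Num.min 1 (b * m / t) <=
    3 * (Num.min 1 (a * (m + s) / t) * Num.min 1 (b * (m + s) / t)).
Proof.
move=> a0 b0 m0 s0 st abm.
pose A := a / s; pose B := b / s; pose M := m / s.
have sn0 : s != 0 by rewrite gt_eqF.
have -> : a * (m + s) / t = A * (M + 1) by rewrite -st /A /M; field.
have -> : b * (m + s) / t = B * (M + 1) by rewrite -st /B /M; field.
have -> : a * b / t = A * B by rewrite -st /A /B; field.
have -> : a * m / t = A * M by rewrite -st /A /M; field.
have -> : b * m / t = B * M by rewrite -st /B /M; field.
have A0 : 0 < A by rewrite divr_gt0.
have B0 : 0 < B by rewrite divr_gt0.
have M0 : 0 < M by rewrite divr_gt0.
have ABM : A + B <= 2 * M.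
  by rewrite -mulrDl mulrA ler_pM2r ?invr_gt0.
move: A B M A0 B0 M0 ABM {sn0 st abm} => A B M A0 B0 M0 ABM.
have mn (u : R) : 0 < u -> 0 <= Num.min 1 u.
  by move=> u0; rewrite le_min ler01 ltW.
have AM0 : 0 < A * M by rewrite mulr_gt0.
have BM0 : 0 < B * M by rewrite mulr_gt0.
have AB0 : 0 < A * B by rewrite mulr_gt0.
have AM1 : 0 < A * (M + 1) by rewrite mulr_gt0// addr_gt0.
have BM1 : 0 < B * (M + 1) by rewrite mulr_gt0// addr_gt0.
have min_mul (u k : R) : 1 <= k -> 0 <= u -> Num.min 1 (k * u) <= k * Num.min 1 u.
  move=> k1 u0; rewrite minr_pMr; last by lra.
  by rewrite mulr1 le_min !ge_min k1 lexx !orbT.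
have min_le (u w : R) : u <= w -> Num.min 1 u <= Num.min 1 w.
  by move=> uw; rewrite le_min !ge_min lexx uw orbT.
have two : 1 <= (2 : R) by lra.
split.
- have [M1|M1] := leP M 1.
    have h1 : Num.min 1 (A * (M + 1)) <= 2 * Num.min 1 A.
      by apply: le_trans (min_mul _ _ two (ltW A0)); apply: min_le; nra.
    have h2 : Num.min 1 (B * (M + 1)) <= 2 * Num.min 1 B.
      by apply: le_trans (min_mul _ _ two (ltW B0)); apply: min_le; nra.
    have h3 := ler_pM (mn _ AM1) (mn _ BM1) h1 h2.
    apply: le_trans h3 _.
    have h4 : Num.min 1 A * Num.min 1 B <= Num.min 1 (A * B).
      rewrite le_min; apply/andP; split.
        rewrite -[leRHS]mulr1; apply: ler_pM; rewrite ?mn//; by rewrite ge_min lexx.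
      by apply: ler_pM; rewrite ?mn// ge_min lexx orbT.
    have := mulr_ge0 (mn _ AM0) (mn _ BM0); lra.
  have h1 : Num.min 1 (A * (M + 1)) <= 2 * Num.min 1 (A * M).
    by apply: le_trans (min_mul _ _ two (ltW AM0)); apply: min_le; nra.
  have h2 : Num.min 1 (B * (M + 1)) <= 2 * Num.min 1 (B * M).
    by apply: le_trans (min_mul _ _ two (ltW BM0)); apply: min_le; nra.
  have h3 := ler_pM (mn _ AM1) (mn _ BM1) h1 h2.
  by apply: le_trans h3 _; have := mn _ AB0; lra.
have h1 : Num.min 1 (A * M) <= Num.min 1 (A * (M + 1)) by apply: min_le; nra.
have h2 : Num.min 1 (B * M) <= Num.min 1 (B * (M + 1)) by apply: min_le; nra.
have h3 := ler_pM (mn _ AM0) (mn _ BM0) h1 h2.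
suff : Num.min 1 (A * B) <= 2 * (Num.min 1 (A * (M + 1)) * Num.min 1 (B * (M + 1))).
  by lra.
(* When exactly one minimum equals 1, [A + B <= 2 M] yields [A B <= 2 B (M + 1)] or
   [A B <= 2 A (M + 1)]. *)
have [x1|x1] := leP 1 (A * (M + 1)); have [y1|y1] := leP 1 (B * (M + 1)).
- by rewrite !mulr1 ge_min; apply/orP; left.
- by rewrite ge_min; apply/orP; right; nra.
- by rewrite ge_min; apply/orP; right; nra.
- rewrite ge_min; apply/orP; right.
  have -> : A * (M + 1) * (B * (M + 1)) = A * B * (M + 1) ^+ 2 by ring.
  have : 1 <= (M + 1) ^+ 2 by nra.
  by nra.
Qed.

End profiles.

(** * Choice of the moving ball *)

Section lower_bound.
Variables (R : realType) (n : nat).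
Implicit Types (D : set 'rV[R]_n) (x y c v : 'rV[R]_n).

Lemma expR_log_gauss (t : R) x y : 0 < t ->
  expR (log_gauss t x y) = gauss_kernel t x y * Num.sqrt (4 * pi) ^+ n.
Proof.
move=> t0; have p0 : 0 < 4 * pi :> R by rewrite mulr_gt0// pi_gt0.
have q0 : 0 < Num.sqrt (4 * pi) :> R by rewrite sqrtr_gt0.
have S : Num.sqrt (4 * pi) ^+ n = expR (n%:R / 2 * ln (4 * pi)) :> R.
  rewrite -[LHS]lnK ?posrE ?exprn_gt0//; congr expR.
  rewrite lnXn// -[in RHS](sqr_sqrtr (ltW p0)) lnXn//.
  by rewrite -(mulr_natr (ln _) n) -(mulr_natr (ln _) 2); field.
rewrite S /gauss_kernel /powR gt_eqF; last by rewrite mulr_gt0.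
rewrite -!expRD; congr expR; rewrite lnM ?posrE//.
rewrite /log_gauss /sqd scaler0 subr0 sqr_enorm; ring.
Qed.

(** Each of the two terms of the clock grows by at most [4 K]; multiplied by the coefficient
    [2 tube_rate^2] this gives the 16. *)
Lemma tube_barrier_final_ge y c v (rad kap t K : R) x : tube_ok rad kap t ->
  dot (c - y) (c - y) < rad ^+ 2 -> sqd c v t x < rad ^+ 2 ->
  t <= K * (rad * (rad + kap * t)) ->
  expR (log_gauss t x y) * handover y c rad *
    expR (- 16 * tube_rate R n ^+ 2 * K) *
    (expR (- tube_rate R n) * (tube_rate R n * (1 - sqd c v t x / rad ^+ 2))) <=
  tube_barrier y c v rad kap t (handover_const y c rad kap t) t x.
Proof.
move=> ok he hx hK; have [rad0 kap0 rt _ _] := ok.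
have r20 : 0 < rad ^+ 2 by rewrite exprn_gt0.
have t0 : 0 < t by exact: lt_trans rt.
rewrite tube_barrierE.
have tt : tube_radius rad kap t t = rad.
  by rewrite /tube_radius subrr mulr0 mul0r addr0.
have h0 := handover_gt0 rad0 he.
have al4 := tube_rate_ge4 R n.
rewrite tt -(mulrA _ (handover _ _ _)).
apply: ler_pM.
- by apply: mulr_ge0; [exact: expR_ge0|apply: mulr_ge0; [exact: ltW|exact: expR_ge0]].
- apply: mulr_ge0; first exact: expR_ge0.
  apply: mulr_ge0; first by lra.
  by rewrite subr_ge0 ler_pdivrMr// mul1r ltW.
- rewrite ler_pM2l ?expR_gt0// /tube_a1 /handover_const.
  have -> : ln (handover y c rad) + 2 * tube_rate R n ^+ 2 * tube_clock rad kap t (rad ^+ 2) +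
      - (2 * tube_rate R n ^+ 2) * tube_clock rad kap t t =
      ln (handover y c rad) - 2 * tube_rate R n ^+ 2 *
       (tube_clock rad kap t t - tube_clock rad kap t (rad ^+ 2)) by ring.
  rewrite expRD lnK ?posrE// ler_pM2l// ler_expR.
  have clk : tube_clock rad kap t t - tube_clock rad kap t (rad ^+ 2) <= 8 * K.
    have u0 : 0 <= t - rad ^+ 2 by rewrite subr_ge0 ltW.
    have dpos u : 0 <= u -> 0 < rad / 2 + kap / 2 * u.
      by move=> ?; have := mulr_ge0 kap0 (y := u); rewrite -(mulrA kap) => /(_ _); nra.
    have d1 := dpos _ (ltW t0); have d2 := dpos _ u0; have d3 := dpos _ (ltW r20).
    have c1 : 0 <= rad ^+ 2 * (rad / 2 * (rad / 2 + kap / 2 * rad ^+ 2))^-1.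
      by rewrite mulr_ge0 ?invr_ge0 ?mulr_ge0 ?ltW// divr_gt0.
    have c2 : (t - rad ^+ 2) * (rad / 2 * (rad / 2 + kap / 2 * (t - rad ^+ 2)))^-1 <=
       t * (rad / 2 * (rad / 2 + kap / 2 * t))^-1.
      rewrite ler_pdivrMr; last by rewrite mulr_gt0// divr_gt0.
      rewrite mulrAC ler_pdivlMr; last by rewrite mulr_gt0// divr_gt0.
      have -> : (t - rad ^+ 2) * (rad / 2 * (rad / 2 + kap / 2 * t)) =
         rad / 2 * ((t - rad ^+ 2) * (rad / 2 + kap / 2 * t)) by ring.
      have -> : t * (rad / 2 * (rad / 2 + kap / 2 * (t - rad ^+ 2))) =
         rad / 2 * (t * (rad / 2 + kap / 2 * (t - rad ^+ 2))) by ring.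
      rewrite ler_pM2l ?divr_gt0//.
      have := mulr_gt0 r20 rad0; lra.
    have c3 : t * (rad / 2 * (rad / 2 + kap / 2 * t))^-1 <= 4 * K.
      rewrite ler_pdivrMr; last by rewrite mulr_gt0// divr_gt0.
      by lra.
    rewrite /tube_clock subrr mul0r subr0; lra.
  have : 2 * tube_rate R n ^+ 2 * (tube_clock rad kap t t - tube_clock rad kap t (rad ^+ 2))
    <= 2 * tube_rate R n ^+ 2 * (8 * K).
    by rewrite ler_wpM2l// mulr_ge0// sqr_ge0.
  by lra.
- apply: expR_diff_ge; first by lra.
  by rewrite ler_pdivrMr// mul1r ltW.
Qed.

(** This is [1 - (1 - a)^2 >= a] for [a = mn / rad] in [[0, 1]]. *)
Lemma defect_ge (rad mn q : R) : 0 < rad -> 0 <= mn <= rad -> 0 <= q <= rad - mn ->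
  mn / rad <= 1 - q ^+ 2 / rad ^+ 2.
Proof.
move=> r0 /andP[m0 m1] /andP[q0 q1].
have -> : 1 - q ^+ 2 / rad ^+ 2 = (rad ^+ 2 - q ^+ 2) / rad ^+ 2.
  by field; rewrite gt_eqF.
rewrite ler_pdivlMr ?exprn_gt0//.
have -> : mn / rad * rad ^+ 2 = mn * rad by field; rewrite gt_eqF.
have : q ^+ 2 <= (rad - mn) ^+ 2 by rewrite ler_pXn2r// nnegrE; lra.
by nra.
Qed.

(** The constant [Lam]: 8 gives [rad <= sqrt t / 8] and [rad * d <= t / 8], the quotient gives
    [rad <= r]. *)
Definition shape_const (r T : R) : R := 8 + Num.sqrt T / r.

(** The damping at the hand-over, the loss of the long stage with [K = 4 Lam^2], and the slope of
    the final bump; [1/8] remains after [tube_rate] cancels. *)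
Definition kernel_const (r T : R) : R :=
  expR (- pole_lambda n%:R - 4 * pole_beta n%:R) *
  expR (- 16 * tube_rate R n ^+ 2 * (4 * shape_const r T ^+ 2)) *
  expR (- tube_rate R n) / 8.

Lemma kernel_const_gt0 r T : 0 < kernel_const r T.
Proof. by rewrite divr_gt0// !mulr_gt0 ?expR_gt0. Qed.

(** [d1] is the radius available halfway and [kap] solves [rad + kap * t / 2 = d1]. The maximum with
    [rad] covers points close to the boundary, where [dm - rad] may be small or negative. *)
Lemma tube_radii (r T t dm : R) (d := dm + Num.sqrt t) :
  0 < r -> 0 < t -> t < T -> 0 < dm ->
  exists2 rad, 0 < rad & let d1 := Num.max rad (dm - rad) in
    [/\ rad <= r, rad * d <= t, tube_ok rad (2 * (d1 - rad) / t) t &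
        t <= 4 * shape_const r T ^+ 2 * (rad * (rad + 2 * (d1 - rad) / t * t))].
Proof.
move=> r0 t0 tT dm0.
pose Lam := shape_const r T.
have sT : 0 <= Num.sqrt T / r by rewrite divr_ge0// ?sqrtr_ge0// ltW.
have L8 : 8 <= Lam by rewrite /Lam /shape_const; lra.
have radr0 : Num.sqrt t <= Lam * r.
  have -> : Lam * r = 8 * r + Num.sqrt T.
    by rewrite /Lam /shape_const; field; rewrite gt_eqF.
  have : Num.sqrt t <= Num.sqrt T by rewrite ler_wsqrtr// ltW.
  by lra.
rewrite -/Lam; move: (Lam) L8 radr0 => {}Lam L8 radr0 {sT tT}.
have s0 : 0 < Num.sqrt t by rewrite sqrtr_gt0.
have st : t = Num.sqrt t * Num.sqrt t by rewrite -expr2 sqr_sqrtr// ltW.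
move: (Num.sqrt t) s0 st radr0 @d => s s0 st radr0 d.
have d0 : 0 < d by rewrite addr_gt0.
have L0 : 0 < Lam by lra.
exists (t / (Lam * d)); first by rewrite divr_gt0// mulr_gt0.
set rad := t / _.
have rad0 : 0 < rad by rewrite divr_gt0// mulr_gt0.
have radE : rad * (Lam * d) = t by rewrite divfK// gt_eqF// mulr_gt0.
have sd : s <= d by rewrite lerDr ltW.
have rads : rad * Lam <= s.
  rewrite -(ler_pM2r s0) -st -radE -mulrA ler_pM2l//.
  by rewrite ler_pM2l.
have rad8 : rad * 8 <= s by apply: le_trans rads; rewrite ler_pM2l.
set d1 := Num.max _ _.
have d1r : rad <= d1 by rewrite le_max lexx.
have d1m : dm - rad <= d1 by rewrite le_max lexx orbT.
have d1d : d1 <= d.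
  rewrite ge_max; apply/andP; split; last by rewrite /d; lra.
  by apply: le_trans sd; lra.
have d10 : 0 < d1 by exact: lt_le_trans d1r.
have kapt : 2 * (d1 - rad) / t * t = 2 * (d1 - rad) by rewrite divfK// gt_eqF.
have rd : rad * d * 8 <= t.
  by rewrite -radE -mulrA ler_pM2l// mulrC ler_pM2r.
have rr : rad * rad <= t / 64.
  have h : rad <= s / 8 by lra.
  by have := ler_pM (ltW rad0) (ltW rad0) h h; rewrite st; lra.
have krad : rad * (2 * (d1 - rad) / t) <= 1 / 2.
  rewrite -(ler_pM2r t0) -(mulrA rad) kapt.
  have : rad * d1 <= rad * d by rewrite ler_pM2l.
  by have := mulr_gt0 rad0 rad0; lra.
split.
- by rewrite -(ler_pM2r L0); apply: le_trans rads _; rewrite mulrC.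
- by have := mulr_gt0 rad0 d0; lra.
- split => //.
  + by rewrite divr_ge0 ?(ltW t0)// mulr_ge0// subr_ge0.
  + by rewrite expr2; lra.
  + by have := ler_wpM2r (ltW rad0) krad; move: (2 * _ / t) => kap; lra.
  + by apply: le_trans krad _; lra.
rewrite kapt.
(* If [sqrt t <= dm], then [d1] is comparable to [dm]; otherwise [d^2 <= 4 t = 4 rad Lam d] and
   [rad <= d1] suffices. *)
have dL : d <= d1 * (4 * Lam).
  have [h|h] := leP s dm.
    have h4 : d <= d1 * 4 by rewrite /d; lra.
    by apply: le_trans h4 _; rewrite ler_pM2l//; lra.
  have h4 : d <= rad * (4 * Lam).
    rewrite -(ler_pM2r d0).
    have -> : rad * (4 * Lam) * d = 4 * t by rewrite -radE; ring.
    have h2 : d <= 2 * s by rewrite /d; lra.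
    by have := ler_pM (ltW d0) (ltW d0) h2 h2; rewrite st; lra.
  by apply: le_trans h4 _; rewrite ler_wpM2r//; lra.
have h1 : rad * (Lam * d) <= rad * (Lam * (d1 * (4 * Lam))).
  by rewrite ler_pM2l// ler_pM2l.
rewrite -{1}radE; apply: le_trans h1 _.
have -> : rad * (Lam * (d1 * (4 * Lam))) = 4 * Lam ^+ 2 * (rad * d1) by ring.
apply: ler_wpM2l; first by apply: mulr_ge0 => //; exact: sqr_ge0.
by apply: ler_wpM2l; [exact: ltW|lra].
Qed.

Lemma dot_lt_sqr (z : 'rV[R]_n) (q : R) : 0 < q -> (dot z z < q ^+ 2) = (enorm z < q).
Proof. by move=> q0; rewrite -sqr_enorm ltr_pXn2r// nnegrE ?enorm_ge0// ltW. Qed.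

Lemma moving_ball_subset D c c' (rad t : R) (v := t^-1 *: (c' - c)) :
  convex_set (D : set (convex_lmodType 'rV[R]_n)) -> 0 < rad -> 0 < t ->
  eball c rad `<=` D -> eball c' rad `<=` D ->
  forall u z, 0 < u <= t -> sqd c v u z < rad ^+ 2 -> D z.
Proof.
move=> cD rad0 t0 cyD cxD u z /andP[u0 u1]; rewrite dot_lt_sqr// => hz.
have l01 : 0 <= u / t <= 1.
  apply/andP; split; first by rewrite divr_ge0// ltW.
  by rewrite ler_pdivrMr// mul1r.
apply: (convex_eball cD rad0 rad0 cyD cxD l01); rewrite /eball /=.
have -> : (1 - u / t) * rad + u / t * rad = rad by ring.
have -> : z - ((1 - u / t) *: c + (u / t) *: c') = z - c - u *: v.
  by rewrite /v; apply/rowP => i; rewrite !mxE; ring.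
exact: hz.
Qed.

(** Up to time [t / 2] the ball lies in an average of the balls at [c] and [mid], afterwards in one
    of the balls at [c'] and [mid]; the radius lies below both linear interpolations. *)
Lemma tube_subset D c c' (rad d1 t : R) (v := t^-1 *: (c' - c))
    (kap := 2 * (d1 - rad) / t) :
  convex_set (D : set (convex_lmodType 'rV[R]_n)) -> tube_ok rad kap t -> 0 < d1 ->
  eball c rad `<=` D -> eball c' rad `<=` D ->
  eball ((1 - 2^-1) *: c + 2^-1 *: c') d1 `<=` D ->
  forall u z, rad ^+ 2 <= u <= t -> sqd c v u z < tube_radius rad kap t u ^+ 2 -> D z.
Proof.
set mid := _ + 2^-1 *: c'.
move=> cD ok d10 cyD cxD midD u z uab; have [rad0 kap0 rt _ _] := ok.
have /andP[u0 u1] := uab.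
have ra := tube_radius_ge ok uab.
rewrite dot_lt_sqr; last exact: lt_le_trans ra.
move=> hz.
have r2 := sqr_ge0 rad.
have t0 : 0 < t by exact: le_lt_trans rt.
have tn0 : t != 0 by rewrite gt_eqF.
have up : 0 < u by apply: lt_le_trans u0; rewrite exprn_gt0.
have tr1 : tube_radius rad kap t u <= rad + kap * u.
  apply: le_trans (tube_radius_le ok uab) _.
  by rewrite lerD2l ler_wpM2l//; lra.
have tr2 : tube_radius rad kap t u <= rad + kap * (t - u).
  have -> : tube_radius rad kap t u = rad + kap * ((t - u) * ((u - rad ^+ 2) / t)).
    by rewrite /tube_radius; ring.
  rewrite lerD2l ler_wpM2l// ler_piMr ?subr_ge0//.
  by rewrite ler_pdivrMr// mul1r; lra.
have [h|h] := leP u (t / 2).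
  have l01 : 0 <= 2 * u / t <= 1.
    apply/andP; split; first by rewrite divr_ge0 ?mulr_ge0// ltW.
    by rewrite ler_pdivrMr// mul1r; lra.
  apply: (convex_eball cD rad0 d10 cyD midD l01); rewrite /eball /=.
  have -> : (1 - 2 * u / t) * rad + 2 * u / t * d1 = rad + kap * u.
    by rewrite /kap; field.
  have -> : z - ((1 - 2 * u / t) *: c + (2 * u / t) *: mid) = z - c - u *: v.
    by rewrite /v /mid; apply/rowP => i; rewrite !mxE; field.
  exact: lt_le_trans hz tr1.
have l01 : 0 <= 2 * (t - u) / t <= 1.
  apply/andP; split; first by rewrite divr_ge0 ?mulr_ge0 ?subr_ge0// ltW.
  by rewrite ler_pdivrMr// mul1r; lra.
apply: (convex_eball cD rad0 d10 cxD midD l01); rewrite /eball /=.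
have -> : (1 - 2 * (t - u) / t) * rad + 2 * (t - u) / t * d1 = rad + kap * (t - u).
  by rewrite /kap; field.
have -> : z - ((1 - 2 * (t - u) / t) *: c' + (2 * (t - u) / t) *: mid) = z - c - u *: v.
  by rewrite /v /mid; apply/rowP => i; rewrite !mxE; field.
exact: lt_le_trans hz tr2.
Qed.

Lemma tube_exists D (r T t : R) x y (d := bdist D (midpoint x y) + Num.sqrt t) :
  0 < r -> domain D -> convex_set (D : set (convex_lmodType 'rV[R]_n)) ->
  C11_class r D -> D x -> D y -> 0 < t -> t < T ->
  exists (c v : 'rV[R]_n) (rad kap : R),
  [/\ tube_ok rad kap t,
      t <= 4 * shape_const r T ^+ 2 * (rad * (rad + kap * t)),
      forall u z, 0 < u <= t -> sqd c v u z < rad ^+ 2 -> D z &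
      forall u z, rad ^+ 2 <= u <= t ->
        sqd c v u z < tube_radius rad kap t u ^+ 2 -> D z] /\
  [/\ dot (c - y) (c - y) < rad ^+ 2, sqd c v t x < rad ^+ 2,
      Num.min 1 (bdist D x * d / t) <= 1 - sqd c v t x / rad ^+ 2 &
      Num.min 1 (bdist D y * d / t) <= 1 - dot (c - y) (c - y) / rad ^+ 2].
Proof.
move=> r0 dD cD C11 Dx Dy t0 tT; have [oD _ bD] := dD.
pose m := midpoint x y.
have half01 : 0 <= (2^-1 : R) <= 1 by apply/andP; split; lra.
have Dm : D m.
  have -> : m = (1 - 2^-1) *: x + 2^-1 *: y.
    by rewrite /m /midpoint; apply/rowP => i; rewrite !mxE; field.
  exact: convex_comb.
have dm0 : 0 < bdist D m by exact: bdist_gt0.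
have [rad rad0 /= [radr rd ok K]] := tube_radii r0 t0 tT dm0.
have [cx cxD hcx] := interior_tangent_ball dD C11 rad0 radr Dx.
have [c cyD hcy] := interior_tangent_ball dD C11 rad0 radr Dy.
set d1 := Num.max _ _ in ok K.
have d10 : 0 < d1 by rewrite lt_max rad0.
have mn (w : 'rV[R]_n) : D w -> 0 < Num.min (bdist D w) rad <= rad.
  by move=> Dw; rewrite lt_min bdist_gt0// rad0 ge_min lexx orbT.
have /andP[mx0 mx1] := mn x Dx; have /andP[my0 my1] := mn y Dy.
have midD : eball ((1 - 2^-1) *: c + 2^-1 *: cx) d1 `<=` D.
  (* For [d1 = dm - rad] the centre is within [rad] of the midpoint [m]; for [d1 = rad] the ball is
     the average of the two end balls. *)
  rewrite /d1 maxEle; case: ifP => _.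
    apply: subset_trans (eball_bdist oD Dm); apply: eball_sub.
    have -> : m - ((1 - 2^-1) *: c + 2^-1 *: cx) = 2^-1 *: (x - cx) + 2^-1 *: (y - c).
      by rewrite /m /midpoint; apply/rowP => i; rewrite !mxE; field.
    apply: le_trans (ler_enormD _ _) _; rewrite !enormZ (enormB x) (enormB y).
    rewrite ger0_norm; last by case/andP: half01.
    by move: hcx hcy mx0 my0; rewrite -/m; lra.
  have := convex_eball cD rad0 rad0 cyD cxD half01.
  by congr (eball _ _ `<=` _); lra.
pose v := t^-1 *: (cx - c).
have xcx : x - c - t *: v = x - cx.
  by rewrite /v scalerA divff ?gt_eqF// scale1r; apply/rowP => i; rewrite !mxE; ring.
(* By [rad * d <= t], the relative depth [bdist D w / rad] dominates [bdist D w * d / t]. *)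
have prof (w : 'rV[R]_n) (q : R) : D w -> 0 <= q <= rad - Num.min (bdist D w) rad ->
    Num.min 1 (bdist D w * d / t) <= 1 - q ^+ 2 / rad ^+ 2.
  move=> Dw hq; have /andP[w0 w1] := mn w Dw.
  have := @defect_ge rad (Num.min (bdist D w) rad) q rad0 _ hq.
  rewrite (ltW w0) w1 => /(_ isT); apply: le_trans.
  have [h|h] := leP (bdist D w) rad; last first.
    by rewrite divff ?gt_eqF// ge_min lexx.
  rewrite ge_min; apply/orP; right; rewrite -mulrA ler_pM2l ?bdist_gt0//.
  by rewrite ler_pdivrMr// mulrC ler_pdivlMr// mulrC.
exists c, v, rad, (2 * (d1 - rad) / t); split; split => //.
- exact: moving_ball_subset.
- exact: tube_subset.
- by rewrite dot_lt_sqr//; lra.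
- by rewrite /sqd xcx dot_lt_sqr// enormB; lra.
- rewrite /sqd xcx -sqr_enorm; apply: prof => //.
  by rewrite enorm_ge0/= enormB.
- rewrite -sqr_enorm; apply: prof => //.
  by rewrite enorm_ge0.
Qed.

End lower_bound.

Section main_bound.
Variables (R : realType) (n : nat).
Implicit Types (D : set 'rV[R]_n) (x y c v : 'rV[R]_n).

Lemma dirichlet_kernel_ge D pD (r T t : R) x y : (0 < n)%N -> 0 < r -> 0 < T ->
  domain D -> convex_set (D : set (convex_lmodType 'rV[R]_n)) -> C11_class r D ->
  dirichlet_heat_kernel D pD -> D x -> D y -> 0 < t -> t < T ->
  kernel_const n r T * gauss_kernel t x y * lower_profile D t x y <= pD t x y.
Proof.
move=> n0 r0 T0 dD cD C11 hpD Dx Dy t0 tT.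
have [oD _ bD] := dD.
pose Lam := shape_const r T.
pose m := midpoint x y; pose d := bdist D m + Num.sqrt t.
have dm0 : 0 <= bdist D m by exact: bdist_ge0.
have d0 : 0 < d by rewrite ltr_wpDl// sqrtr_gt0.
have [c [v [rad [kap [[ok K B1 B2] [he hx px py]]]]]] := tube_exists r0 dD cD C11 Dx Dy t0 tT.
rewrite -/m -/d in px py.
have upper := kernel_ge_tube_barrier n0 oD hpD Dx Dy ok he B1 B2 hx.
have lower := tube_barrier_final_ge ok he hx K.
have S0 : 0 < Num.sqrt (4 * pi) ^+ n :> R.
  by rewrite exprn_gt0// sqrtr_gt0 mulr_gt0// pi_gt0.
rewrite -(ler_pM2r S0); apply: le_trans upper; apply: le_trans lower.
rewrite expR_log_gauss//.
have g0 : 0 <= gauss_kernel t x y by rewrite mulr_ge0 ?powR_ge0 ?expR_ge0.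
have al4 := tube_rate_ge4 R n.
have p0 (w : 'rV[R]_n) : D w -> 0 <= Num.min 1 (bdist D w * d / t).
  by move=> Dw; rewrite le_min ler01 divr_ge0 ?(ltW t0)// mulr_ge0 ?(ltW d0)// bdist_ge0.
have main := ler_pM (p0 x Dx) (p0 y Dy) px py.
rewrite /lower_profile -/m -/d /kernel_const -/Lam /handover.
move: main; set Px := Num.min _ _; set Py := Num.min _ _.
move: (1 - sqd c v t x / rad ^+ 2) (1 - dot (c - y) (c - y) / rad ^+ 2) => qx qy main.
move: (expR (- pole_lambda _ - _)) (expR_ge0 (- pole_lambda n%:R - 4 * pole_beta n%:R : R)) => E1 E10.
move: (expR (- 16 * _ * _)) (expR_ge0 (- 16 * tube_rate R n ^+ 2 * (4 * Lam ^+ 2))) => E2 E20.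
move: (expR (- tube_rate R n)) (expR_ge0 (- tube_rate R n)) => E3 E30.
have an0 : tube_rate R n != 0 by rewrite gt_eqF//; lra.
move: g0 S0; move: (gauss_kernel t x y) (Num.sqrt (4 * pi) ^+ n) => Gk S g0 S0.
have -> : Gk * S * (E1 * (qy / 2) / (4 * tube_rate R n)) * E2 * (E3 * (tube_rate R n * qx))
   = Gk * S * E1 * E2 * E3 / 8 * (qx * qy).
  by move: an0; move: (tube_rate R n) => al an0; field.
have -> : E1 * E2 * E3 / 8 * Gk * (Px * Py) * S = Gk * S * E1 * E2 * E3 / 8 * (Px * Py).
  by ring.
by rewrite ler_wpM2l// !mulr_ge0// ltW.
Qed.

End main_bound.

Theorem theorem4p3 (R : realType) (n : nat) (hn : (0 < n)%N) :
  exists c1 c2 : R, 0 < c1 /\ 0 < c2 /\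
  forall r T : R, 0 < r -> 0 < T ->
  exists C : R, 0 < C /\
  forall D : set 'rV[R]_n,
    domain D ->
    convex_set (D : set (convex_lmodType 'rV[R]_n)) ->
    C11_class r D ->
    (forall pD, dirichlet_heat_kernel D pD ->
       forall (t : R) (x y : 'rV[R]_n), D x -> D y -> 0 < t -> t < T ->
         C * gauss_kernel t x y * lower_profile D t x y <= pD t x y) /\
    (forall (t : R) (x y : 'rV[R]_n), D x -> D y -> 0 < t -> t < T ->
       c1 <= (C * gauss_kernel t x y * lower_profile D t x y) /
             (C * gauss_kernel t x y * sum_profile D t x y) <= c2).
Proof.
(* The constants of [profile_le_sum]; the common factor of numerator and denominator cancels. *)
exists 3^-1, 4; split; first by rewrite invr_gt0.
split => // r T r0 T0; exists (kernel_const n r T); split.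
  exact: kernel_const_gt0.
move=> D dD cD C11; split=> [pD hpD t x y Dx Dy t0 tT|t x y Dx Dy t0 tT].
  exact: dirichlet_kernel_ge.
have [oD _ bD] := dD.
have g0 : 0 < kernel_const n r T * gauss_kernel t x y.
  rewrite mulr_gt0 ?kernel_const_gt0// mulr_gt0 ?expR_gt0// powR_gt0//.
  by rewrite !mulr_gt0// pi_gt0.
have a0 := bdist_gt0 oD bD Dx; have b0 := bdist_gt0 oD bD Dy.
have abm := bdist_midpoint_ge oD bD cD Dx Dy.
have m0 : 0 < bdist D (midpoint x y) by lra.
have s0 : 0 < Num.sqrt t by rewrite sqrtr_gt0.
have st : Num.sqrt t ^+ 2 = t by rewrite sqr_sqrtr// ltW.
have [h1 h2] := profile_le_sum a0 b0 m0 s0 st abm.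
rewrite -/(lower_profile D t x y) -/(sum_profile D t x y) in h1 h2.
have S0 : 0 < sum_profile D t x y.
  rewrite ltr_pwDl ?lt_min ?ltr01 ?divr_gt0 ?mulr_gt0//.
  by rewrite mulr_ge0// le_min ler01 divr_ge0 ?mulr_ge0// ltW.
rewrite -mulf_div divff ?gt_eqF// mul1r.
by rewrite ler_pdivlMr// ler_pdivrMr//; apply/andP; split; lra.
Qed.
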